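(* Let $\omega(n)=\sqrt{(n+n^3)\tanh(n)}$ (the dispersion relation of the gravity–capillary wave equation) and let $g$ be a non-constant step function on $\mathbb T=\mathbb R/(2\pi\mathbb Z)$. Then $D_t(\omega,g)\in\left[\frac54,\frac74\right]$ for all $t\neq0$, and $D_t(\omega,g)\in\left[\frac{11}8,\frac{13}8\right]$ for a.e. $t$ characterized by Khinchin–Lévy numbers, namely for every $t\neq0$ such that $\frac{4}{27}\left(\frac{t}{2\pi}\right)^{-2}$ is Khinchin–Lévy (a condition satisfied by a.e. $t$).
   Context: $e^{itL_\omega}g(x)=\sum_{n\in\mathbb Z}\widehat g(n)e^{it\omega(n)+inx}$, and $D_t(\omega,g)$ is the maximum of the fractal dimensions of the graphs of the real and imaginary parts of $e^{itL_\omega}g$ as functions of $x$ (continuous representatives). A step function is a finite linear combination of indicator functions of intervals (arcs). The fractal (upper box-counting) dimension of a bounded set $E$ is $\limsup_{\epsilon\to0}\frac{\log\mathcal N(E,\epsilon)}{\log(1/\epsilon)}$, with $\mathcal N(E,\epsilon)$ the minimum number of $\epsilon$-balls needed to cover $E$. A number $\beta\notin\mathbb Q$ is called Khinchin–Lévy if there is a strictly increasing sequence $\{q_n\}_{n\in\mathbb N}$ of natural numbers such that for every $\epsilon>0$, $q_{n+1}\le q_n^{1+\epsilon}$ for all $n>N_\epsilon$, and for each $n$ there is an $a_n$ coprime to $q_n$ with $|\beta-\frac{a_n}{q_n}|\le\frac1{q_n^2}$; a.e. $\beta\in\mathbb R$ is Khinchin–Lévy. *)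

(* Defs.v *)
From HB Require Import structures.
From mathcomp Require Import all_boot all_order all_algebra.
From mathcomp Require Import complex.
From mathcomp Require Import all_classical all_reals all_analysis.

Set Implicit Arguments.
Unset Strict Implicit.
Unset Printing Implicit Defensive.

Import Order.TTheory GRing.Theory Num.Theory.
Import numFieldNormedType.Exports.

Local Open Scope classical_set_scope.
Local Open Scope ring_scope.
Local Open Scope complex_scope.

(* The torus T = R / 2 pi Z: functions on T are 2pi-periodic functions on R,
   integrated over one period. *)

Definition periodic_2pi (R : realType) (V : Type) (f : R -> V) : Prop :=
  forall x, f (x + 2 * pi) = f x.

Definition torus_integral (R : realType) (f : R -> R[i]) : R[i] :=
  Complex
    (\int[lebesgue_measure]_(x in `[0, 2 * pi]) complex.Re (f x))
    (\int[lebesgue_measure]_(x in `[0, 2 * pi]) complex.Im (f x)).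

Definition cis (R : realType) (theta : R) : R[i] :=
  Complex (cos theta) (sin theta).

Definition fourier_coef (R : realType) (g : R -> R[i]) (n : int) : R[i] :=
  ((2 * pi)^-1)%:C * torus_integral (fun x => g x * cis (- (n%:~R * x))).

(* The preimage in R of the image in T of the interval I; all of R when I is
   longer than 2pi or unbounded. *)
Definition torus_arc (R : realType) (I : interval R) : set R :=
  [set x | exists k : int, x + 2 * pi * k%:~R \in I].

Definition step_function (R : realType) (g : R -> R[i]) : Prop :=
  exists (m : nat) (c : 'I_m -> R[i]) (I : 'I_m -> interval R),
    forall x, g x = \sum_(j < m) c j * \1_(torus_arc (I j)) x.

(* Up to null sets: combinations of indicators of arcs may differ from a
   constant at finitely many points only, and then they are constant as
   elements of L^2(T). *)
Definition nonconstant (R : realType) (g : R -> R[i]) : Prop :=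
  ~ exists c : R[i], {ae lebesgue_measure, forall x : R, g x = c}.

(* sum_(|n| <= N) ghat(n) e^(i t omega(n) + i n x), with n = k - N. *)
Definition evolution_partial_sum (R : realType) (omega : int -> R) (t : R)
    (g : R -> R[i]) (N : nat) (x : R) : R[i] :=
  \sum_(0 <= k < N.*2.+1)
    let n := k%:Z - N%:Z in
    fourier_coef g n * cis (t * omega n + n%:~R * x).

(* u is a continuous representative of e^(i t L_omega) g; the Fourier series
   defining the latter converges in L^2(T). *)
Definition continuous_representative (R : realType) (omega : int -> R) (t : R)
    (g : R -> R[i]) (u : R -> R[i]) : Prop :=
  [/\ periodic_2pi u,
      continuous (fun x => complex.Re (u x)),
      continuous (fun x => complex.Im (u x)) &
      (\int[lebesgue_measure]_(x in `[0%R, (2 * pi)%R])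
         ((Normc.normc
            (u x - evolution_partial_sum omega t g N x)) ^+ 2)%:E)%E
        @[N --> \oo] --> 0%E].

(* A continuous representative is unique when it exists; the value is
   irrelevant when there is none. *)
Definition evolution (R : realType) (omega : int -> R) (t : R)
    (g : R -> R[i]) : R -> R[i] :=
  xget (fun=> 0) [set u | continuous_representative omega t g u].

Definition disc (R : realType) (c : R * R) (eps : R) : set (R * R) :=
  [set p | Num.sqrt ((p.1 - c.1) ^+ 2 + (p.2 - c.2) ^+ 2) < eps].

(* The infimum is a minimum, being over a set of natural numbers which is
   nonempty when E is bounded and eps > 0. *)
Definition covering_number (R : realType) (E : set (R * R)) (eps : R) : R :=
  inf [set n%:R | n in [set n : nat | exists c : 'I_n -> R * R,
                          E `<=` \bigcup_j disc (c j) eps]].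

Definition fractal_dim (R : realType) (E : set (R * R)) : \bar R :=
  limf_esup (fun eps : R => (ln (covering_number E eps) / ln (eps^-1))%:E)
            (0 : R)^'+.

(* The graph over one period. *)
Definition torus_graph (R : realType) (f : R -> R) : set (R * R) :=
  [set (x, f x) | x in `[0, 2 * pi]].

Definition D_ (R : realType) (t : R) (omega : int -> R) (g : R -> R[i]) :
    \bar R :=
  maxe
    (fractal_dim (torus_graph (fun x => complex.Re (evolution omega t g x))))
    (fractal_dim (torus_graph (fun x => complex.Im (evolution omega t g x)))).

Definition khinchin_levy (R : realType) (beta : R) : Prop :=
  irrational beta /\
  exists q : nat -> nat,
    [/\ forall n, (0 < q n)%N,
        forall n, (q n < q n.+1)%N,
        forall eps : R, 0 < eps ->
          exists N : nat, forall n : nat, (N < n)%N ->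
            (q n.+1)%:R <= ((q n)%:R : R) `^ (1 + eps) &
        forall n, exists a : int,
          coprimez a (q n)%:Z /\
          `| beta - a%:~R / (q n)%:R | <= ((q n)%:R ^+ 2)^-1].

Definition tanh (R : realType) (x : R) : R :=
  (expR x - expR (- x)) / (expR x + expR (- x)).

Definition omega_gc (R : realType) (n : int) : R :=
  let x : R := n%:~R in Num.sqrt ((x + x ^+ 3) * tanh x).

(* Main.v *)
Require Import Defs.
From HB Require Import structures.
From mathcomp Require Import all_boot all_order all_algebra.
From mathcomp Require Import complex ring lra zify.
From mathcomp Require Import all_classical all_reals all_analysis.
From mathcomp Require Import measurable_realfun.
Require Import Defs.

Set Implicit Arguments.
Unset Strict Implicit.
Unset Printing Implicit Defensive.

Import Order.TTheory GRing.Theory Num.Theory.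
Import numFieldNormedType.Exports.

Local Open Scope classical_set_scope.
Local Open Scope ring_scope.
Local Open Scope complex_scope.

(** Everything rests on one estimate, [sum_bound t alpha]: the sums of [cis (t * omega n + n * x)]
    over [0 <= n < N] are O([N^(1 - alpha)]), uniformly in [x]. For [0 < alpha < 1] it places the
    dimension between [1 + alpha] and [2 - alpha] ([dimension_bounds]). The value [alpha = 1/4] is
    available for every [t != 0] and gives [5/4, 7/4]; under the Khinchin-Levy condition every
    [alpha] slightly below 3/8 is available, which gives [11/8, 13/8] in the limit.

    Upper bound. The Fourier coefficients of a step function are [1 / (2 pi i n)] times a
    trigonometric sum over its jumps. As [omega] is even, the evolution is a finite combination of
    values of one function, the sum over [n > 0] of [cis (t * omega n + n * x) / n]. Abel summation
    bounds its tails by [N^(- alpha)], and the derivatives of its partial sums are exponential sums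
    of size [N^(1 - alpha)]; cutting at [N] about [1 / h] shows that the function is Hoelder of
    exponent [alpha] ([mode_limit_hoelder]), so its graphs have dimension at most [2 - alpha]
    ([fractal_dim_hoelder]).

    Lower bound. The increments [u (x + h) - u x] with [h = pi / (2 N)] are paired with a block of
    exponentials of frequencies [N <= n < 2 N] that carries the phases of the evolution. By Parseval
    these phases cancel, and what remains depends only on [g]; a single genuine jump keeps it away
    from 0 ([correlation_lower_bound]). Since the block is O([N^(1 - alpha)]) in the supremum norm,
    the mean of the increments is at least a multiple of [N^(alpha - 1)] ([increment_lower_bound]).
    Covers of both graphs by few discs would make that mean too small ([sampled_increments_le]), so
    one of the dimensions is at least [1 + alpha] ([fractal_dim_lower]).

    Exponential sums. Since [omega n] is [n^(3/2) + O(n^(- 1/2))], it suffices to treat the phase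
    [t n^(3/2) + n x]. The sum is cut into blocks on which the derivative of the phase runs through
    an interval of length [2 pi]. Each block has one stationary point [s^2] and contributes
    [sqrt s * cis (- t s^3 / 2)] times a common constant, up to O([s^(1/4)]) ([stationary_phase]).
    The centres [s] form an arithmetic progression with about [sqrt N] terms, so there remains a
    cubic Weyl sum ([exp_sum_transfer]). The trivial bound for it gives [alpha = 1/4]. Its leading
    coefficient is [2 pi] times [beta = 4/27 (t / 2 pi)^-2] up to sign; a Khinchin-Levy [beta] has,
    for each large length [M], a good denominator between [M] and [M^(1 + eta)], and Weyl's
    inequality yields [M^(3/4 + eta)] ([weyl_khinchin_levy]), that is [alpha = 3/8 - eta / 2].

    Almost every [t]. Borel-Cantelli shows that [beta] is almost never approximable to an order
    beyond the Dirichlet exponent ([well_approximable_negligible]), and for such [beta] successive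
    Dirichlet denominators form the required sequence ([khinchin_levy_of_diophantine]). *)

Notation normc := (@Normc.normc _).

(** * Modulus, real and imaginary parts of complex numbers *)

Section ComplexNorm.
Context {R : realType}.
Implicit Types (z w : R[i]) (x y : R).

Lemma normcE2 z : normc z = Num.sqrt (complex.Re z ^+ 2 + complex.Im z ^+ 2).
Proof. by case: z. Qed.

Lemma normc_ge0 z : 0 <= normc z.
Proof. by rewrite normcE2 sqrtr_ge0. Qed.

Lemma normc_real x : normc x%:C = `|x|.
Proof. by rewrite normcE2 /= expr0n /= addr0 sqrtr_sqr. Qed.

Lemma normc_sqr z : normc z ^+ 2 = complex.Re z ^+ 2 + complex.Im z ^+ 2.
Proof. by rewrite normcE2 sqr_sqrtr // addr_ge0 ?sqr_ge0. Qed.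

Lemma normc_sum (I : Type) (r : seq I) (P : pred I) (F : I -> R[i]) :
  normc (\sum_(i <- r | P i) F i) <= \sum_(i <- r | P i) normc (F i).
Proof.
elim/big_rec2: _ => [|i y1 y2 _ h]; first by rewrite Normc.normc0.
by apply: (le_trans (le_normcD _ _)); rewrite lerD2l.
Qed.

Lemma normc_le_sub z w : normc (z - w) <= normc z + normc w.
Proof. by rewrite (le_trans (le_normcD _ _)) // normcN. Qed.

Lemma normc_addl_le z w : normc z <= normc (z + w) + normc w.
Proof. by rewrite -{1}(addrK w z) normc_le_sub. Qed.

Lemma normc_distC z w : normc (z - w) = normc (w - z).
Proof. by rewrite -normcN opprB. Qed.

Lemma Re_le_normc z : `|complex.Re z| <= normc z.
Proof. by rewrite normcE2 -sqrtr_sqr ler_wsqrtr // lerDl sqr_ge0. Qed.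

Lemma Im_le_normc z : `|complex.Im z| <= normc z.
Proof. by rewrite normcE2 -sqrtr_sqr ler_wsqrtr // lerDr sqr_ge0. Qed.

Lemma normc_le_ReIm z : normc z <= `|complex.Re z| + `|complex.Im z|.
Proof.
rewrite -(@ler_pXn2r _ 2) // ?nnegrE ?normc_ge0 ?addr_ge0 // normc_sqr.
rewrite sqrrD !real_normK ?num_real // lerD2r lerDl.
by rewrite mulrn_wge0 // mulr_ge0.
Qed.

Lemma normcJ z : normc (conjc z) = normc z.
Proof. by rewrite !normcE2; case: z => a b /=; rewrite sqrrN. Qed.

Lemma normc_mulJ z : z * conjc z = (normc z ^+ 2)%:C.
Proof.
by rewrite normc_sqr; case: z => a b /=; apply/eqP; rewrite eq_complex /=;
  apply/andP; split; apply/eqP; ring.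
Qed.

Lemma ReD z w : complex.Re (z + w) = complex.Re z + complex.Re w.
Proof. by case: z w => a b [c d]. Qed.

Lemma ImD z w : complex.Im (z + w) = complex.Im z + complex.Im w.
Proof. by case: z w => a b [c d]. Qed.

Lemma ReN z : complex.Re (- z) = - complex.Re z.
Proof. by case: z. Qed.

Lemma ImN z : complex.Im (- z) = - complex.Im z.
Proof. by case: z. Qed.

Lemma ReB z w : complex.Re (z - w) = complex.Re z - complex.Re w.
Proof. by rewrite ReD ReN. Qed.

Lemma ImB z w : complex.Im (z - w) = complex.Im z - complex.Im w.
Proof. by rewrite ImD ImN. Qed.

Lemma ReM z w : complex.Re (z * w) =
  complex.Re z * complex.Re w - complex.Im z * complex.Im w.
Proof. by case: z w => a b [c d]. Qed.

Lemma ImM z w : complex.Im (z * w) =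
  complex.Re z * complex.Im w + complex.Im z * complex.Re w.
Proof. by case: z w => a b [c d]. Qed.

Lemma Re_sum (I : Type) (r : seq I) (P : pred I) (F : I -> R[i]) :
  complex.Re (\sum_(i <- r | P i) F i) = \sum_(i <- r | P i) complex.Re (F i).
Proof. by apply: (big_morph (@complex.Re R)) => // z w; exact: ReD. Qed.

Lemma Im_sum (I : Type) (r : seq I) (P : pred I) (F : I -> R[i]) :
  complex.Im (\sum_(i <- r | P i) F i) = \sum_(i <- r | P i) complex.Im (F i).
Proof. by apply: (big_morph (@complex.Im R)) => // z w; exact: ImD. Qed.

Lemma conjc_sum (I : Type) (r : seq I) (P : pred I) (F : I -> R[i]) :
  conjc (\sum_(i <- r | P i) F i) = \sum_(i <- r | P i) conjc (F i).
Proof.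
by apply: (big_morph (@conjc R)) => [[a b] [c d]|]; rewrite /= ?opprD ?oppr0.
Qed.

Lemma complex_eq z w : complex.Re z = complex.Re w ->
  complex.Im z = complex.Im w -> z = w.
Proof. by case: z w => a b [c d] /= -> ->. Qed.

Lemma conjcD z w : conjc (z + w) = conjc z + conjc w.
Proof. by case: z w => a b [c d]; rewrite /= opprD. Qed.

Lemma conjcM z w : conjc (z * w) = conjc z * conjc w.
Proof. by case: z w => a b [c d]; apply: complex_eq => /=; ring. Qed.

End ComplexNorm.

(** * Mean value inequalities and derivatives of functions of one real variable *)

Section MeanValue.
Context {R : realType}.
Implicit Types (f df g dg : R -> R) (a b x dfx dgx : R).

Lemma mvt f df a b : a <= b ->
  (forall x, a <= x <= b -> is_derive x 1 f (df x)) ->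
  exists2 c, a <= c <= b & f b - f a = df c * (b - a).
Proof.
move=> ab fd; have [||c cab E] := @MVT_segment R f df a b ab.
- by move=> x; rewrite in_itv /= => /andP[h1 h2]; apply: fd; rewrite !ltW.
- apply: derivable_within_continuous => x; rewrite in_itv /= => h.
  by have [] := fd _ h.
by exists c => //; move: cab; rewrite in_itv.
Qed.

Lemma mvt_norm f df a b K : a <= b ->
  (forall x, a <= x <= b -> is_derive x 1 f (df x)) ->
  (forall x, a <= x <= b -> `|df x| <= K) ->
  `|f b - f a| <= K * (b - a).
Proof.
move=> ab fd h; have [c cab ->] := mvt ab fd.
by rewrite normrM (ger0_norm (_ : 0 <= b - a)) ?subr_ge0 // ler_wpM2r ?subr_ge0 // h.
Qed.

Lemma mvt_comparison f df g dg a b : a <= b ->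
  (forall x, a <= x <= b -> is_derive x 1 f (df x)) ->
  (forall x, a <= x <= b -> is_derive x 1 g (dg x)) ->
  (forall x, a <= x <= b -> `|df x| <= dg x) ->
  `|f b - f a| <= g b - g a.
Proof.
move=> ab fd gd h; rewrite ler_norml; apply/andP; split.
- have [x xab|c cab] := @mvt (f + g) (fun x => df x + dg x) a b ab.
    by have := fd x xab; have := gd x xab => ? ?; exact: is_deriveD.
  have := h c cab; rewrite ler_norml => /andP[h1 _].
  have : 0 <= (df c + dg c) * (b - a) by rewrite mulr_ge0 ?subr_ge0 //; lra.
  by move=> + E; rewrite -E !fctE; lra.
- have [x xab|c cab] := @mvt (g - f) (fun x => dg x - df x) a b ab.
    by have := fd x xab; have := gd x xab => ? ?; exact: is_deriveB.
  have := h c cab; rewrite ler_norml => /andP[_ h1].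
  have : 0 <= (dg c - df c) * (b - a) by rewrite mulr_ge0 ?subr_ge0 //; lra.
  by move=> + E; rewrite -E !fctE; lra.
Qed.

Lemma is_derive_comp1 f g x dfx dgx :
  is_derive x 1 g dgx -> is_derive (g x) 1 f dfx ->
  is_derive x (1 : R) (fun y => f (g y)) (dfx * dgx).
Proof.
by move=> hg hf; exact: (@is_derive1_comp R f g x dfx dgx hf hg).
Qed.

Lemma is_derive_cst1 (c x : R) : is_derive x (1 : R) (fun=> c : R) 0.
Proof. exact: is_derive_cst. Qed.

Lemma is_derive_id1 (x : R) : is_derive x (1 : R) (fun y : R => y) 1.
Proof. exact: is_derive_id. Qed.

Lemma is_deriveD1 f g x a b : is_derive x (1 : R) f a -> is_derive x (1 : R) g b ->
  is_derive x (1 : R) (fun y => f y + g y) (a + b).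
Proof. exact: is_deriveD. Qed.

Lemma is_deriveB1 f g x a b : is_derive x (1 : R) f a -> is_derive x (1 : R) g b ->
  is_derive x (1 : R) (fun y => f y - g y) (a - b).
Proof. exact: is_deriveB. Qed.

Lemma is_deriveN1 f x a : is_derive x (1 : R) f a ->
  is_derive x (1 : R) (fun y => - f y) (- a).
Proof. exact: is_deriveN. Qed.

Lemma is_deriveM1 f g x a b : is_derive x (1 : R) f a -> is_derive x (1 : R) g b ->
  is_derive x (1 : R) (fun y => f y * g y) (a * g x + f x * b).
Proof.
by move=> h1 h2; apply: is_derive_eq (is_deriveM h1 h2) _; rewrite addrC mulrC.
Qed.

Lemma is_deriveZ1 f x a c : is_derive x (1 : R) f a ->
  is_derive x (1 : R) (fun y => c * f y) (c * a).
Proof. exact: is_deriveZ. Qed.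

Lemma is_deriveV1 f x a : f x != 0 -> is_derive x (1 : R) f a ->
  is_derive x (1 : R) (fun y => (f y)^-1) (- a / f x ^+ 2).
Proof.
move=> h h1; apply: is_derive_eq (is_deriveV h h1) _.
by rewrite /GRing.scale /= mulNr mulNr mulrC.
Qed.

End MeanValue.

(** * The unit exponential and elementary sine estimates *)

Section Cis.
Context {R : realType}.
Implicit Types (a b x y th : R).

Lemma cisD a b : cis (a + b) = cis a * cis b.
Proof. by apply: complex_eq; rewrite ?ReM ?ImM /= ?cosD ?sinD //; ring. Qed.

Lemma cis0 : cis (0 : R) = 1.
Proof. by apply: complex_eq; rewrite /= ?cos0 ?sin0. Qed.

Lemma cisN a : cis (- a) = conjc (cis a).
Proof. by apply: complex_eq; rewrite /= ?cosN ?sinN. Qed.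

Lemma normc_cis a : normc (cis a) = 1.
Proof. by rewrite normcE2 /= cos2Dsin2 sqrtr1. Qed.

Lemma cisNK a : cis a * cis (- a) = 1.
Proof. by rewrite -cisD subrr cis0. Qed.

Lemma cis_nat_mul (n : nat) a : cis (n%:R * a) = cis a ^+ n.
Proof.
elim: n => [|n ih]; first by rewrite mul0r cis0 expr0.
by rewrite -natr1 mulrDl mul1r cisD ih exprSr.
Qed.

Lemma cis_2pi : cis (2 * pi) = 1 :> R[i].
Proof. by apply: complex_eq; rewrite /= mulrC mulr_natr ?cos2pi ?sin2pi. Qed.

Lemma cis_2pi_int (k : int) : cis (2 * pi * k%:~R) = 1 :> R[i].
Proof.
case: k => n; first by rewrite mulrC cis_nat_mul cis_2pi expr1n.
rewrite NegzE mulrC mulrNz mulNr cisN cis_nat_mul cis_2pi expr1n.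
by rewrite conjc1.
Qed.

Lemma cis_per a (k : int) : cis (a + 2 * pi * k%:~R) = cis a.
Proof. by rewrite cisD cis_2pi_int mulr1. Qed.

Lemma sin_le_id x : 0 <= x -> sin x <= x.
Proof.
move=> x0; have [c _] := mvt x0 (fun y _ => is_derive_sin y).
by rewrite sin0 !subr0 => ->; rewrite ler_piMl // cos_le1.
Qed.

Lemma norm_sin_le x : `|sin x| <= `|x|.
Proof.
wlog x0 : x / 0 <= x.
  move=> h; have [/h //|/ltW x0] := leP 0 x.
  by rewrite -normrN -sinN -[leRHS]normrN h // oppr_ge0.
rewrite (ger0_norm x0) ler_norml sin_le_id // andbT.
have [x1|x1] := leP x pi; last by have := sin_geN1 x; have := @pi_ge2 R; lra.
by have := @sin_ge0_pi R x; rewrite x0 x1 => /(_ isT); lra.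
Qed.

Lemma cisB1E th : cis th - 1 = (Complex 0 2) * (sin (th / 2))%:C * cis (th / 2).
Proof.
have -> : th = th / 2 + th / 2 by lra.
rewrite (_ : (th / 2 + th / 2) / 2 = th / 2); last by lra.
move: (th / 2) => u; apply: complex_eq; rewrite ?ReM ?ImM /= ?cosD ?sinD.
  by have := cos2Dsin2 u; rewrite -!expr2 => h; lra.
by ring.
Qed.

Lemma normc_cisB1 th : normc (cis th - 1) = 2 * `|sin (th / 2)|.
Proof.
rewrite cisB1E !Normc.normcM normc_cis mulr1 normc_real normcE2 /=.
by rewrite expr0n add0r sqrtr_sqr ger0_norm.
Qed.

Lemma normc_cisB a b : normc (cis a - cis b) <= `|a - b|.
Proof.
have -> : cis a - cis b = cis b * (cis (a - b) - 1).
  by rewrite mulrBr mulr1 -cisD (addrC b) subrK.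
rewrite Normc.normcM normc_cis mul1r normc_cisB1.
have := norm_sin_le ((a - b) / 2).
by rewrite normrM (ger0_norm (_ : 0 <= 2^-1)) ?invr_ge0 //; lra.
Qed.

(* [x cos x <= sin x], i.e. [x <= tan x], without division. *)
Lemma mul_cos_le_sin x : 0 <= x <= pi -> x * cos x <= sin x.
Proof.
move=> /andP[x0 xpi].
have [c /andP[c0 cx]] := mvt x0 (fun y _ => is_derive_sin y).
rewrite sin0 !subr0 => ->; rewrite mulrC ler_wpM2r //.
move: cx; rewrite le_eqVlt => /predU1P[->//|cx].
by apply: ltW; rewrite ltr_cos // in_itv /= ?c0 ?x0 ?(le_trans (ltW cx)).
Qed.

(** Write [x = 2 u]: then [sin x = 2 sin u cos u >= 2 u (cos u)^2], and [2 (cos u)^2 >= 1] because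
    [cos x >= 0]. *)
Lemma half_le_sin x : 0 <= x <= pi / 2 -> x / 2 <= sin x.
Proof.
move=> /andP[x0 xp]; have p2 := @pi_ge2 R.
have [u xE] : exists u, x = u + u by exists (x / 2); lra.
have -> : x / 2 = u by lra.
have /mul_cos_le_sin h : 0 <= u <= pi by apply/andP; split; lra.
have c0 : 0 <= cos u by apply: cos_ge0_pihalf; apply/andP; split; lra.
have : 0 <= cos x by apply: cos_ge0_pihalf; apply/andP; split; lra.
have u0 : 0 <= u by lra.
rewrite xE cosD sinD; have := cos2Dsin2 u.
move: (cos u) (sin u) c0 h => c s c0 h h1 h2.
have : 0 <= c * (s - u * c) by rewrite mulr_ge0 //; lra.
have : 0 <= u * (2 * c ^+ 2 - 1) by rewrite mulr_ge0 //; lra.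
by rewrite !mulrBr !expr2; lra.
Qed.

Lemma sum_cis_geom th (N : nat) : sin (th / 2) != 0 ->
  normc (\sum_(n < N) cis (n%:R * th)) <= `|sin (th / 2)|^-1.
Proof.
move=> s0; have s1 : 0 < `|sin (th / 2)| by rewrite normr_gt0.
have E : (cis th - 1) * \sum_(n < N) cis (n%:R * th) = cis (N%:R * th) - 1.
  rewrite cis_nat_mul subrX1; congr (_ * _); apply: eq_bigr => i _.
  by rewrite cis_nat_mul.
have := congr1 normc E; rewrite Normc.normcM normc_cisB1 => {}E.
rewrite -[_^-1]mul1r ler_pdivlMr //.
have : normc (cis (N%:R * th) - 1) <= 2.
  by rewrite (le_trans (normc_le_sub _ _)) // normc_cis Normc.normc1; lra.
by rewrite -E; lra.
Qed.

End Cis.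

(** * The Kusmin-Landau inequality *)

Section KusminLandau.
Context {R : realType}.

Definition nceil (x : R) : nat := `|Num.ceil x|%N.

Lemma nceilP (x : R) : 0 <= x -> x <= (nceil x)%:R /\ (nceil x)%:R < x + 1.
Proof.
move=> x0; have c0 : 0 <= Num.ceil x by rewrite ceil_ge0 (lt_le_trans _ x0) // ltrN10.
have -> : (nceil x)%:R = (Num.ceil x)%:~R :> R.
  by rewrite /nceil natr_absz ger0_norm.
split; first exact: ceil_ge.
by have := ceilB1_lt x; rewrite intrD mulrN1z; lra.
Qed.

(** Abel summation moves the differences from [z] onto the monotone [k], whose total variation
    telescopes to at most [2 * K]; the boundary terms account for the rest. *)
Lemma abel_monotone (z : nat -> R[i]) (k : nat -> R) (N : nat) (K : R) :
  0 <= K ->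
  (forall n, normc (z n) <= 1) -> (forall n, (n < N)%N -> `|k n| <= K) ->
  (forall n, (n.+1 < N)%N -> k n.+1 <= k n) ->
  normc (\sum_(n < N) (z n.+1 - z n) * (k n)%:C) <= 4 * K.
Proof.
move=> K0 z1 kK kmono; case: N kK kmono => [|N] kK kmono.
  by rewrite big_ord0 Normc.normc0 mulr_ge0.
suff h M : (M <= N)%N ->
    normc (\sum_(n < M.+1) (z n.+1 - z n) * (k n)%:C - z M.+1 * (k M)%:C)
      <= K + (k 0%N - k M).
  have {h} := h N (leqnn N).
  have h0 := kK 0%N isT; have hN := kK N (ltnSn N).
  have := normc_addl_le (\sum_(n < N.+1) (z n.+1 - z n) * (k n)%:C)
    (- (z N.+1 * (k N)%:C)).
  rewrite normcN Normc.normcM normc_real.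
  have : normc (z N.+1) * `|k N| <= 1 * K by rewrite ler_pM ?normc_ge0.
  by move: h0 hN; rewrite !ler_norml => /andP[? ?] /andP[? ?]; lra.
elim: M => [_|M ih MN].
  rewrite big_ord_recr big_ord0 /= add0r subrr addr0 mulrBl addrAC subrr add0r.
  rewrite normcN Normc.normcM normc_real -[leRHS]mul1r ler_pM ?normc_ge0 //.
  exact: kK.
rewrite big_ord_recr /=.
rewrite (_ : _ - _ = (\sum_(n < M.+1) (z n.+1 - z n) * (k n)%:C - z M.+1 * (k M)%:C)
   + z M.+1 * (k M - k M.+1)%:C); last by rewrite rmorphB /=; ring.
apply: (le_trans (le_normcD _ _)).
have := ih (ltnW MN); rewrite Normc.normcM normc_real.
have km := kmono M MN; rewrite (ger0_norm (_ : 0 <= k M - k M.+1)) ?subr_ge0 //.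
have : normc (z M.+1) * (k M - k M.+1) <= 1 * (k M - k M.+1).
  by rewrite ler_wpM2r ?subr_ge0.
by lra.
Qed.

Lemma cot_decreasing (a b : R) : 0 < a -> a <= b -> b <= pi / 2 ->
  cos b / sin b <= cos a / sin a.
Proof.
move=> a0 ab bp; have p2 := @pi_ge2 R.
have sa : 0 < sin a by apply: sin_gt0_pi; apply/andP; split; lra.
have sb : 0 < sin b by apply: sin_gt0_pi; apply/andP; split; lra.
rewrite ler_pdivrMr // mulrAC ler_pdivlMr //.
have : 0 <= sin (b - a) by apply: sin_ge0_pi; apply/andP; split; lra.
by rewrite sinB; lra.
Qed.

Lemma cot_bound (a d : R) : 0 < d -> d <= a -> a <= pi / 2 ->
  `|cos a / sin a| <= d^-1.
Proof.
move=> d0 da ap; have p2 := @pi_ge2 R.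
have sa : 0 < sin a by apply: sin_gt0_pi; apply/andP; split; lra.
have ca : 0 <= cos a by apply: cos_ge0_pihalf; apply/andP; split; lra.
rewrite ger0_norm ?divr_ge0 ?(ltW sa) // ler_pdivrMr // mulrC ler_pdivlMr //.
have /mul_cos_le_sin : 0 <= a <= pi by apply/andP; split; lra.
by apply: le_trans; rewrite mulrC ler_wpM2r.
Qed.

(** With [th] the phase increment, [z n] is [z n.+1 - z n] divided by [cis th - 1], and [1 / (cis th
    - 1) = - 1/2 - (i/2) cot (th / 2)]. The constant part telescopes; the cotangents are monotone in
    [n] and bounded by [2 / d], so [abel_monotone] applies. *)
Lemma kusmin_landau (phi : nat -> R) (N : nat) (d : R) :
  0 < d ->
  (forall n, (n < N)%N -> d <= phi n.+1 - phi n <= pi) ->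
  (forall n, (n.+1 < N)%N -> phi n.+1 - phi n <= phi n.+2 - phi n.+1) \/
  (forall n, (n.+1 < N)%N -> phi n.+2 - phi n.+1 <= phi n.+1 - phi n) ->
  normc (\sum_(n < N) cis (phi n)) <= 1 + 4 / d.
Proof.
move=> d0 hth hmono; have p2 := @pi_ge2 R.
pose k n := cos ((phi n.+1 - phi n) / 2) / sin ((phi n.+1 - phi n) / 2).
pose z n := cis (phi n).
have zE n : (n < N)%N ->
    z n = (- 2^-1)%:C * (z n.+1 - z n) - Complex 0 2^-1 * ((z n.+1 - z n) * (k n)%:C).
  move=> nN; have /andP[h1 h2] := hth n nN.
  have -> : z n.+1 = z n * cis (phi n.+1 - phi n) by rewrite -cisD addrC subrK.
  rewrite /k; move: (phi n.+1 - phi n) h1 h2 => th h1 h2.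
  have s0 : sin (th / 2) != 0.
    by rewrite gt_eqF //; apply: sin_gt0_pi; apply/andP; split; lra.
  have {1}-> : z n = z n * ((- 2^-1)%:C * (cis th - 1)
      - Complex 0 2^-1 * ((cis th - 1) * (cos (th / 2) / sin (th / 2))%:C)); last by ring.
  rewrite -[LHS]mulr1; congr (_ * _); rewrite cisB1E.
  have := cos2Dsin2 (th / 2); move: s0; rewrite /cis.
  move: (cos _) (sin _) => c s s0 cs; apply: complex_eq.
    rewrite /= ?(ReB, ReM, ImM, ReN, ImN) /=.
    have : s * (c / s) = c by field.
    move: (c / s) => q E; have : s * c * q = c ^+ 2 by rewrite mulrAC E expr2.
    by lra.
  rewrite /= ?(ImB, ImM, ReM, ReN, ImN) /=.
  have : s * (c / s) = c by field.
  move: (c / s) => q E; have : s * s * q = c * s by rewrite -mulrA E mulrC.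
  by lra.
have S : \sum_(n < N) z n = (- 2^-1)%:C * (z N - z 0%N)
    - Complex 0 2^-1 * \sum_(n < N) ((z n.+1 - z n) * (k n)%:C).
  rewrite (eq_bigr (fun n : 'I_N => (- 2^-1)%:C * (z n.+1 - z n)
     - Complex 0 2^-1 * ((z n.+1 - z n) * (k n)%:C))) => [|n _]; last exact: zE.
  rewrite sumrB -!mulr_sumr; congr (_ * _ - _).
  by rewrite -(big_mkord xpredT (fun n => z n.+1 - z n)) telescope_sumr.
rewrite -/z S (le_trans (normc_le_sub _ _)) // !Normc.normcM.
have kb n : (n < N)%N -> `|k n| <= 2 / d.
  move=> nN; have /andP[h1 h2] := hth n nN; rewrite -[2 / d]invrK invf_div.
  by apply: cot_bound; [rewrite divr_gt0|rewrite ler_pM2r ?invr_gt0|lra].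
have z1 n : normc (z n) <= 1 by rewrite normc_cis.
have d2 : 0 <= 2 / d by rewrite divr_ge0 // ltW.
have h : normc (\sum_(n < N) ((z n.+1 - z n) * (k n)%:C)) <= 4 * (2 / d).
  case: hmono => hmono.
    apply: abel_monotone => // n nN; have /andP[h1 h2] := hth n (ltnW nN).
    have /andP[h3 h4] := hth n.+1 nN; have := hmono n nN => h5.
    by apply: cot_decreasing; lra.
  rewrite -normcN -sumrN (eq_bigr (fun n : 'I_N => (z n.+1 - z n) * (- k n)%:C)).
    apply: (@abel_monotone z (fun n => - k n)) => // n nN; first by rewrite normrN kb.
    have /andP[h1 h2] := hth n (ltnW nN).
    have /andP[h3 h4] := hth n.+1 nN; have := hmono n nN => h5.
    by rewrite lerN2; apply: cot_decreasing; lra.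
  by move=> n _; rewrite rmorphN /= mulrN.
have -> : normc (- 2^-1 : R)%:C = 2^-1 by rewrite normc_real normrN ger0_norm // invr_ge0.
have -> : normc (Complex 0 (2^-1 : R)) = 2^-1.
  by rewrite normcE2 /= expr0n add0r sqrtr_sqr ger0_norm // invr_ge0.
have h2 : normc (z N - z 0%N) <= 2.
  by rewrite (le_trans (normc_le_sub _ _)) // !normc_cis; lra.
rewrite (_ : 4 / d = 2 * (2 / d)); last by rewrite mulrA; congr (_ / _); lra.
by lra.
Qed.

End KusminLandau.

(** * Quadratic exponential sums and Fresnel integrals *)

Section Fresnel.
Context {R : realType}.
Implicit Types (E F f : R -> R).

(** For [f] of the form [cos (x * x + c)] this is a Fresnel integral. Its limit at infinity never
    enters: later bounds only compare values of the primitive. *)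
Lemma exists_primitive f (A : R) : continuous f ->
  exists F, forall x, - A < x < A -> is_derive x 1 F (f x).
Proof.
move=> cf; exists (fun x => \int[lebesgue_measure]_(t in `[- A, x]) f t)%R.
move=> x /andP[x1 x2].
have intf : lebesgue_measure.-integrable `[- A, A] (EFin \o f).
  apply: continuous_compact_integrable; first exact: segment_compact.
  exact: continuous_subspaceT.
have [dF <-] := continuous_FTC1_closed x2 intf x1 (cf x).
by rewrite derive1E; exact: derivableP.
Qed.

Lemma is_derive_cos_quad (k c w : R) :
  is_derive w 1 (fun w => cos (k * (w * w) + c)) (- (2 * k * w) * sin (k * (w * w) + c)).
Proof.
have h : is_derive w 1 (fun w : R => k * (w * w) + c) (k * (1 * w + w * 1) + 0).
  exact: (is_deriveD1 (is_deriveZ1 k (is_deriveM1 (is_derive_id1 w) (is_derive_id1 w))) (is_derive_cst1 c w)).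
apply: is_derive_eq (is_derive_comp1 h (is_derive_cos _)) _.
by ring.
Qed.

Lemma is_derive_sin_quad (k c w : R) :
  is_derive w 1 (fun w => sin (k * (w * w) + c)) (2 * k * w * cos (k * (w * w) + c)).
Proof.
have h : is_derive w 1 (fun w : R => k * (w * w) + c) (k * (1 * w + w * 1) + 0).
  exact: (is_deriveD1 (is_deriveZ1 k (is_deriveM1 (is_derive_id1 w) (is_derive_id1 w))) (is_derive_cst1 c w)).
apply: is_derive_eq (is_derive_comp1 h (is_derive_sin _)) _.
by ring.
Qed.

Lemma continuous_cos_quad (c : R) : continuous (fun w : R => cos (w * w + c)).
Proof.
move=> x; apply: differentiable_continuous; apply/derivable1_diffP.
have := is_derive_cos_quad 1 c x; rewrite (_ : (fun w => _) = (fun w => cos (w * w + c))).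
  by case.
by apply/funext => w; rewrite mul1r.
Qed.

(* [E v - sin (v ^ 2 + c) / (2 v)] has derivative at most [1 / (2 v ^ 2)]. *)
Lemma fresnel_tail E (A c v V : R) : 0 < v -> v <= V -> V < A ->
  (forall x, - A < x < A -> is_derive x 1 E (cos (x * x + c))) ->
  `|E V - E v| <= v^-1 + v^-1.
Proof.
move=> v0 vV VA dE.
pose G w := E w - sin (1 * (w * w) + c) * (2 * w)^-1.
pose g (w : R) := - (2 * w)^-1.
have V0 : 0 < V by exact: lt_le_trans vV.
have inv x : v <= x -> is_derive x 1 (fun w : R => (2 * w)^-1) (- (2 * 1) / (2 * x) ^+ 2).
  move=> vx; have x0 : 2 * x != 0 by rewrite mulf_neq0 // gt_eqF // (lt_le_trans v0).
  exact: is_deriveV1 x0 (is_deriveZ1 2 (is_derive_id1 x)).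
have h : `|G V - G v| <= g V - g v.
  apply: (@mvt_comparison R G (fun w => sin (1 * (w * w) + c) * (2 * 1) / (2 * w) ^+ 2)
    g (fun w => (2 * 1) / (2 * w) ^+ 2)) => // x /andP[vx xV].
  - have x0 : x != 0 by rewrite gt_eqF // (lt_le_trans v0).
    have xA : - A < x < A by apply/andP; split; lra.
    apply: is_derive_eq (is_deriveB1 (dE x xA) (is_deriveM1 (is_derive_sin_quad 1 c x) (inv x vx))) _.
    by rewrite mul1r; field.
  - have := is_deriveN1 (inv x vx) => dg; apply: is_derive_eq dg _.
    by rewrite mulNr opprK.
  - have q0 : 0 <= 2 * 1 / (2 * x) ^+ 2 by rewrite divr_ge0 ?sqr_ge0 //; lra.
    by rewrite -mulrA normrM (ger0_norm q0) ler_piMl // sin_max.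
have sb w : 0 < w -> `|sin (1 * (w * w) + c) * (2 * w)^-1| <= w^-1 / 2.
  move=> w0; rewrite normrM invfM mulrC [2^-1 * _]mulrC.
  rewrite (ger0_norm (_ : 0 <= w^-1 / 2)) ?divr_ge0 ?invr_ge0 ?(ltW w0) //.
  by rewrite ler_piMr ?sin_max // divr_ge0 ?invr_ge0 ?(ltW w0).
have := sb v v0; have := sb V V0.
have VvV : V^-1 <= v^-1 by rewrite lef_pV2.
have : 0 < V^-1 by rewrite invr_gt0.
move: h; rewrite /G /g ?invfM !ler_norml.
move: (sin (1 * (V * V) + c) * _) (sin (1 * (v * v) + c) * _) => a b.
by move=> /andP[? ?] ? /andP[? ?] /andP[? ?]; apply/andP; split; lra.
Qed.

Lemma fresnel_tailN E (A c v V : R) : 0 < v -> v <= V -> V < A ->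
  (forall x : R, - A < x < A -> is_derive x 1 E (cos (x * x + c))) ->
  `|E (- V) - E (- v)| <= v^-1 + v^-1.
Proof.
move=> v0 vV VA dE.
have := @fresnel_tail (fun x => - E (- x)) A c v V v0 vV VA.
rewrite -opprD normrN; apply => x /andP[x1 x2].
have hx : - A < - x < A by apply/andP; split; lra.
apply: is_derive_eq (is_deriveN1 (is_derive_comp1 (is_deriveN1 (is_derive_id1 x)) (dE _ hx))) _.
by rewrite mulrN1 opprK mulrNN.
Qed.

(** The auxiliary [h] compares the integral from [w] to [v] with the trapezoid over the same
    segment. By the mean value theorem its derivative is [(v - w) / 2] times a difference of two
    values of [q1], so the oscillation [B] of the first derivative controls the error. *)
Lemma trapezoid F (q q1 : R -> R) (w B : R) :
  (forall x, w <= x <= w + 1 -> is_derive x 1 F (q x)) ->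
  (forall x, w <= x <= w + 1 -> is_derive x 1 q (q1 x)) ->
  (forall x y, w <= x <= w + 1 -> w <= y <= w + 1 -> `|q1 x - q1 y| <= B) ->
  `|F (w + 1) - F w - (q w + q (w + 1)) / 2| <= B / 2.
Proof.
move=> dF dq hB.
pose h v := F v - (v - w) * ((q w + q v) / 2).
have ww : w <= w + 1 by rewrite lerDl.
have := @mvt_norm R h (fun v => q v - ((q w + q v) / 2 + (v - w) * (q1 v / 2))) w (w + 1) (B / 2) ww.
rewrite /h subrr mul0r (_ : w + 1 - w = 1) ?mul1r ?mulr1; last by ring.
rewrite (_ : F (w + 1) - (q w + q (w + 1)) / 2 - (F w - 0) =
  F (w + 1) - F w - (q w + q (w + 1)) / 2); last by ring.
apply => x xw.
  have d1 : is_derive x 1 (fun v => v - w) (1 - 0).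
    exact: is_deriveB1 (is_derive_id1 x) (is_derive_cst1 w x).
  have d2 : is_derive x 1 (fun v => (q w + q v) / 2) ((0 + q1 x) * 2^-1 + (q w + q x) * 0).
    exact: is_deriveM1 (is_deriveD1 (is_derive_cst1 (q w) x) (dq x xw)) (is_derive_cst1 2^-1 x).
  by apply: is_derive_eq (is_deriveB1 (dF x xw) (is_deriveM1 d1 d2)) _; ring.
have /andP[x1 x2] := xw.
have [y|y /andP[y1 y2] E] := @mvt R q q1 w x x1.
  by move=> /andP[y1 y2]; apply: dq; rewrite y1 (le_trans y2).
rewrite (_ : _ - _ = (x - w) / 2 * (q1 y - q1 x)); last first.
  have -> : q x = q w + q1 y * (x - w) by rewrite -E; ring.
  by field.
have yw : w <= y <= w + 1 by rewrite y1 (le_trans y2).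
have := hB y x yw xw => hb; rewrite normrM mulrC.
have B0 : 0 <= B by exact: le_trans (normr_ge0 _) hb.
by rewrite ler_pM ?normr_ge0 // ger0_norm; lra.
Qed.

(** Summing [trapezoid] over unit steps turns the sum into an integral, which the substitution
    [sqrt k * w] expresses through the primitive [E]. The error 1 is half the difference of the two
    end values; the other factor bounds the second derivative of [cos (k w^2 + c)] for
    [|w| <= L]. *)
Lemma sum_cos_quad E (A c k s2 L : R) (n0 N : nat) :
  (forall x : R, - A < x < A -> is_derive x 1 E (cos (x * x + c))) ->
  0 < k -> 0 <= L -> Num.sqrt k * L < A ->
  (forall n, (n <= N)%N -> `|(n0 + n)%:R - s2| <= L) ->
  `|\sum_(n < N) cos (k * (((n0 + n)%:R - s2) * ((n0 + n)%:R - s2)) + c)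
    - (E (Num.sqrt k * ((n0 + N)%:R - s2)) - E (Num.sqrt k * (n0%:R - s2))) / Num.sqrt k|
  <= 1 + N%:R * (2 * k + 4 * k ^+ 2 * L ^+ 2).
Proof.
move=> dE k0 L0 LA hL; have sk0 : 0 < Num.sqrt k by rewrite sqrtr_gt0.
pose F (w : R) : R := E (Num.sqrt k * w) / Num.sqrt k.
pose q (w : R) : R := cos (k * (w * w) + c).
pose q1 (w : R) : R := - (2 * k * w) * sin (k * (w * w) + c).
have dF (w : R) : `|w| <= L -> is_derive w 1 F (q w).
  move=> wL; have wA : - A < Num.sqrt k * w < A.
    rewrite -ltr_norml normrM (gtr0_norm sk0) (le_lt_trans _ LA) //.
    by rewrite ler_pM2l.
  have d1 : is_derive w 1 (fun w => Num.sqrt k * w) (Num.sqrt k * 1).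
    exact: is_deriveZ1 (is_derive_id1 w).
  have d2 := is_deriveM1 (is_derive_comp1 d1 (dE _ wA)) (is_derive_cst1 (Num.sqrt k)^-1 w).
  apply: is_derive_eq d2 _; rewrite /q mulr0 addr0 mulr1 -mulrA divff ?gt_eqF // mulr1.
  congr (cos (_ + _)); rewrite -[in RHS](sqr_sqrtr (ltW k0)); ring.
have dq (w : R) : is_derive w 1 q (q1 w) by exact: is_derive_cos_quad.
have dq1 (w : R) : is_derive w 1 q1 (- (2 * k) * sin (k * (w * w) + c) - (2 * k * w) * (2 * k * w) * cos (k * (w * w) + c)).
  have d1 : is_derive w 1 (fun w => - (2 * k * w)) (- (2 * k * 1)).
    exact: is_deriveN1 (is_deriveZ1 (2 * k) (is_derive_id1 w)).
  by apply: is_derive_eq (is_deriveM1 d1 (is_derive_sin_quad k c w)) _; ring.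
set B := 2 * k + 4 * k ^+ 2 * L ^+ 2.
have hq1 (w : R) : `|w| <= L -> `|- (2 * k) * sin (k * (w * w) + c) - (2 * k * w) * (2 * k * w) * cos (k * (w * w) + c)| <= B.
  move=> wL; apply: (le_trans (ler_normB _ _)); rewrite /B; apply: lerD.
    rewrite normrM normrN (gtr0_norm (_ : 0 < 2 * k)) ?ler_piMr ?sin_max //; last by rewrite mulr_gt0.
    by rewrite mulr_ge0 // ltW.
  rewrite normrM -expr2 (ger0_norm (sqr_ge0 _)).
  apply: (@le_trans _ _ ((2 * k * w) ^+ 2)); first by rewrite ler_piMr ?sqr_ge0 ?cos_max.
  rewrite !exprMn -natrX ler_wpM2l //; first by rewrite mulr_ge0 // sqr_ge0.
  by rewrite -real_normK ?num_real // ler_pXn2r ?nnegrE.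
have step (m : nat) : (m < N)%N ->
    `|F ((n0 + m.+1)%:R - s2) - F ((n0 + m)%:R - s2)
      - (q ((n0 + m)%:R - s2) + q ((n0 + m.+1)%:R - s2)) / 2| <= B / 2.
  move=> mN; set w := (n0 + m)%:R - s2.
  have -> : (n0 + m.+1)%:R - s2 = w + 1 by rewrite /w addnS -natr1; ring.
  have hw x : w <= x <= w + 1 -> `|x| <= L.
    have := hL m (ltnW mN); have := hL m.+1 mN.
    rewrite addnS -natr1 -/w (_ : _ + 1 - s2 = w + 1); last by rewrite /w; ring.
    rewrite !ler_norml => /andP[? ?] /andP[? ?] /andP[? ?].
    by apply/andP; split; lra.
  apply: (@trapezoid F q q1) => // [x /hw|x y hx hy]; first exact: dF.
  wlog xy : x y hx hy / y <= x.
    by move=> H; have [/H|/ltW/H] := leP y x; [exact|rewrite distrC; exact].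
  have /andP[? ?] := hx; have /andP[? ?] := hy.
  have := @mvt_norm R q1 _ y x B xy (fun z _ => dq1 z) => H.
  apply: (le_trans (H _)).
    by move=> z /andP[? ?]; apply: hq1; apply: hw; apply/andP; split; lra.
  rewrite ler_piMr //; last by lra.
  by rewrite /B addr_ge0 ?mulr_ge0 ?sqr_ge0 // ltW.
have tot M : (M <= N)%N ->
   `|F ((n0 + M)%:R - s2) - F ((n0 + 0)%:R - s2)
      - (\sum_(n < M) q ((n0 + n)%:R - s2) + (q ((n0 + M)%:R - s2) - q ((n0 + 0)%:R - s2)) / 2)|
   <= M%:R * (B / 2).
  elim: M => [_|M ih MN]; first by rewrite big_ord0 !subrr mul0r addr0 subrr normr0 mul0r.
  rewrite big_ord_recr /= (_ : M.+1%:R * (B / 2) = M%:R * (B / 2) + B / 2); last first.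
    by rewrite -natr1; ring.
  apply: le_trans (lerD (ih (ltnW MN)) (step M MN)); apply: le_trans (ler_normD _ _).
  by rewrite le_eqVlt; apply/orP; left; apply/eqP; congr `|_|; field.
have := tot N (leqnn N).
have B0 : 0 <= B by rewrite /B addr_ge0 ?mulr_ge0 ?sqr_ge0 // ltW.
have : N%:R * (B / 2) <= N%:R * B by rewrite ler_wpM2l //; lra.
rewrite addn0 /q /F.
have := cos_max (k * (((n0 + N)%:R - s2) * ((n0 + N)%:R - s2)) + c).
have := cos_max (k * ((n0%:R - s2) * (n0%:R - s2)) + c).
rewrite mulrBl !ler_norml => /andP[? ?] /andP[? ?] ? /andP[? ?].
by apply/andP; split; lra.
Qed.

End Fresnel.

(** * Stationary phase for one block of the sum with phase [t n^(3/2)] *)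

Section StationaryPhase.
Context {R : realType}.
Implicit Types (t s p : R).

Lemma sum_nat_shift (V : nmodType) (a b : nat) (F : nat -> V) :
  \sum_(a <= n < b) F n = \sum_(n < b - a) F (a + n)%N.
Proof.
by rewrite -{1}(add0n a) big_addn big_mkord; apply: eq_bigr => i _; rewrite addnC.
Qed.

(** The linear term is chosen so that the derivative is [3/2 * t * (sqrt n - s)], which vanishes at
    [n = s^2]. *)
Definition phase t s (n : nat) : R :=
  t * (n%:R * Num.sqrt n%:R) - 3 / 2 * t * s * n%:R.

(** The increment lies between the values of the increasing derivative at the two ends. The proof is
    algebraic in [a = sqrt n] and [b = sqrt (n + 1)], from [b^2 = a^2 + 1]. *)
Lemma phase_increment t s (n : nat) : 0 < t ->
  3 / 2 * t * (Num.sqrt n%:R - s) <= phase t s n.+1 - phase t s n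
    <= 3 / 2 * t * (Num.sqrt n.+1%:R - s).
Proof.
move=> t0; rewrite /phase; have t0' := ltW t0.
have a0 : 0 <= Num.sqrt n%:R :> R by exact: sqrtr_ge0.
have b0 : 0 <= Num.sqrt n.+1%:R :> R by exact: sqrtr_ge0.
have aE : n%:R = Num.sqrt n%:R ^+ 2 :> R by rewrite sqr_sqrtr.
have bE : n.+1%:R = Num.sqrt n.+1%:R ^+ 2 :> R by rewrite sqr_sqrtr.
have ab : Num.sqrt n.+1%:R ^+ 2 = Num.sqrt n%:R ^+ 2 + 1 :> R.
  by rewrite -aE -bE natr1.
move: (Num.sqrt n%:R) (Num.sqrt n.+1%:R) a0 b0 ab aE bE => a b a0 b0 ab -> ->.
have h1 : 0 <= t * ((b - a) ^+ 2 * (b + a / 2)).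
  by rewrite mulr_ge0 // mulr_ge0 ?sqr_ge0 //; lra.
have h2 : 0 <= t * ((b - a) ^+ 2 * (b / 2 + a)).
  by rewrite mulr_ge0 // mulr_ge0 ?sqr_ge0 //; lra.
have e1 : t * (a * b ^+ 2) = t * (a * (a ^+ 2 + 1)) by rewrite ab.
have e2 : t * (b * b ^+ 2) = t * (b * (a ^+ 2 + 1)) by rewrite ab.
have e3 : t * s * b ^+ 2 = t * s * (a ^+ 2 + 1) by rewrite ab.
by apply/andP; split; lra.
Qed.

(** Here [u] stands for [sqrt n]. The model is quadratic in [u^2 - s^2], that is in [n - s^2], so
    that summing over integers gives a quadratic exponential sum; the remainder is exactly a
    combination of [(u - s)^3] and [(u - s)^4 / s]. *)
Lemma phase_quadratic t s u : 0 < t -> 0 < s ->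
  `|(t * (u ^+ 2 * u) - 3 / 2 * t * s * u ^+ 2)
     - (- (t * s ^+ 3 / 2) + 3 * t / (8 * s) * ((u ^+ 2 - s ^+ 2) * (u ^+ 2 - s ^+ 2)))|
  <= t * (`|u - s| ^+ 3 + `|u - s| ^+ 4 / s).
Proof.
move=> t0 s0; rewrite (_ : _ - _ = - (t * ((u - s) ^+ 3 / 2 + 3 / 8 * ((u - s) ^+ 4 / s)))).
  rewrite normrN normrM (gtr0_norm t0) ler_pM2l // (le_trans (ler_normD _ _)) //.
  move: (u - s) => r; rewrite -!normrX.
  have h1 : `|r ^+ 4 / s| = `|r ^+ 4| / s.
    by rewrite normrM (gtr0_norm (_ : 0 < s^-1)) ?invr_gt0.
  have -> : `|r ^+ 3 / 2| = `|r ^+ 3| / 2.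
    by rewrite normrM (gtr0_norm (_ : 0 < 2^-1)) ?invr_gt0.
  have -> : `|3 / 8 * (r ^+ 4 / s)| = 3 / 8 * (`|r ^+ 4| / s).
    by rewrite normrM h1 (gtr0_norm (_ : 0 < 3 / 8)) // divr_gt0.
  have : 0 <= `|r ^+ 3| by [].
  have : 0 <= `|r ^+ 4| / s by rewrite divr_ge0 // ltW.
  lra.
by field; rewrite gt_eqF.
Qed.

Lemma sqrt_natr_ge (n : nat) (x : R) : 0 <= x -> (x <= Num.sqrt n%:R) = (x ^+ 2 <= n%:R).
Proof. by move=> x0; rewrite -[in LHS](ger0_norm x0) -sqrtr_sqr ler_sqrt. Qed.

Lemma sqrt_natr_le (n : nat) (x : R) : 0 <= x -> (Num.sqrt n%:R <= x) = (n%:R <= x ^+ 2).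
Proof. by move=> x0; rewrite -[in LHS](ger0_norm x0) -sqrtr_sqr ler_sqrt // sqr_ge0. Qed.

(** Collects the errors of [stationary_phase]: [2560 t] from the quadratic model, [12 t + 144 t^2]
    from the trapezoids, and the bounded and [1 / t] terms from the Kusmin-Landau and Fresnel
    tails. *)
Definition stationary_bound t : R := 2572 * t + 144 * t ^+ 2 + 5 + 28 / t.

Section Block.
Variables (t s p r0 : R) (A V : R) (Ec Es : R -> R).
(** The block consists of the [n] with [|sqrt n - s|] up to [r0], where the derivative of the phase
    reaches [pi] in absolute value; its centre, from [n1] to [n2], has [|sqrt n - s|] up to [p]. The
    choice [p = s^(- 1/4)] balances the errors: O([s p]) central terms, each with model error
    O([t p^3]), against tails of size [1 / (t p)]. *)
Hypotheses (t0 : 0 < t) (s1 : 1 <= s) (p0 : 0 < p) (p1 : p <= 1) (sp : s * p ^+ 4 = 1).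
Hypotheses (r0E : r0 = 2 * pi / (3 * t)) (pr : p <= r0 / 2) (rs : r0 <= s / 2)
  (r2 : 2 <= r0 * s).

Let a := nceil ((s - r0) ^+ 2).
Let b := nceil ((s + r0) ^+ 2).
Let n1 := `|Num.floor ((s - p) ^+ 2)|%N.
Let n2 := nceil ((s + p) ^+ 2).

Let s0 : 0 < s. Proof. exact: lt_le_trans s1. Qed.
Let r0p : 0 < r0. Proof. move: p0 pr; lra. Qed.
Ltac ctx := move: (t0) (s1) (p0) (p1) (pr) (rs) (r2) (s0) (r0p) => t0_ s1_ p0_ p1_ pr_ rs_ r2_ s0_ r0p_.

Let aP : (s - r0) ^+ 2 <= a%:R /\ a%:R < (s - r0) ^+ 2 + 1.
Proof. by apply: nceilP; exact: sqr_ge0. Qed.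
Let bP : (s + r0) ^+ 2 <= b%:R /\ b%:R < (s + r0) ^+ 2 + 1.
Proof. by apply: nceilP; exact: sqr_ge0. Qed.
Let n2P : (s + p) ^+ 2 <= n2%:R /\ n2%:R < (s + p) ^+ 2 + 1.
Proof. by apply: nceilP; exact: sqr_ge0. Qed.
Let n1P : n1%:R <= (s - p) ^+ 2 /\ (s - p) ^+ 2 < n1%:R + 1.
Proof.
have h : 0 <= (s - p) ^+ 2 by exact: sqr_ge0.
have f0 : 0 <= Num.floor ((s - p) ^+ 2) by rewrite floor_ge0.
have -> : n1%:R = (Num.floor ((s - p) ^+ 2))%:~R :> R.
  by rewrite /n1 natr_absz ger0_norm.
by split; [exact: floor_le|have := floorD1_gt ((s - p) ^+ 2); rewrite intrD].
Qed.

Let an1 : (a <= n1)%N.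
Proof.
ctx.
rewrite -ltnS -(ltr_nat R) -natr1.
have [_ h1] := aP; have [_ h2] := n1P.
have h : 1 <= (r0 - p) * (2 * s - r0 - p).
  have : r0 / 2 * s <= (r0 - p) * (2 * s - r0 - p) by apply: ler_pM; lra.
  lra.
suff : (s - r0) ^+ 2 + 1 <= (s - p) ^+ 2 by lra.
by rewrite !expr2 in h *; lra.
Qed.

Let n12 : (n1 <= n2)%N.
Proof.
ctx.
rewrite -(ler_nat R); have [h1 _] := n1P; have [h2 _] := n2P.
apply: (le_trans h1); apply: le_trans h2.
by rewrite ler_pXn2r ?nnegrE //; lra.
Qed.

Let n2b : (n2 <= b)%N.
Proof.
ctx.
rewrite -ltnS -(ltr_nat R) -natr1; have [h1 _] := bP; have [_ h2] := n2P.
apply: (lt_le_trans h2); rewrite lerD2r; apply: le_trans h1.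
by rewrite ler_pXn2r ?nnegrE //; lra.
Qed.

Let piE : pi = 3 / 2 * t * r0.
Proof. by rewrite r0E; field; rewrite gt_eqF. Qed.

Let pc : 1 + 4 / (3 / 2 * t * p) = 1 + 8 / 3 / t / p.
Proof. by field; rewrite !gt_eqF. Qed.

Let right_tail : normc (\sum_(n2 <= n < b) cis (phase t s n)) <= 2 + 8 / 3 / t / p.
Proof.
ctx.
have [b0|] := leqP b n2.
  by rewrite big_geq // Normc.normc0 addr_ge0 // !divr_ge0 // ltW.
case E : b => [//|b']; rewrite ltnS => h.
(* The last term is split off: with it the increments could exceed [pi], since [b] is rounded up
   from [(s + r0)^2]. *)
rewrite big_nat_recr //= (le_trans (le_normcD _ _)) // normc_cis sum_nat_shift.
suff : normc (\sum_(n < b' - n2) cis (phase t s (n2 + n))) <= 1 + 4 / (3 / 2 * t * p).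
  by rewrite pc; lra.
apply: (@kusmin_landau R (fun n => phase t s (n2 + n)) (b' - n2)).
- by rewrite !mulr_gt0.
- move=> n; rewrite addnS ltn_subRL => hn.
  have /andP[h1 h2] := phase_increment s (n2 + n) t0.
  apply/andP; split.
    apply: le_trans h1; rewrite ler_pM2l ?mulr_gt0 // lerBrDl sqrt_natr_ge; last lra.
    have [h3 _] := n2P; apply: (le_trans h3); by rewrite ler_nat leq_addr.
  apply: (le_trans h2); rewrite piE ler_pM2l ?mulr_gt0 // lerBlDl sqrt_natr_le; last lra.
  have [_ h3] := bP; have : (n2 + n).+1%:R + 1 <= b%:R :> R by rewrite natr1 ler_nat E ltnS.
  lra.
- left => n _; rewrite !addnS.
  have /andP[_ h1] := phase_increment s (n2 + n) t0.
  have /andP[h2 _] := phase_increment s (n2 + n).+1 t0.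
  exact: le_trans h1 h2.
Qed.

Let left_tail : normc (\sum_(a <= n < n1) cis (phase t s n)) <= 1 + 8 / 3 / t / p.
Proof.
ctx.
(* Left of the stationary point the increments are negative; conjugation makes them positive and
   decreasing. *)
rewrite sum_nat_shift -normcJ conjc_sum.
rewrite (eq_bigr (fun n : 'I_(n1 - a) => cis (- phase t s (a + n)))); last first.
  by move=> n _; rewrite cisN.
rewrite -pc; apply: (@kusmin_landau R (fun n => - phase t s (a + n)) (n1 - a)).
- by rewrite !mulr_gt0.
- move=> n; rewrite addnS ltn_subRL => hn.
  have /andP[h1 h2] := phase_increment s (a + n) t0.
  rewrite opprK addrC -opprB lerNr lerNl; apply/andP; split.
    apply: (le_trans h2); rewrite -mulrN ler_pM2l ?mulr_gt0 // lerBlDl sqrt_natr_le; last lra.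
    have [h3 _] := n1P; apply: le_trans h3; by rewrite ler_nat.
  apply: le_trans h1; rewrite piE -mulrN ler_pM2l ?mulr_gt0 // lerBrDl sqrt_natr_ge; last lra.
  have [h3 _] := aP; apply: (le_trans h3); by rewrite ler_nat leq_addr.
- right => n _; rewrite !addnS !opprK.
  have /andP[_ h1] := phase_increment s (a + n) t0.
  have /andP[h2 _] := phase_increment s (a + n).+1 t0.
  by move: (le_trans h1 h2); lra.
Qed.

Let k := 3 * t / (8 * s).
Let k0 : 0 < k. Proof. by rewrite divr_gt0 ?mulr_gt0. Qed.
Let sp1 : 1 <= s * p.
Proof.
ctx; rewrite -sp ler_pM2l // -[leRHS]mulr1 exprS ler_pM2l //.
by rewrite exprn_ile1 // ltW.
Qed.

Let ppp : p ^+ 2 <= s * p.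
Proof. by ctx; rewrite expr2 ler_pM2r //; lra. Qed.

Let width n : (n1 <= n <= n2)%N -> `|n%:R - s ^+ 2| <= 4 * (s * p).
Proof.
ctx; move: sp1 ppp => sp1_ ppp_ /andP[h1 h2]; have [_ h3] := n1P; have [_ h4] := n2P.
have h5 : n1%:R <= n%:R :> R by rewrite ler_nat.
have h6 : n%:R <= n2%:R :> R by rewrite ler_nat.
have := sqr_ge0 p.
by rewrite ler_norml => ?; apply/andP; split; rewrite !expr2 in h3 h4 ppp_ *; lra.
Qed.

Let count : (n2 - n1)%:R <= 8 * (s * p).
Proof.
have := @width n1; have := @width n2; rewrite !leqnn n12 => /(_ isT) + /(_ isT).
by rewrite natrB // !ler_norml => /andP[? ?] /andP[? ?]; lra.
Qed.

Let phase_error n : (n1 <= n <= n2)%N ->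
  normc (cis (phase t s n)
    - cis (- (t * s ^+ 3 / 2) + k * ((n%:R - s ^+ 2) * (n%:R - s ^+ 2)))) <= 320 * t * p ^+ 3.
Proof.
ctx; move=> hn; apply: (le_trans (normc_cisB _ _)).
have u0 : 0 <= Num.sqrt n%:R :> R by exact: sqrtr_ge0.
have w := width hn.
have up : `|Num.sqrt n%:R - s| <= 4 * p.
  have nE : n%:R = Num.sqrt n%:R ^+ 2 :> R by rewrite sqr_sqrtr.
  rewrite -(@ler_pM2l _ s) // mulrCA; apply: le_trans w; rewrite [n%:R in leRHS]nE.
  move: (Num.sqrt _) u0 => u u0; rewrite subr_sqr normrM mulrC ler_wpM2l //.
  by rewrite ger0_norm; lra.
have := @phase_quadratic t s (Num.sqrt n%:R) t0 s0.
rewrite sqr_sqrtr // => h; apply: (le_trans h).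
have r3 : `|Num.sqrt n%:R - s| ^+ 3 <= (4 * p) ^+ 3 by rewrite ler_pXn2r ?nnegrE //; lra.
have r4 : `|Num.sqrt n%:R - s| ^+ 4 / s <= (4 * p) ^+ 4.
  apply: (@le_trans _ _ (`|Num.sqrt n%:R - s| ^+ 4)).
    by rewrite ler_pdivrMr // ler_peMr // exprn_ge0.
  by rewrite ler_pXn2r ?nnegrE //; lra.
have p43 : p ^+ 4 <= p ^+ 3 by rewrite exprS ler_piMl // exprn_ge0 // ltW.
rewrite (_ : 320 * t * p ^+ 3 = t * (320 * p ^+ 3)) ?ler_pM2l //; last by ring.
by rewrite !exprMn in r3 r4; lra.
Qed.

(** The offset [c] lets the real part ([c = 0]) and the imaginary part ([c = - (pi / 2)]) share one
    proof. Moving the ends of the window out to [V] and [- V] costs two Fresnel tails, which makes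
    the main term the same for every window. *)
Lemma center_real (E : R -> R) c :
  Num.sqrt k * (4 * (s * p)) <= V -> V < A ->
  (forall x : R, - A < x < A -> is_derive x 1 E (cos (x * x + c))) ->
  `|\sum_(n < n2 - n1) cos (k * (((n1 + n)%:R - s ^+ 2) * ((n1 + n)%:R - s ^+ 2)) + c)
    - (E V - E (- V)) / Num.sqrt k| <= 1 + 6 * t * p + 72 * t ^+ 2 / p + 32 / 3 / t / p.
Proof.
ctx; move=> kV VA dE; move: sp1 ppp k0 => sp1_ ppp_ k0_.
have sk : 0 < Num.sqrt k by rewrite sqrtr_gt0.
have nn n : (n <= n2 - n1)%N -> (n1 <= n1 + n <= n2)%N.
  by move=> h; rewrite leq_addr /= -(subnKC n12) leq_add2l.
have L0 : 0 <= 4 * (s * p) by lra.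
have := @sum_cos_quad R E A c k (s ^+ 2) (4 * (s * p)) n1 (n2 - n1) dE k0 L0
  (le_lt_trans kV VA) (fun n h => width (nn n h)).
rewrite subnKC //; set S := \sum_(n < _) _; move=> h.
have w2 : s * p <= n2%:R - s ^+ 2.
  have [h1 _] := n2P; have := sqr_ge0 p; rewrite !expr2 in h1 *; lra.
have w1 : s * p <= - (n1%:R - s ^+ 2).
  by have [h1 _] := n1P; rewrite !expr2 in h1 ppp_ *; lra.
have tail w : s * p <= w -> w <= 4 * (s * p) ->
    `|E V - E (Num.sqrt k * w)| <= (Num.sqrt k * (s * p))^-1 * 2 /\
    `|E (- V) - E (- (Num.sqrt k * w))| <= (Num.sqrt k * (s * p))^-1 * 2.
  move=> h1 h2; have w0 : 0 < w by lra.
  have kw0 : 0 < Num.sqrt k * w by rewrite mulr_gt0.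
  have kwV : Num.sqrt k * w <= V by rewrite (le_trans _ kV) // ler_pM2l.
  have i : (Num.sqrt k * w)^-1 <= (Num.sqrt k * (s * p))^-1.
    by rewrite lef_pV2 ?posrE ?mulr_gt0 // ler_pM2l.
  have := fresnel_tail kw0 kwV VA dE; have := fresnel_tailN kw0 kwV VA dE.
  by move=> *; split; lra.
have := @width n1; have := @width n2; rewrite !leqnn n12 => /(_ isT) + /(_ isT).
rewrite !ler_norml => /andP[_ b2] /andP[b1 _].
have [t2 _] := tail _ w2 b2.
have w1u : - (n1%:R - s ^+ 2) <= 4 * (s * p) by lra.
have [_ t1] := tail _ w1 w1u.
rewrite mulrN opprK in t1.
have kk : (Num.sqrt k * (s * p))^-1 * 2 / Num.sqrt k = 16 / 3 / t / p.
  rewrite (_ : _ / _ = 2 / (Num.sqrt k ^+ 2 * (s * p))); last by field; rewrite !gt_eqF.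
  by rewrite sqr_sqrtr ?(ltW k0) // /k; field; rewrite !gt_eqF.
have cnt : (n2 - n1)%:R * (2 * k + 4 * k ^+ 2 * (4 * (s * p)) ^+ 2) <= 6 * t * p + 72 * t ^+ 2 / p.
  apply: (@le_trans _ _ (8 * (s * p) * (2 * k + 4 * k ^+ 2 * (4 * (s * p)) ^+ 2))).
    have h1 : 0 <= k ^+ 2 by exact: sqr_ge0.
    have h2 : 0 <= (4 * (s * p)) ^+ 2 by exact: sqr_ge0.
    apply: ler_wpM2r; last exact: count.
    apply: addr_ge0; first by rewrite mulr_ge0 // ltW.
    by apply: mulr_ge0 => //; exact: mulr_ge0.
  have -> : 8 * (s * p) * (2 * k + 4 * k ^+ 2 * (4 * (s * p)) ^+ 2) =
      6 * t * p + 72 * t ^+ 2 * (s * p ^+ 4) / p by rewrite /k; field; rewrite !gt_eqF.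
  by rewrite sp mulr1.
have : `|(E V - E (- V)) / Num.sqrt k - (E (Num.sqrt k * (n2%:R - s ^+ 2)) - E (Num.sqrt k * (n1%:R - s ^+ 2))) / Num.sqrt k| <= 32 / 3 / t / p.
  rewrite -mulrBl normrM (gtr0_norm (_ : 0 < (Num.sqrt k)^-1)) ?invr_gt0 //.
  rewrite (_ : 32 / 3 / t / p = ((Num.sqrt k * (s * p))^-1 * 2 + (Num.sqrt k * (s * p))^-1 * 2) / Num.sqrt k).
    rewrite ler_pM2r ?invr_gt0 //.
    by move: t1 t2; rewrite !ler_norml => /andP[? ?] /andP[? ?]; apply/andP; split; lra.
  by rewrite [RHS]mulrDl kk; field; rewrite !gt_eqF.
move: h cnt; rewrite !ler_norml => /andP[? ?] ? /andP[? ?].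
by apply/andP; split; lra.
Qed.

(** Two Kusmin-Landau tails, the quadratic model and the trapezoids are the sources of error. All
    are O([1 / p]), the fourth root of [s], while the main term has size [sqrt s]. *)
Lemma stationary_phase :
  Num.sqrt k * (4 * (s * p)) <= V -> V < A ->
  (forall x : R, - A < x < A -> is_derive x 1 Ec (cos (x * x + 0))) ->
  (forall x : R, - A < x < A -> is_derive x 1 Es (cos (x * x - pi / 2))) ->
  normc (\sum_(a <= n < b) cis (phase t s n)
    - cis (- (t * s ^+ 3 / 2)) * ((Num.sqrt k)^-1)%:C
      * Complex (Ec V - Ec (- V)) (Es V - Es (- V))) <= stationary_bound t / p.
Proof.
ctx; move=> kV VA dEc dEs; move: sp1 k0 => sp1_ k0_.
have hc := center_real kV VA dEc; have hs := center_real kV VA dEs.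
rewrite (big_cat_nat an1 (leq_trans n12 n2b)) (big_cat_nat n12 n2b) /=.
set SL := \sum_(a <= n < n1) _; set SR := \sum_(n2 <= n < b) _.
set SC := \sum_(n1 <= n < n2) _; set M := _ * _ * _.
pose Q := \sum_(n < n2 - n1)
  cis (- (t * s ^+ 3 / 2) + k * (((n1 + n)%:R - s ^+ 2) * ((n1 + n)%:R - s ^+ 2))).
have hQ : normc (SC - Q) <= 2560 * t.
  rewrite /SC /Q sum_nat_shift -sumrB (le_trans (normc_sum _ _ _)) //.
  apply: (@le_trans _ _ (\sum_(n < n2 - n1) 320 * t * p ^+ 3)).
    apply: ler_sum => n _; apply: phase_error.
    by rewrite leq_addr /= -leq_subRL // ltnW.
  rewrite sumr_const card_ord -[_ *+ _]mulr_natr.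
  apply: (@le_trans _ _ (320 * t * p ^+ 3 * (8 * (s * p)))).
    apply: ler_wpM2l; last exact: count.
    by apply: mulr_ge0; [lra|rewrite exprn_ge0 // ltW].
  have -> : 320 * t * p ^+ 3 * (8 * (s * p)) = 2560 * t * (s * p ^+ 4) by ring.
  by rewrite sp mulr1.
have hM : normc (Q - M) <= 2 * (1 + 6 * t * p + 72 * t ^+ 2 / p + 32 / 3 / t / p).
  have -> : Q - M = cis (- (t * s ^+ 3 / 2)) *
      (\sum_(n < n2 - n1) cis (k * (((n1 + n)%:R - s ^+ 2) * ((n1 + n)%:R - s ^+ 2)))
       - ((Num.sqrt k)^-1)%:C * Complex (Ec V - Ec (- V)) (Es V - Es (- V))).
    rewrite mulrBr mulr_sumr /Q; congr (_ - _); last exact/esym/mulrA.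
    by apply: eq_bigr => n _; rewrite cisD.
  rewrite Normc.normcM normc_cis mul1r (le_trans (normc_le_ReIm _)) //.
  rewrite ReB ImB Re_sum Im_sum ReM ImM /= mul0r subr0 mul0r addr0.
  rewrite mulr_natl mulr2n ![(Num.sqrt k)^-1 * _]mulrC; apply: lerD.
    by apply: le_trans hc; under [in leRHS]eq_bigr do rewrite addr0.
  by apply: le_trans hs; under [in leRHS]eq_bigr do rewrite cosBpihalf.
have hL := left_tail; have hR := right_tail.
have -> : SL + (SC + SR) - M = SL + SR + ((SC - Q) + (Q - M)) by ring.
rewrite (le_trans (le_normcD _ _)) //.
have := le_normcD SL SR; have := le_normcD (SC - Q) (Q - M).
rewrite /stationary_bound -/SL -/SR in hL hR *.
have ip : 1 <= p^-1 by rewrite invf_ge1.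
have tp : t <= t / p by rewrite ler_peMr // ltW.
have tpp : t * p <= t / p by rewrite ler_pM2l //; lra.
have -> : (2572 * t + 144 * t ^+ 2 + 5 + 28 / t) / p =
  2572 * (t / p) + 144 * (t ^+ 2 / p) + 5 * p^-1 + 28 * (t^-1 / p) by field; rewrite !gt_eqF.
have e1 : 8 / 3 / t / p = 8 / 3 * (t^-1 / p) by rewrite !mulrA.
have e2 : 32 / 3 / t / p = 32 / 3 * (t^-1 / p) by rewrite !mulrA.
rewrite e1 in hL hR; rewrite e2 in hM.
have : 0 <= t^-1 / p by rewrite divr_ge0 ?invr_ge0 // ltW.
lra.
Qed.

End Block.
End StationaryPhase.

(** * From the sum over integers to the dual sum over blocks *)

Section Blocks.
Context {R : realType}.
Implicit Types (t s p : R).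

Lemma abel_bounded_variation (w : nat -> R) (z : nat -> R[i]) (B : R) (m : nat) :
  (forall j, (j <= m)%N -> normc (\sum_(i < j) z i) <= B) ->
  normc (\sum_(i < m) (w i)%:C * z i) <= B * (`|w m| + \sum_(i < m) `|w i.+1 - w i|).
Proof.
move=> hB.
suff h : normc (\sum_(i < m) (w i)%:C * z i - (w m)%:C * \sum_(i < m) z i)
    <= B * \sum_(i < m) `|w i.+1 - w i|.
  have := normc_addl_le (\sum_(i < m) (w i)%:C * z i) (- ((w m)%:C * \sum_(i < m) z i)).
  rewrite normcN Normc.normcM normc_real => /le_trans; apply.
  rewrite mulrDr addrC lerD // mulrC ler_wpM2r //; exact: hB.
elim: m hB => [|m ih] hB.
  by rewrite !big_ord0 mulr0 subr0 Normc.normc0 mulr0.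
have -> : \sum_(i < m.+1) (w i)%:C * z i - (w m.+1)%:C * \sum_(i < m.+1) z i =
  (\sum_(i < m) (w i)%:C * z i - (w m)%:C * \sum_(i < m) z i)
  - (w m.+1 - w m)%:C * \sum_(i < m.+1) z i.
  by rewrite !big_ord_recr /= rmorphB /=; ring.
rewrite [in leRHS]big_ord_recr /= mulrDr (le_trans (normc_le_sub _ _)) // lerD //.
  by apply: ih => j jm; apply: hB; exact: leqW.
by rewrite Normc.normcM normc_real mulrC ler_wpM2r // hB.
Qed.

Definition block_radius t : R := 2 * pi / (3 * t).

Lemma block_radius_gt0 t : 0 < t -> 0 < block_radius t.
Proof. by move=> t0; rewrite divr_gt0 // mulr_gt0 // pi_gt0. Qed.

Lemma stationary_phase_large t : 0 < t ->
  exists2 S1 : R, 1 <= S1 /\ 2 * block_radius t <= S1 &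
  forall s (A V : R) (Ec Es : R -> R), S1 <= s -> 1 + 6 * t * s <= V -> V < A ->
  (forall x : R, - A < x < A -> is_derive x 1 Ec (cos (x * x + 0))) ->
  (forall x : R, - A < x < A -> is_derive x 1 Es (cos (x * x - pi / 2))) ->
  normc (\sum_(nceil ((s - block_radius t) ^+ 2) <= n < nceil ((s + block_radius t) ^+ 2))
      cis (phase t s n)
    - (Num.sqrt s)%:C * (cis (- (t * s ^+ 3 / 2)) * ((Num.sqrt (8 / (3 * t)))%:C
      * Complex (Ec V - Ec (- V)) (Es V - Es (- V)))))
  <= stationary_bound t * Num.sqrt (Num.sqrt s).
Proof.
move=> t0; set r0 := block_radius t; have r00 : 0 < r0 by exact: block_radius_gt0.
(* The summands secure [1 <= s], [r0 <= s / 2], [2 <= r0 * s] and, through the fourth power,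
   [p <= r0 / 2] for [p = s^(- 1/4)]. *)
exists (1 + 2 * r0 + (2 / r0) + (2 / r0) ^+ 4).
  have : 0 < 2 / r0 by rewrite divr_gt0.
  move=> h; have : 0 < (2 / r0) ^+ 4 by rewrite exprn_gt0.
  by move=> ?; split; lra.
move=> s A V Ec Es hs hV VA dEc dEs.
have i0 : 0 < 2 / r0 by rewrite divr_gt0.
have i4 : 0 < (2 / r0) ^+ 4 by rewrite exprn_gt0.
have s1 : 1 <= s by lra.
have s0 : 0 < s by lra.
pose u := Num.sqrt (Num.sqrt s).
have u0 : 0 < u by rewrite !sqrtr_gt0.
have uE : u ^+ 2 = Num.sqrt s by rewrite sqr_sqrtr.
have sE : u ^+ 4 = s by rewrite (exprM u 2 2) uE sqr_sqrtr // ltW.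
have u1 : 1 <= u by rewrite -(@ler_pXn2r _ 4) ?nnegrE ?(ltW u0) // sE expr1n.
have us : u ^+ 2 <= s by rewrite -sE (exprM u 2 2) [leRHS]expr2 ler_peMr ?sqr_ge0 // exprn_ege1.
have ur : 2 / r0 <= u.
  by rewrite -(@ler_pXn2r _ 4) ?nnegrE ?(ltW u0) ?(ltW i0) // sE; lra.
have p0 : 0 < u^-1 by rewrite invr_gt0.
have p1 : u^-1 <= 1 by rewrite invf_le1.
have sp : s * u^-1 ^+ 4 = 1 by rewrite exprVn sE divff // gt_eqF.
have pr : u^-1 <= r0 / 2.
  by rewrite -[r0 / 2]invrK invf_div lef_pV2 ?posrE.
have rs : r0 <= s / 2 by lra.
have r2 : 2 <= r0 * s.
  have : 2 / r0 <= s by lra.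
  by rewrite ler_pdivrMr // mulrC.
(* With [u^4 = s] the square of the left side is [6 t u^2], which is below [V], hence below
   [V^2]. *)
have kV : Num.sqrt (3 * t / (8 * s)) * (4 * (s * u^-1)) <= V.
  have ts0 : 0 < 6 * t * s by apply: mulr_gt0 => //; lra.
  have V0 : 0 <= V by lra.
  have l0 : 0 <= Num.sqrt (3 * t / (8 * s)) * (4 * (s * u^-1)).
    by rewrite mulr_ge0 ?sqrtr_ge0 // !mulr_ge0 // ?ltW.
  rewrite -(@ler_pXn2r _ 2) ?nnegrE // exprMn sqr_sqrtr; last first.
    by rewrite divr_ge0 // mulr_ge0 // ltW.
  have -> : 3 * t / (8 * s) * (4 * (s * u^-1)) ^+ 2 = 6 * t * (s / u ^+ 2).
    by field; rewrite !gt_eqF.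
  rewrite -{1}sE (exprM u 2 2) expr2 mulfK ?expf_neq0 ?gt_eqF //.
  have V1 : 1 <= V by lra.
  apply: (@le_trans _ _ V); last by rewrite expr2 ler_peMr.
  have : 6 * t * u ^+ 2 <= 6 * t * s by rewrite ler_pM2l // mulr_gt0.
  lra.
have := stationary_phase t0 s1 p0 p1 sp (erefl r0) pr rs r2 kV VA dEc dEs.
rewrite invrK; congr (normc (_ - _) <= _).
have -> : (Num.sqrt (3 * t / (8 * s)))^-1 = Num.sqrt s * Num.sqrt (8 / (3 * t)).
  rewrite -sqrtrM ?ltW // -sqrtrV; last by rewrite divr_ge0 // mulr_ge0 // ltW.
  by congr Num.sqrt; field; rewrite !gt_eqF.
by rewrite rmorphM /=; ring.
Qed.

Lemma fresnel_bounded E (A c V : R) : 1 <= V -> V < A ->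
  (forall x : R, - A < x < A -> is_derive x 1 E (cos (x * x + c))) ->
  `|E V - E (- V)| <= 6.
Proof.
move=> V1 VA dE; have o0 : 0 < 1 :> R by [].
have h1 := fresnel_tail o0 V1 VA dE; have h2 := fresnel_tailN o0 V1 VA dE.
have : `|E 1 - E (- 1)| <= 1 * (1 - - 1).
  apply: (@mvt_norm R E (fun x => cos (x * x + c))) => [|x /andP[? ?]|x _]; first by lra.
    by apply: dE; apply/andP; split; lra.
  exact: cos_max.
move: h1 h2; rewrite invr1 !ler_norml => /andP[? ?] /andP[? ?] /andP[? ?].
by apply/andP; split; lra.
Qed.

Lemma le_nceil (x y : R) : 0 <= x -> x <= y -> (nceil x <= nceil y)%N.
Proof.
move=> x0 xy; have [_ h1] := nceilP x0; have [h2 _] := nceilP (le_trans x0 xy).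
by rewrite -ltnS -(ltr_nat R) -natr1; lra.
Qed.

Lemma normc_sum_cis_le (f : nat -> R) (m n : nat) :
  normc (\sum_(m <= i < n) cis (f i)) <= (n - m)%:R.
Proof.
rewrite (le_trans (normc_sum _ _ _)) // (eq_bigr (fun=> 1)) => [|i _]; last exact: normc_cis.
by rewrite big_const_nat iter_addr addr0.
Qed.

Lemma sum_blocks (V : nmodType) (a : nat -> nat) (F : nat -> V) (M : nat) :
  (forall j, (a j <= a j.+1)%N) ->
  \sum_(0 <= n < a M) F n = \sum_(0 <= n < a 0%N) F n
    + \sum_(j < M) \sum_(a j <= n < a j.+1) F n.
Proof.
move=> am; elim: M => [|M ih]; first by rewrite big_ord0 addr0.
by rewrite big_ord_recr /= addrA -ih -big_cat_nat.
Qed.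

Lemma abel_sqrt_weights (s : nat -> R) (z : nat -> R[i]) (B : R) (M : nat) :
  (forall j, s j <= s j.+1) ->
  (forall j, (j <= M)%N -> normc (\sum_(i < j) z i) <= B) ->
  normc (\sum_(i < M) (Num.sqrt (s i))%:C * z i) <= B * (2 * Num.sqrt (s M)).
Proof.
move=> sm hB; apply: (le_trans (abel_bounded_variation (fun i => Num.sqrt (s i)) hB)).
have B0 : 0 <= B by apply: le_trans (hB 0%N isT); exact: normc_ge0.
rewrite ler_wpM2l // mulr_natl mulr2n ger0_norm ?sqrtr_ge0 // lerD2l.
rewrite (eq_bigr (fun i : 'I_M => Num.sqrt (s i.+1) - Num.sqrt (s i))); last first.
  by move=> i _; rewrite ger0_norm // subr_ge0 ler_wsqrtr.
rewrite -(big_mkord xpredT (fun i => Num.sqrt (s i.+1) - Num.sqrt (s i))).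
by rewrite telescope_sumr // gerBl sqrtr_ge0.
Qed.

(** The van der Corput transformation: blocks around the points where the phase derivative is a
    multiple of [2 pi] are replaced by their stationary terms, and Abel summation removes the
    amplitudes [sqrt s]. About [sqrt N] block errors of size [N^(1/8)] add up to the power 5/4 of
    [sqrt N]; [3/4 <= th] keeps this within the claimed bound. *)
Lemma exp_sum_transfer t th (D : R) : 0 < t -> 3 / 4 <= th -> th <= 1 -> 0 <= D ->
  (forall (s : R) (M : nat),
     normc (\sum_(j < M) cis (- (t * (s + 2 * block_radius t * j%:R) ^+ 3 / 2)))
     <= D * M%:R `^ th) ->
  exists2 C : R, 0 <= C & forall x (N : nat), (0 < N)%N ->
    normc (\sum_(0 <= n < N) cis (t * (n%:R * Num.sqrt n%:R) + n%:R * x))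
    <= C * Num.sqrt N%:R `^ (1 / 2 + th).
Proof.
move=> t0 th34 th1 D0 hW.
have [S1 [S11 S1r] hS] := stationary_phase_large t0.
set r0 := block_radius t in S1r hS hW *; have r00 : 0 < r0 by exact: block_radius_gt0.
have tr0 : 3 / 2 * t * (2 * r0) = 2 * pi.
  by rewrite /r0 /block_radius; field; rewrite gt_eqF.
clearbody r0.
pose Z0 : R := Num.sqrt (8 / (3 * t)) * 12.
pose c := 1 + r0; have [e eE] : exists e, e = c / (2 * r0) by eexists.
have [Cb CbE] : exists Cb, Cb = stationary_bound t by eexists.
have Cb0 : 0 <= Cb.
  rewrite CbE /stationary_bound.
  have : 0 < 28 / t by rewrite divr_gt0.
  have := sqr_ge0 t; lra.
have c0 : 0 < c by rewrite /c; lra.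
have e0 : 0 < e by rewrite eE divr_gt0 // mulr_gt0.
have [e0' c0' r0'] : [/\ 0 <= e, 0 <= c & 0 <= r0] by split; exact: ltW.
have Z00 : 0 <= Z0 by rewrite mulr_ge0 ?sqrtr_ge0.
pose C0 := (S1 + 2 * r0) ^+ 2 + 1.
have C00 : 0 <= C0 by rewrite addr_ge0 ?sqr_ge0.
exists (C0 + D * (e `^ th) * Z0 * (2 * Num.sqrt c) + e * Cb * Num.sqrt (Num.sqrt c)
  + (4 * r0 * c + 1)).
  have h1 : 0 <= D * (e `^ th) * Z0 * (2 * Num.sqrt c).
    by rewrite !mulr_ge0 ?powR_ge0 ?sqrtr_ge0.
  have h2 : 0 <= e * Cb * Num.sqrt (Num.sqrt c) by rewrite !mulr_ge0 ?sqrtr_ge0.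
  have h3 : 0 <= 4 * r0 * c by rewrite !mulr_ge0.
  lra.
move=> x N N0; set X := Num.sqrt N%:R.
have X1 : 1 <= X by rewrite -sqrtr1 ler_wsqrtr // ler1n.
have X0 : 0 < X by lra.
have X0' := ltW X0.
set Y := X `^ (1 / 2 + th).
have Y1 : X <= Y by rewrite -{1}(powRr1 (ltW X0)) ler_powR //; lra.
(* At [sqrt n = s0] the derivative [3/2 * t * sqrt n + x] equals [2 pi k]. As [s0] lies between [S1]
   and [S1 + 2 r0], the discarded head has a length bounded independently of [x]. *)
pose k := Num.ceil ((x + 3 / 2 * t * S1) / (2 * pi)).
pose s0 := (2 * pi * k%:~R - x) / (3 / 2 * t).
have p0 := @pi_gt0 R.
have t32 : 0 < 3 / 2 * t by lra.
have s0E : 3 / 2 * t * s0 = 2 * pi * k%:~R - x by rewrite /s0 mulrC divfK // gt_eqF.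
have s0S : S1 <= s0.
  rewrite -(ler_pM2l t32) s0E.
  have := ceil_ge ((x + 3 / 2 * t * S1) / (2 * pi)).
  by rewrite ler_pdivrMr ?mulr_gt0 // -/k; lra.
have s0S' : s0 <= S1 + 2 * r0.
  rewrite -(ler_pM2l t32) s0E [leRHS]mulrDr tr0.
  have := ceilB1_lt ((x + 3 / 2 * t * S1) / (2 * pi)).
  by rewrite ltr_pdivlMr ?mulr_gt0 // intrB -/k; lra.
pose s (j : nat) := s0 + 2 * r0 * j%:R.
have sS j : s j.+1 = s j + 2 * r0 by rewrite /s -natr1; ring.
have sm j : s j <= s j.+1 by rewrite sS; lra.
have s0j j : s0 <= s j by rewrite /s lerDl !mulr_ge0 // ltW.
have sj0 j : 0 <= s j - r0 by have := s0j j; lra.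
have sleM i j : (i <= j)%N -> s i <= s j.
  by move=> ij; rewrite /s lerD2l ler_wpM2l ?ler_nat //; lra.
pose a j := nceil ((s j - r0) ^+ 2).
have am j : (a j <= a j.+1)%N.
  apply: le_nceil; first exact: sqr_ge0.
  by rewrite ler_pXn2r ?nnegrE //; have := sm j; lra.
have aP j : (s j - r0) ^+ 2 <= (a j)%:R /\ (a j)%:R < (s j - r0) ^+ 2 + 1.
  by apply: nceilP; exact: sqr_ge0.
have exj : exists j, (N < a j)%N.
  pose j := nceil ((N%:R + 1) / (2 * r0)).
  have j0 : 0 <= (N%:R + 1) / (2 * r0) by rewrite divr_ge0 ?addr_ge0 // mulr_ge0.
  have [h _] := nceilP j0; rewrite -/j in h.
  exists j; rewrite -(ltr_nat R); have [h1 _] := aP j; apply: lt_le_trans h1.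
  rewrite ler_pdivrMr ?mulr_gt0 // in h.
  have h2 : N%:R + 1 <= s j - r0 by rewrite /s; lra.
  have h3 : 1 <= s j - r0 by have := ler0n R N; lra.
  have : s j - r0 <= (s j - r0) ^+ 2 by rewrite expr2 ler_peMr.
  lra.
pose z n := cis (t * (n%:R * Num.sqrt n%:R) + n%:R * x) : R[i].
rewrite -/(z _).
have a0C : (a 0%N)%:R <= C0.
  have [_ h] := aP 0%N; rewrite /C0 (le_trans (ltW h)) // lerD2r.
  rewrite ler_pXn2r ?nnegrE //; first by rewrite /s mulr0n mulr0 addr0; lra.
  by lra.
set Ctot := (X in _ <= X * Y).
have tot0 : C0 * Y <= Ctot * Y.
  apply: ler_wpM2r; first exact: powR_ge0.
  rewrite /Ctot.
  have h1 : 0 <= D * (e `^ th) * Z0 * (2 * Num.sqrt c).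
    by rewrite !mulr_ge0 ?powR_ge0 ?sqrtr_ge0.
  have h2 : 0 <= e * Cb * Num.sqrt (Num.sqrt c) by rewrite !mulr_ge0 ?sqrtr_ge0.
  have h3 : 0 <= 4 * r0 * c by rewrite !mulr_ge0.
  lra.
case: (ex_minnP exj) => [[|M]] NaM hmin.
  apply: (le_trans (normc_sum_cis_le _ _ _)); rewrite subn0.
  apply: le_trans tot0; apply: (@le_trans _ _ C0).
    by apply: le_trans a0C; rewrite ler_nat ltnW.
  by rewrite ler_peMr //; lra.
have {hmin} aMN : (a M <= N)%N.
  by rewrite leqNgt; apply/negP => /hmin; rewrite ltnn.
have sMX : s M <= c * X.
  have [h1 _] := aP M; have : (s M - r0) ^+ 2 <= X ^+ 2.
    by rewrite sqr_sqrtr // (le_trans h1) // ler_nat.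
  rewrite ler_pXn2r ?nnegrE // ?(ltW X0) // /c => h2.
  have : r0 * 1 <= r0 * X by rewrite ler_pM2l.
  lra.
have sM0 : 0 < s M by have := s0j M; lra.
have MX : M%:R <= e * X.
  rewrite eE mulrAC ler_pdivlMr ?mulr_gt0 // mulrC; apply: le_trans sMX.
  by rewrite /s lerDr; lra.
rewrite (big_cat_nat (leq0n _) aMN) /= (sum_blocks _ _ am).
(* [V] is fitted to the last centre, so that the same Fresnel factor [Z] serves all blocks and
   factors out of the dual sum. *)
pose V := 1 + 6 * t * s M; pose A := V + 1.
have VA : V < A by rewrite /A ltrDl.
have ts0 : 0 < 6 * t * s M by apply: mulr_gt0 => //; lra.
have V1 : 1 <= V by rewrite /V; lra.
have [Ec dEc] := exists_primitive A (@continuous_cos_quad R 0).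
have [Es dEs] := exists_primitive A (@continuous_cos_quad R (- (pi / 2))).
pose Z := (Num.sqrt (8 / (3 * t)))%:C * Complex (Ec V - Ec (- V)) (Es V - Es (- V)).
have ZZ0 : normc Z <= Z0.
  rewrite Normc.normcM normc_real ger0_norm ?sqrtr_ge0 // ler_wpM2l ?sqrtr_ge0 //.
  rewrite (le_trans (normc_le_ReIm _)) //=.
  have := fresnel_bounded V1 VA dEc; have := fresnel_bounded V1 VA dEs; lra.
(* At integers the phase adapted to block [j] differs from the original phase by a multiple of
   [2 pi]. *)
have phE j n : cis (phase t (s j) n) = z n.
  rewrite /z -(cis_per _ (n%:Z * (k + j%:Z))) /phase; congr cis.
  rewrite [3 / 2 * t * s j](_ : _ = 2 * pi * k%:~R - x + 2 * pi * j%:R).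
    by rewrite intrM intrD -!pmulrn; ring.
  by rewrite /s mulrDr s0E mulrA tr0.
have hblock j : (j < M)%N ->
    normc (\sum_(a j <= n < a j.+1) z n
      - (Num.sqrt (s j))%:C * (cis (- (t * (s j) ^+ 3 / 2)) * Z))
    <= Cb * Num.sqrt (Num.sqrt (s M)).
  move=> jM; have sjM := sleM _ _ (ltnW jM).
  have := hS (s j) A V Ec Es (le_trans s0S (s0j j)) _ VA dEc dEs.
  have -> : (s j + r0) = s j.+1 - r0 by rewrite sS; ring.
  under eq_bigr do rewrite phE.
  move=> h; apply: (le_trans (h _)).
    by rewrite /V lerD2l ler_pM2l //; lra.
  by rewrite -CbE ler_wpM2l // !ler_wsqrtr.
have hmain : normc (\sum_(j < M) (Num.sqrt (s j))%:C * (cis (- (t * (s j) ^+ 3 / 2)) * Z))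
    <= D * M%:R `^ th * Z0 * (2 * Num.sqrt (s M)).
  apply: (@abel_sqrt_weights s (fun j => cis (- (t * s j ^+ 3 / 2)) * Z)) => // j jM.
  rewrite -mulr_suml Normc.normcM ler_pM ?normc_ge0 //.
  apply: (le_trans (hW s0 j)); rewrite ler_wpM2l // ge0_ler_powR ?nnegrE //; last by rewrite ler_nat.
  lra.
set S0 := \sum_(0 <= n < a 0%N) _; set SB := \sum_(j < M) _; set SR := \sum_(a M <= n < N) _.
set SM := \sum_(j < M) _ in hmain.
have hS0 : normc S0 <= C0.
  by apply: (le_trans (normc_sum_cis_le _ _ _)); rewrite subn0.
have hSB : normc (SB - SM) <= M%:R * (Cb * Num.sqrt (Num.sqrt (s M))).
  rewrite -sumrB (le_trans (normc_sum _ _ _)) //.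
  apply: (@le_trans _ _ (\sum_(j < M) Cb * Num.sqrt (Num.sqrt (s M)))).
    by apply: ler_sum => j _; exact: hblock.
  by rewrite sumr_const card_ord -[_ *+ M]mulr_natl.
(* The unfinished block between [a M] and [N] is estimated by its length, which is O([sqrt N]). *)
have hSR : normc SR <= 4 * r0 * s M + 1.
  apply: (le_trans (normc_sum_cis_le _ _ _)); rewrite natrB //.
  have [h1 _] := aP M; have [_ h2] := aP M.+1.
  have h3 : N%:R <= (a M.+1)%:R :> R by rewrite ler_nat ltnW.
  by rewrite sS in h2; rewrite !expr2 in h1 h2; lra.
have -> : S0 + SB + SR = S0 + SR + ((SB - SM) + SM) by ring.
have b1 : D * M%:R `^ th * Z0 * (2 * Num.sqrt (s M)) <= D * (e `^ th) * Z0 * (2 * Num.sqrt c) * Y.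
  have h1 : M%:R `^ th <= e `^ th * X `^ th.
    rewrite -powRM //; apply: ge0_ler_powR; rewrite ?nnegrE ?mulr_ge0 //; lra.
  have h2 : Num.sqrt (s M) <= Num.sqrt c * X `^ (1 / 2).
    by rewrite mul1r powR12_sqrt ?(ltW X0) // -sqrtrM ?(ltW c0) // ler_wsqrtr.
  rewrite /Y powRD; last by rewrite (gt_eqF X0) implybT.
  have -> : D * e `^ th * Z0 * (2 * Num.sqrt c) * (X `^ (1 / 2) * X `^ th) =
     D * (e `^ th * X `^ th) * Z0 * (2 * (Num.sqrt c * X `^ (1 / 2))) by ring.
  apply: ler_pM; rewrite ?mulr_ge0 ?powR_ge0 ?sqrtr_ge0 //.
    by rewrite ler_wpM2r // ler_wpM2l.
  by rewrite ler_wpM2l.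
have b2 : M%:R * (Cb * Num.sqrt (Num.sqrt (s M))) <= e * Cb * Num.sqrt (Num.sqrt c) * Y.
  have h2 : Num.sqrt (Num.sqrt (s M)) <= Num.sqrt (Num.sqrt c) * X `^ (1 / 4).
    have -> : X `^ (1 / 4) = Num.sqrt (Num.sqrt X).
      rewrite -!powR12_sqrt ?powR_ge0 ?(ltW X0) // -powRrM; congr (_ `^ _); by field.
    rewrite -sqrtrM ?sqrtr_ge0 // ler_wsqrtr // -sqrtrM // ler_wsqrtr //.
  have h3 : X * X `^ (1 / 4) <= Y.
    rewrite -{1}(powRr1 (ltW X0)) -powRD; last by rewrite (gt_eqF X0) implybT.
    by rewrite ler_powR //; lra.
  apply: (@le_trans _ _ (e * X * (Cb * (Num.sqrt (Num.sqrt c) * X `^ (1 / 4))))).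
    by apply: ler_pM; rewrite ?mulr_ge0 ?sqrtr_ge0 // ler_wpM2l.
  have -> : e * X * (Cb * (Num.sqrt (Num.sqrt c) * X `^ (1 / 4))) =
    e * Cb * Num.sqrt (Num.sqrt c) * (X * X `^ (1 / 4)) by ring.
  by rewrite ler_wpM2l // !mulr_ge0 ?sqrtr_ge0 // ltW.
have b3 : 4 * r0 * s M + 1 <= (4 * r0 * c + 1) * Y.
  have : 4 * r0 * s M <= 4 * r0 * (c * Y).
    rewrite ler_wpM2l //; first by lra.
    by rewrite (le_trans sMX) // ler_pM2l.
  lra.
have b0 : C0 <= C0 * Y by rewrite ler_peMr //; lra.
apply: (le_trans (le_normcD _ _)).
apply: (le_trans (lerD (le_normcD _ _) (le_normcD _ _))).
apply: (le_trans (lerD (lerD hS0 hSR) (lerD hSB hmain))).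
apply: (le_trans (lerD (lerD b0 b3) (lerD b2 b1))).
by rewrite le_eqVlt; apply/orP; left; apply/eqP; rewrite /Ctot; ring.
Qed.

End Blocks.

(** * The divisor bound: any power of the number of divisors is O([m]) *)

Section DivisorBound.
Local Open Scope nat_scope.

(** This is [a + 1 <= k * 2^(a / k)], with integer division, raised to the power [k]. *)
Lemma succ_exp_le (k a : nat) : 0 < k -> a.+1 ^ k <= k ^ k * 2 ^ a.
Proof.
move=> k0; have h : a.+1 <= k * 2 ^ (a %/ k).
  apply: (@leq_trans (k * (a %/ k).+1)); last by rewrite leq_mul2l ltn_expl ?orbT.
  by rewrite mulnC -ltn_divLR //.
apply: (@leq_trans ((k * 2 ^ (a %/ k)) ^ k)); first by rewrite leq_exp2r.
by rewrite expnMn -expnM leq_mul2l leq_exp2l // leq_trunc_div orbT.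
Qed.

Lemma size_divisors_pfactor (p a m : nat) : prime p -> 0 < m -> ~~ (p %| m) ->
  size (divisors (p ^ a * m)) <= a.+1 * size (divisors m).
Proof.
move=> pp m0 pm.
have -> : a.+1 * size (divisors m) =
    size [seq p ^ i * e | i <- iota 0 a.+1, e <- divisors m].
  by rewrite size_allpairs size_iota.
apply: uniq_leq_size; first exact: divisors_uniq.
have pa0 : 0 < p ^ a by rewrite expn_gt0 prime_gt0.
move=> d; rewrite -dvdn_divisors ?muln_gt0 ?pa0 // => dm.
have d0 : 0 < d by apply: dvdn_gt0 dm; rewrite muln_gt0 pa0.
have [r pr dE] := pfactor_coprime pp d0.
rewrite dE mulnC; apply: allpairs_f.
  rewrite mem_iota /= add0n ltnS -(dvdn_Pexp2l _ _ (prime_gt1 pp)).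
  have : p ^ logn p d %| p ^ a * m.
    by apply: dvdn_trans dm; rewrite [X in _ %| X]dE dvdn_mull.
  by rewrite Gauss_dvdl // coprimeXl // prime_coprime.
rewrite -dvdn_divisors //.
have : r %| p ^ a * m by apply: dvdn_trans dm; rewrite dE dvdn_mulr.
by rewrite Gauss_dvdr // coprimeXr // coprime_sym.
Qed.

(* Primes [p >= 2 ^ k] contribute a factor [(a + 1) ^ k <= p ^ a], and the
   finitely many others at most [k ^ k * p ^ a]. *)
Lemma divisor_bound (k : nat) : 0 < k ->
  exists2 C, 0 < C & forall m, 0 < m -> size (divisors m) ^ k <= C * m.
Proof.
move=> k0; have kk0 : 0 < k ^ k by rewrite expn_gt0 k0.
suff H P m : 0 < m -> (forall p, prime p -> p %| m -> p < P) ->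
    size (divisors m) ^ k <= (k ^ k) ^ minn P (2 ^ k) * m.
  exists ((k ^ k) ^ 2 ^ k) => [|m m0]; first by rewrite expn_gt0 kk0.
  apply: (leq_trans (H m.+1 m m0 _)).
    by move=> p _ /(dvdn_leq m0); rewrite ltnS.
  by rewrite leq_mul2r leq_pexp2l ?orbT // geq_minr.
elim: P m => [|P ih] m m0 hP.
  case: (ltnP 1 m) => [m1|m1].
    by have := hP (pdiv m) (pdiv_prime m1) (pdiv_dvd m).
  have -> : m = 1 by apply/eqP; rewrite eqn_leq m1.
  by rewrite min0n expn0 exp1n.
have [pP|nP] := boolP (prime P && (P %| m)); last first.
  apply: (leq_trans (ih m m0 _)).
    move=> p pp pm; have := hP p pp pm; rewrite ltnS leq_eqVlt => /predU1P[E|//].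
    by rewrite -E pp pm in nP.
  rewrite leq_mul2r leq_pexp2l ?orbT // leq_min geq_minr andbT.
  by rewrite (leq_trans (geq_minl _ _)).
have /andP[pp Pm] := pP.
have [m' Pm' mE] := pfactor_coprime pp m0.
have m'0 : 0 < m' by move: m0; rewrite mE muln_gt0 => /andP[].
have nPm' : ~~ (P %| m') by rewrite -prime_coprime.
set a := logn P m in mE.
rewrite {1}mE mulnC.
apply: (@leq_trans ((a.+1 * size (divisors m')) ^ k)).
  by rewrite leq_exp2r // size_divisors_pfactor.
rewrite expnMn.
have h' : size (divisors m') ^ k <= (k ^ k) ^ minn P (2 ^ k) * m'.
  apply: ih => // p pq pm'; have : p < P.+1 by apply: hP => //; rewrite mE dvdn_mulr.
  rewrite ltnS leq_eqVlt => /predU1P[E|//].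
  by rewrite E (negPf nPm') in pm'.
have P2 := prime_gt1 pp.
apply: (leq_trans (leq_mul (leqnn _) h')).
rewrite {1}mE; have [PB|] := boolP (2 ^ k <= P).
  have -> : minn P.+1 (2 ^ k) = minn P (2 ^ k).
    by rewrite (minn_idPr PB) (minn_idPr (leqW PB)).
  rewrite [X in _ <= X]mulnA [X in _ <= X]mulnC leq_mul2r; apply/orP; right.
  apply: (@leq_trans ((2 ^ a) ^ k)); first by rewrite leq_exp2r // ltn_expl.
  by rewrite -expnM mulnC expnM; case: (a) => // b; rewrite leq_exp2r.
rewrite -ltnNge => PB; have -> : minn P.+1 (2 ^ k) = (minn P (2 ^ k)).+1.
  by rewrite (minn_idPl PB) (minn_idPl (ltnW PB)).
rewrite expnS.
have h2 : a.+1 ^ k <= k ^ k * P ^ a.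
  apply: (leq_trans (succ_exp_le a k0)); rewrite leq_mul2l; apply/orP; right.
  by case: (a) => // b; rewrite leq_exp2r.
apply: (leq_trans (leq_mul h2 (leqnn _))).
rewrite -!mulnA leq_mul2l; apply/orP; right.
by rewrite mulnCA leq_mul2l [m' * _]mulnC leqnn orbT.
Qed.

End DivisorBound.

(** * Weyl differencing for quadratic and cubic sums *)

Section WeylDifferencing.
Context {R : realType}.

Lemma sum_triangle (z : nat -> R[i]) (N : nat) :
  \sum_(i < N) \sum_(j < i) z i * conjc (z j) =
  \sum_(h < N) \sum_(n < N - h.+1) z (n + h.+1)%N * conjc (z n).
Proof.
elim: N => [|N ih]; first by rewrite !big_ord0.
rewrite big_ord_recr /= ih [RHS]big_ord_recr /= subnn big_ord0 addr0.
rewrite [in RHS](eq_bigr (fun h : 'I_N => \sum_(n < N - h.+1) z (n + h.+1)%N * conjc (z n)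
   + z N * conjc (z (N - h.+1)%N))); last first.
  by move=> h _; rewrite subSS -(subnSK (ltn_ord h)) big_ord_recr /= subnK.
rewrite big_split /=; congr (_ + _).
by rewrite -(big_mkord xpredT (fun j => z N * conjc (z j))) big_nat_rev /= big_mkord add0n.
Qed.

(** Expand the square: the diagonal gives [N], the two triangles are conjugate to each other, and
    each is grouped by the difference of the indices. *)
Lemma normc_sum_sqr_le (z : nat -> R[i]) (N : nat) : (forall n, normc (z n) = 1) ->
  normc (\sum_(n < N) z n) ^+ 2 <=
  N%:R + 2 * \sum_(h < N) normc (\sum_(n < N - h.+1) z (n + h.+1)%N * conjc (z n)).
Proof.
move=> z1; set T := \sum_(i < N) \sum_(j < i) z i * conjc (z j).
have E : (\sum_(n < N) z n) * conjc (\sum_(n < N) z n) = (N%:R)%:C + T + conjc T.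
  rewrite {}/T; elim: N => [|N ih]; first by rewrite !big_ord0 mul0r; apply: complex_eq; rewrite ?ReD ?ImD /= ?oppr0 !addr0.
  rewrite !big_ord_recr /= !conjcD mulrDl !mulrDr ih -natr1 rmorphD /=.
  rewrite normc_mulJ z1 expr1n rmorph1.
  rewrite -mulr_sumr -conjc_sum conjcM conjcK.
  move: (\sum_(i < N) z i) (z N) => S w; move: (\sum_(i < N) _) => T.
  by rewrite [conjc w * S]mulrC; ring.
have hT : normc T <= \sum_(h < N) normc (\sum_(n < N - h.+1) z (n + h.+1)%N * conjc (z n)).
  by rewrite /T sum_triangle normc_sum.
have := congr1 normc E; rewrite Normc.normcM normcJ -expr2 => ->.
apply: (le_trans (le_normcD _ _)); rewrite normcJ.
have := le_normcD (N%:R)%:C T; rewrite normc_real ger0_norm //; lra.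
Qed.

(** The harmonic mean of [M] and [1 / |sin x|]. It dominates their minimum, the usual bound for a
    geometric sum, without a case distinction or a division by 0. *)
Definition geom_bound (M : nat) (x : R) : R := 2 * M%:R / (1 + M%:R * `|sin x|).

Lemma geom_bound_ge0 (M : nat) (x : R) : 0 <= geom_bound M x.
Proof. by rewrite divr_ge0 ?mulr_ge0 ?addr_ge0 ?mulr_ge0. Qed.

Lemma normc_geom_sum (K M : nat) (th : R) : (K <= M)%N ->
  normc (\sum_(n < K) cis (n%:R * th)) <= geom_bound M (th / 2).
Proof.
move=> KM; rewrite /geom_bound.
have s0 : 0 <= `|sin (th / 2)| by [].
set S := \sum_(n < K) _; set s := `|sin (th / 2)| in s0 *.
have d0 : 0 < 1 + M%:R * s by rewrite ltr_pwDl // mulr_ge0.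
have hS : normc S <= M%:R.
  apply: (@le_trans _ _ K%:R); last by rewrite ler_nat.
  have := @normc_sum_cis_le R (fun n => n%:R * th) 0 K.
  by rewrite big_mkord subn0.
have hs : s * normc S <= 1.
  have E : (cis th - 1) * S = cis (K%:R * th) - 1.
    rewrite cis_nat_mul subrX1; congr (_ * _); apply: eq_bigr => i _.
    by rewrite cis_nat_mul.
  have := congr1 normc E; rewrite Normc.normcM normc_cisB1 -/s => {}E.
  have : normc (cis (K%:R * th) - 1) <= 2.
    by rewrite (le_trans (normc_le_sub _ _)) // normc_cis Normc.normc1; lra.
  by rewrite -E; lra.
rewrite ler_pdivlMr //.
have : M%:R * (s * normc S) <= M%:R * 1 by rewrite ler_wpM2l.
lra.
Qed.

Lemma normc_quadratic_sum (a b c : R) (K M : nat) : (K <= M)%N ->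
  normc (\sum_(n < K) cis (a * n%:R ^+ 2 + b * n%:R + c)) ^+ 2 <=
  M%:R + 2 * \sum_(k < M) geom_bound M (a * k.+1%:R).
Proof.
move=> KM.
have := @normc_sum_sqr_le (fun n => cis (a * n%:R ^+ 2 + b * n%:R + c)) K
  (fun n => normc_cis _).
move/le_trans; apply; apply: lerD; first by rewrite ler_nat.
rewrite ler_wpM2l //.
apply: (@le_trans _ _ (\sum_(h < K) geom_bound M (a * h.+1%:R))); last first.
  rewrite -!(big_mkord xpredT (fun h => geom_bound M (a * h.+1%:R))).
  rewrite (big_cat_nat (leq0n K) KM) /= lerDl.
  by apply: sumr_ge0 => i _; exact: geom_bound_ge0.
apply: ler_sum => h _.
rewrite (eq_bigr (fun n : 'I_(K - h.+1) => cis (a * h.+1%:R ^+ 2 + b * h.+1%:R)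
   * cis (n%:R * (2 * (a * h.+1%:R))))); last first.
  by move=> n _; rewrite -cisN -!cisD natrD; congr cis; ring.
rewrite -mulr_sumr Normc.normcM normc_cis mul1r.
have := @normc_geom_sum (K - h.+1) M (2 * (a * h.+1%:R)).
by rewrite mulrAC divff // mul1r; apply; rewrite (leq_trans (leq_subr _ _)).
Qed.

Lemma sum_sqr_le_card (M : nat) (x : 'I_M -> R) :
  (\sum_(i < M) x i) ^+ 2 <= M%:R * \sum_(i < M) x i ^+ 2.
Proof.
have h : 0 <= \sum_(i < M) \sum_(j < M) (x i - x j) ^+ 2.
  by apply: sumr_ge0 => i _; apply: sumr_ge0 => j _; exact: sqr_ge0.
suff E : \sum_(i < M) \sum_(j < M) (x i - x j) ^+ 2 =
    2 * (M%:R * \sum_(i < M) x i ^+ 2) - 2 * (\sum_(i < M) x i) ^+ 2 by lra.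
rewrite (eq_bigr (fun i => M%:R * x i ^+ 2 + \sum_(j < M) x j ^+ 2
   - 2 * (x i * \sum_(j < M) x j))); last first.
  move=> i _; rewrite (eq_bigr (fun j => x i ^+ 2 + x j ^+ 2 - 2 * (x i * x j))).
    rewrite sumrB big_split /= -!mulr_sumr sumr_const card_ord.
    by rewrite -[x i *+ M]mulr_natl; ring.
  by move=> j _; ring.
rewrite sumrB big_split /= -(mulr_sumr _ _ (fun i => x i ^+ 2)).
rewrite -(mulr_sumr _ _ (fun i => x i * _)) -mulr_suml sumr_const card_ord.
by rewrite -[_ *+ M]mulr_natl; ring.
Qed.

(** Two differencing steps with Cauchy-Schwarz in between. The first leaves quadratic phases with
    leading coefficient [3 A h], the second linear ones, which are geometric sums. *)
Lemma normc_cubic_sum (A B C D : R) (M : nat) :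
  normc (\sum_(n < M) cis (A * n%:R ^+ 3 + B * n%:R ^+ 2 + C * n%:R + D)) ^+ 4 <=
  2 * M%:R ^+ 2 + 8 * M%:R ^+ 3
  + 16 * M%:R * \sum_(h < M) \sum_(k < M) geom_bound M (3 * A * (h.+1%:R * k.+1%:R)).
Proof.
set S := normc _.
have h1 := @normc_sum_sqr_le (fun n => cis (A * n%:R ^+ 3 + B * n%:R ^+ 2 + C * n%:R + D)) M
  (fun n => normc_cis _).
rewrite -/S in h1.
pose P (n : nat) := A * n%:R ^+ 3 + B * n%:R ^+ 2 + C * n%:R + D.
pose x (h : 'I_M) := normc (\sum_(n < M - h.+1) cis (P (n + h.+1)%N) * conjc (cis (P n))).
have {}h1 : S ^+ 2 <= M%:R + 2 * \sum_(h < M) x h by [].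
have x0 h : 0 <= x h by exact: normc_ge0.
have X0 : 0 <= \sum_(h < M) x h by exact: sumr_ge0.
have h2 : S ^+ 4 <= 2 * M%:R ^+ 2 + 8 * (\sum_(h < M) x h) ^+ 2.
  rewrite (exprM S 2 2); apply: (@le_trans _ _ ((M%:R + 2 * \sum_(h < M) x h) ^+ 2)).
    by rewrite ler_pXn2r ?nnegrE ?sqr_ge0 // addr_ge0 // mulr_ge0.
  by have := sqr_ge0 (M%:R - 2 * \sum_(h < M) x h); rewrite !expr2; lra.
apply: (le_trans h2); rewrite -addrA lerD2l.
have h3 := sum_sqr_le_card x.
have h4 : \sum_(h < M) x h ^+ 2 <=
    \sum_(h < M) (M%:R + 2 * \sum_(k < M) geom_bound M (3 * A * (h.+1%:R * k.+1%:R))).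
  apply: ler_sum => h _; rewrite /x /P.
  rewrite (eq_bigr (fun n : 'I_(M - h.+1) => cis ((3 * A * h.+1%:R) * n%:R ^+ 2 +
     (3 * A * h.+1%:R ^+ 2 + 2 * B * h.+1%:R) * n%:R +
     (A * h.+1%:R ^+ 3 + B * h.+1%:R ^+ 2 + C * h.+1%:R)))); last first.
    by move=> n _; rewrite -cisN -!cisD natrD; congr cis; ring.
  apply: (le_trans (normc_quadratic_sum _ _ _ (leq_subr _ _))).
  by under eq_bigr do rewrite -mulrA.
rewrite big_split /= sumr_const card_ord -mulr_sumr -[M%:R *+ M]mulr_natl in h4.
have h5 : M%:R * \sum_(h < M) x h ^+ 2 <= M%:R * (M%:R * M%:R + 2 *
    \sum_(h < M) \sum_(k < M) geom_bound M (3 * A * (h.+1%:R * k.+1%:R))).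
  by rewrite ler_wpM2l.
by rewrite !exprS expr0 in h3 h5 *; lra.
Qed.

End WeylDifferencing.

(** * Sums of geometric bounds over multiples of a well approximated number *)

Section WeylMinSum.
Context {R : realType}.

Definition frac (x : R) : R := x - (Num.floor x)%:~R.

Lemma frac_itv (x : R) : 0 <= frac x < 1.
Proof.
rewrite /frac; have := floor_le x; have := floorD1_gt x; rewrite intrD.
by move=> h1 h2; apply/andP; split; lra.
Qed.

Lemma sin_pi_frac (x : R) : `|sin (pi * x)| = sin (pi * frac x).
Proof.
have /andP[f0 f1] := frac_itv x; have p0 := @pi_gt0 R.
rewrite -[RHS]ger0_norm; last first.
  apply: sin_ge0_pi; apply/andP; split; first by rewrite mulr_ge0 // ltW.
  by rewrite -[leRHS]mulr1; apply: ler_wpM2l; exact: ltW.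
have h (k : int) (y : R) : `|sin (y + pi * k%:~R)| = `|sin y|.
  have step z : `|sin (z + pi)| = `|sin z| :> R by rewrite sinDpi normrN.
  case: k => n.
    elim: n => [|n ih]; first by rewrite mulr0 addr0.
    by rewrite -pmulrn -natr1 mulrDr mulr1 addrA step pmulrn.
  rewrite NegzE; elim: n => [|n ih].
    by rewrite mulrN1z mulrN1 -step subrK.
  rewrite -ih -step; congr `|sin _|; rewrite !mulrNz -!pmulrn -[n.+2%:R]natr1; ring.
by rewrite -[in LHS](subrK (Num.floor x)%:~R x) mulrDr h.
Qed.

Lemma sin_pi_ge (x : R) : 0 <= x <= 2^-1 -> x <= sin (pi * x).
Proof.
move=> /andP[x0 x2]; have p2 := @pi_ge2 R.
have h : pi * x <= pi * 2^-1 by rewrite ler_pM2l ?pi_gt0.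
have h2 : 0 <= pi * x by rewrite mulr_ge0 // pi_ge0.
have /half_le_sin : 0 <= pi * x <= pi / 2 by rewrite h2.
have : 2 * x <= pi * x by rewrite ler_wpM2r.
lra.
Qed.

Definition bin (q : nat) (x : R) : nat := `|Num.floor (2 * q%:R * frac x)|%N.

Lemma binP q x : (0 < q)%N ->
  (bin q x)%:R <= 2 * q%:R * frac x /\ 2 * q%:R * frac x < (bin q x)%:R + 1.
Proof.
move=> q0; have /andP[f0 f1] := frac_itv x.
have h0 : 0 <= 2 * q%:R * frac x by rewrite !mulr_ge0.
have f : 0 <= Num.floor (2 * q%:R * frac x) by rewrite floor_ge0.
have -> : (bin q x)%:R = (Num.floor (2 * q%:R * frac x))%:~R :> R.
  by rewrite /bin natr_absz ger0_norm.
by split; [exact: floor_le|have := floorD1_gt (2 * q%:R * frac x); rewrite intrD].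
Qed.

Lemma bin_lt q x : (0 < q)%N -> (bin q x < 2 * q)%N.
Proof.
move=> q0; have /andP[f0 f1] := frac_itv x; have [h _] := binP x q0.
rewrite -(ltr_nat R) (le_lt_trans h) // natrM -[ltRHS]mulr1 ltr_pM2l //.
by rewrite mulr_gt0 // ltr0n.
Qed.

(* Multiples [m beta] in a range of length at most [q / 2] are [1 / (2 q)]-separated modulo 1. *)
Lemma bin_inj (beta : R) (a : int) (q : nat) (m m' : nat) :
  (0 < q)%N -> coprimez a q%:Z -> `|beta - a%:~R / q%:R| <= (q%:R ^+ 2)^-1 ->
  (2 * `|m%:Z - m'%:Z|%N < q)%N ->
  bin q (beta * m%:R) = bin q (beta * m'%:R) -> m = m'.
Proof.
move=> q0 aq hb hm hbin.
have [h1 h2] := binP (beta * m%:R) q0; have [h3 h4] := binP (beta * m'%:R) q0.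
rewrite -hbin in h3 h4; rewrite /frac in h1 h2 h3 h4.
set f := Num.floor _ in h1 h2; set f' := Num.floor _ in h3 h4.
have q0' : 0 < q%:R :> R by rewrite ltr0n.
pose d : int := m%:Z - m'%:Z.
have dE : d%:~R = m%:R - m'%:R :> R by rewrite /d intrB -!pmulrn.
pose Z : int := f - f'.
have ZE : Z%:~R = f%:~R - f'%:~R :> R by rewrite /Z intrB.
have e1 : `|2 * q%:R * (beta * d%:~R - Z%:~R)| < 1.
  by rewrite dE ZE ltr_norml; apply/andP; split; lra.
have dq : `|d%:~R : R| * 2 < q%:R.
  rewrite -intr_norm mulrC (_ : 2 * _ = (2 * `|d|%N)%:R); last by rewrite natrM natr_absz.
  by rewrite ltr_nat.
have e2 : `|2 * q%:R * (beta * d%:~R) - 2 * (a * d)%:~R| < 1.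
  have -> : 2 * q%:R * (beta * d%:~R) - 2 * (a * d)%:~R =
      (beta - a%:~R / q%:R) * (2 * q%:R * d%:~R).
    by rewrite intrM; field; rewrite gt_eqF.
  rewrite !normrM (ger0_norm (ler0n _ 2)) (gtr0_norm q0').
  apply: (@le_lt_trans _ _ ((q%:R ^+ 2)^-1 * (2 * q%:R * `|d%:~R|))).
    by rewrite ler_wpM2r // !mulr_ge0 // ltW.
  have -> : (q%:R ^+ 2)^-1 * (2 * q%:R * `|d%:~R|) = (`|d%:~R| * 2) / q%:R :> R.
    by field; rewrite gt_eqF.
  by rewrite ltr_pdivrMr // mul1r.
(* This integer has absolute value below 1, so it is 0; then [q] divides [a * d], hence [d], which
   is too short unless it vanishes. *)
have e3 : `|(q%:Z * Z - a * d)%:~R : R| < 1.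
  rewrite intrB intrM -pmulrn.
  move: e1 e2; rewrite !ltr_norml => /andP[? ?] /andP[? ?].
  by apply/andP; split; lra.
have E : q%:Z * Z = a * d.
  apply/eqP; rewrite -subr_eq0 -absz_eq0 -leqn0 -ltnS -(ltr_nat R) natr_absz.
  by rewrite -intr_norm in e3.
have qd : (q%:Z %| d)%Z.
  have qa : coprimez q%:Z a by rewrite coprimez_sym.
  have G := Gauss_dvdzr d qa; rewrite -G.
  by apply/dvdzP; exists Z; rewrite -E mulrC.
have d0 : `|d|%N = 0%N.
  apply/eqP; apply: contraTT hm => d0; rewrite -leqNgt.
  apply: (@leq_trans `|d|%N); last by rewrite -/d leq_pmull.
  by apply: dvdn_leq; rewrite ?lt0n.
by move/eqP: d0; rewrite absz_eq0 subr_eq0 => /eqP [].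
Qed.

Lemma sum_injective_le (m n : nat) (f : 'I_m -> 'I_n) (G : 'I_n -> R) :
  injective f -> (forall j, 0 <= G j) -> \sum_(i < m) G (f i) <= \sum_(j < n) G j.
Proof.
move=> fi G0; rewrite -(big_map f xpredT G) big_uniq.
  by rewrite [leRHS](bigID (mem (map f (index_enum 'I_m)))) /= lerDl sumr_ge0.
by rewrite map_inj_uniq // index_enum_uniq.
Qed.

Definition bin_bound (M q j : nat) : R := 2 * M%:R / (1 + M%:R * (j%:R / (2 * q%:R))).

Lemma bin_bound_ge0 M q j : 0 <= bin_bound M q j.
Proof. by rewrite divr_ge0 ?mulr_ge0 ?addr_ge0 ?mulr_ge0 ?divr_ge0 ?mulr_ge0. Qed.

Lemma geom_bound_le_bin (M q j : nat) (x : R) : j%:R / (2 * q%:R) <= `|sin x| ->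
  geom_bound M x <= bin_bound M q j.
Proof.
move=> h; rewrite /geom_bound /bin_bound ler_wpM2l ?mulr_ge0 //.
rewrite lef_pV2 ?posrE ?ltr_pwDl ?mulr_ge0 ?divr_ge0 ?mulr_ge0 //.
by rewrite lerD2l ler_wpM2l.
Qed.

(** The distance from [x] to the nearest integer is estimated by the lower end of its bin, or by the
    gap between the upper end and 1; the second is the same bound for the reflected bin. *)
Lemma geom_bound_bin (M q : nat) (x : R) : (0 < q)%N ->
  geom_bound M (pi * x) <= bin_bound M q (bin q x) + bin_bound M q (2 * q - (bin q x).+1).
Proof.
move=> q0; have [h1 h2] := binP x q0; have /andP[f0 f1] := frac_itv x.
have q0' : 0 < 2 * q%:R :> R by rewrite mulr_gt0 // ltr0n.
have b1 := bin_bound_ge0 M q (bin q x).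
have b2 := bin_bound_ge0 M q (2 * q - (bin q x).+1).
have [x2|x2] := leP (frac x) 2^-1.
  apply: (@le_trans _ _ (bin_bound M q (bin q x))); last by lra.
  apply: geom_bound_le_bin; rewrite sin_pi_frac.
  apply: le_trans (sin_pi_ge _); last by rewrite f0.
  by rewrite ler_pdivrMr // mulrC.
apply: (@le_trans _ _ (bin_bound M q (2 * q - (bin q x).+1))); last by lra.
apply: geom_bound_le_bin; rewrite sin_pi_frac.
have -> : sin (pi * frac x) = sin (pi * (1 - frac x)).
  have -> : pi * (1 - frac x) = pi - pi * frac x by ring.
  by rewrite sinB sinpi cospi; ring.
apply: le_trans (sin_pi_ge _); last by apply/andP; split; lra.
rewrite ler_pdivrMr // natrB ?bin_lt // natrM -natr1; lra.
Qed.

Definition harmonic_sum (n : nat) : R := \sum_(j < n) (j.+1%:R)^-1.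

Lemma harmonic_le_ln n : (0 < n)%N -> harmonic_sum n <= 1 + ln n%:R.
Proof.
rewrite /harmonic_sum; case: n => [//|n _]; elim: n => [|n ih].
  by rewrite big_ord_recr big_ord0 /= add0r invr1 ln1 addr0.
rewrite big_ord_recr /=.
have n1 : 0 < n.+1%:R :> R by rewrite ltr0n.
have n2 : 0 < n.+2%:R :> R by rewrite ltr0n.
have : ln (n.+1%:R / n.+2%:R) <= - (n.+2%:R)^-1 :> R.
  have -> : n.+1%:R / n.+2%:R = 1 + - (n.+2%:R)^-1 :> R.
    have -> : n.+1%:R = n.+2%:R - 1 :> R by rewrite -[n.+2%:R]natr1 addrK.
    by field; rewrite gt_eqF.
  apply: le_ln1Dx; rewrite ltrN2 invf_lt1 // ltr1n //.
by rewrite ln_div ?posrE //; move: (n.+2%:R^-1) => u; lra.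
Qed.

(** The bin at 0 costs [2 * M] and bin [j > 0] at most [4 q / j], whence the harmonic sum. *)
Lemma sum_bin_bound (M q : nat) : (0 < q)%N ->
  \sum_(j < 2 * q) bin_bound M q j <= 2 * M%:R + 4 * q%:R * harmonic_sum (2 * q).
Proof.
move=> q0; have q0' : 0 < q%:R :> R by rewrite ltr0n.
have : (0 < 2 * q)%N by rewrite muln_gt0.
case E : (2 * q)%N => [//|p] _.
rewrite big_ord_recl /= {1}/bin_bound mul0r mulr0 addr0 divr1 lerD2l.
rewrite /harmonic_sum mulr_sumr big_ord_recr /=.
apply: (@le_trans _ _ (\sum_(j < p) 4 * q%:R * (j.+1%:R)^-1)); last first.
  by rewrite lerDl !mulr_ge0.
apply: ler_sum => j _; rewrite /bin_bound /bump /= add1n.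
have j0 : 0 < j.+1%:R :> R by rewrite ltr0n.
have d0 : 0 <= M%:R * (j.+1%:R / (2 * q%:R)) :> R by rewrite !mulr_ge0 // ?invr_ge0 ?mulr_ge0.
rewrite ler_pdivrMr ?ltr_pwDl //.
rewrite mulrDr mulr1 (_ : 4 * q%:R / j.+1%:R * (M%:R * (j.+1%:R / (2 * q%:R))) = 2 * M%:R).
  by rewrite lerDr divr_ge0 ?mulr_ge0.
by field; rewrite !gt_eqF.
Qed.

(** By [bin_inj] at most [q / 2] consecutive multiples occupy distinct bins, so their sum is
    dominated by the sum over all bins, taken twice because of the reflection. *)
Lemma sum_geom_block (M q L m0 : nat) (beta : R) (a : int) :
  (0 < q)%N -> coprimez a q%:Z -> `|beta - a%:~R / q%:R| <= (q%:R ^+ 2)^-1 ->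
  (2 * L <= q)%N ->
  \sum_(i < L) geom_bound M (pi * (beta * (m0 + i)%:R)) <=
  4 * M%:R + 8 * q%:R * harmonic_sum (2 * q).
Proof.
move=> q0 aq hb Lq.
pose f (i : 'I_L) := Ordinal (bin_lt (beta * (m0 + i)%:R) q0).
pose G (j : 'I_(2 * q)) := bin_bound M q j + bin_bound M q (2 * q - j.+1).
apply: (@le_trans _ _ (\sum_(i < L) G (f i))).
  by apply: ler_sum => i _; exact: geom_bound_bin.
apply: (@le_trans _ _ (\sum_(j < 2 * q) G j)).
  apply: sum_injective_le => [i i' /(congr1 val) /= h|j]; last first.
    by rewrite addr_ge0 // bin_bound_ge0.
  apply/val_inj/(@addnI m0); apply: (bin_inj q0 aq hb) h.
  apply: leq_trans Lq; rewrite ltn_mul2l /=.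
  have -> : (m0 + i)%:Z - (m0 + i')%:Z = i%:Z - i'%:Z by rewrite !PoszD; ring.
  have := ltn_ord i; have := ltn_ord i'.
  case: (leqP i i') => h h1 h2.
    by rewrite distnC distnEl // (leq_ltn_trans (leq_subr _ _)).
  by rewrite distnEl ?(ltnW h) // (leq_ltn_trans (leq_subr _ _)).
rewrite /G big_split /=.
have -> : \sum_(j < 2 * q) bin_bound M q (2 * q - j.+1) = \sum_(j < 2 * q) bin_bound M q j.
  by rewrite [RHS](reindex_inj rev_ord_inj).
have := sum_bin_bound M q0; lra.
Qed.

Lemma sum_geom (M q T : nat) (beta : R) (a : int) :
  (1 < q)%N -> coprimez a q%:Z -> `|beta - a%:~R / q%:R| <= (q%:R ^+ 2)^-1 ->
  \sum_(m < T) geom_bound M (pi * (beta * m%:R)) <=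
  (3 * T%:R / q%:R + 1) * (4 * M%:R + 8 * q%:R * harmonic_sum (2 * q)).
Proof.
move=> q1 aq hb; have q0 : (0 < q)%N by exact: ltnW.
have q0' : 0 < q%:R :> R by rewrite ltr0n.
pose L := (q %/ 2)%N; have L0 : (0 < L)%N by rewrite divn_gt0.
(* Blocks have length [q / 2] rounded down; [q <= 3 L] uses [q >= 2] and is the origin of the factor
   3. *)
have qL : (q <= 3 * L)%N.
  have := divn_eq q 2; have := ltn_pmod q (isT : (0 < 2)%N); rewrite -/L.
  by move: L0; move: (q %% 2)%N => r; lia.
pose K := (T %/ L).+1.
pose F m : R := geom_bound M (pi * (beta * m%:R)).
have F0 m : 0 <= F m by exact: geom_bound_ge0.
have TK : (T <= K * L)%N by rewrite ltnW // ltn_ceil.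
apply: (@le_trans _ _ (\sum_(0 <= m < K * L) F m)).
  by rewrite (big_cat_nat (leq0n T) TK) /= big_mkord lerDl sumr_ge0.
rewrite (sum_blocks (a := fun j => j * L)%N) => [|j]; last by rewrite mulSn leq_addl.
rewrite mul0n big_geq // add0r.
set B := 4 * M%:R + _.
have B0 : 0 <= B.
  rewrite addr_ge0 ?mulr_ge0 // sumr_ge0 // => j _; by rewrite invr_ge0.
apply: (@le_trans _ _ (\sum_(j < K) B)).
  apply: ler_sum => j _; rewrite sum_nat_shift mulSn addnK.
  apply: (sum_geom_block _ _ q0 aq hb).
  by rewrite mulnC leq_trunc_div.
rewrite sumr_const card_ord -[_ *+ K]mulr_natl ler_wpM2r //.
rewrite /K -natr1 lerD2r ler_pdivlMr //.
have h1 : (T %/ L * q <= 3 * T)%N.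
  apply: (@leq_trans (T %/ L * (3 * L))); first by rewrite leq_mul2l qL orbT.
  by rewrite mulnCA leq_mul2l leq_trunc_div.
by move: h1; rewrite -(ler_nat R) !natrM.
Qed.

End WeylMinSum.

(** * Weyl's inequality for cubic sums with a Khinchin-Levy leading coefficient *)

Section WeylBound.
Context {R : realType}.

(** A positive [m] is of the form [6 h k] for at most as many pairs as it has divisors, since [h]
    divides [m] and determines [k]. *)
Lemma sum_products_le (F : nat -> R) (M : nat) (Dd : R) :
  0 <= Dd -> (forall m, 0 <= F m) ->
  (forall m, (0 < m <= 6 * M ^ 2)%N -> (size (divisors m))%:R <= Dd) ->
  \sum_(h < M) \sum_(k < M) F (6 * (h.+1 * k.+1))%N
  <= Dd * \sum_(m < (6 * M ^ 2).+1) F m.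
Proof.
move=> D0 F0 hd; set T := (6 * M ^ 2).+1.
pose P (h m : nat) := (h.+1 %| m)%N && (0 < m)%N.
apply: (@le_trans _ _ (\sum_(h < M) \sum_(m < T | P h m) F m)).
  apply: ler_sum => h _; rewrite [leRHS]big_mkcond /=.
  have kT (k : 'I_M) : (6 * (h.+1 * k.+1) < T)%N.
    by rewrite ltnS leq_mul2l /= expnS expn1 leq_mul.
  pose f k := Ordinal (kT k).
  pose G (m : 'I_T) := if P h m then F m else 0.
  have finj : injective f.
    move=> k k' /(congr1 val) /eqP /=.
    by rewrite !eqn_mul2l /= eqSS => /eqP/val_inj.
  have G0 j : 0 <= G j by rewrite /G; case: ifP.
  apply: le_trans (sum_injective_le finj G0).
  apply: ler_sum => k _; rewrite /G /P /= dvdn_mull ?dvdn_mulr //.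
rewrite (exchange_big_dep xpredT) //= mulr_sumr; apply: ler_sum => m _.
rewrite sumr_const -[F m *+ _]mulr_natl ler_wpM2r //.
have [m0|m0] := posnP m.
  by rewrite (eq_card0 (A := _)) // => h; rewrite unfold_in /P m0 andbF.
apply: le_trans (hd m _); last by rewrite m0 -ltnS ltn_ord.
rewrite ler_nat cardE -(size_map (fun h : 'I_M => h.+1)).
apply: uniq_leq_size.
  by rewrite map_inj_uniq ?enum_uniq // => h h' [] /val_inj.
move=> d /mapP[h]; rewrite mem_enum unfold_in /P => /andP[hm _] ->.
by rewrite -dvdn_divisors.
Qed.

Lemma geom_boundN (M : nat) (x : R) : geom_bound M (- x) = geom_bound M x.
Proof. by rewrite /geom_bound sinN normrN. Qed.

(** The multiples [6 h k] reach up to [6 M^2]; because [M <= q] they fall into O([M]) blocks of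
    length about [q / 2], which is the factor [22 * M] below, and [352 = 16 * 22]. *)
Lemma cubic_sum_denominator (beta b c d : R) (a : int) (q M : nat) (Dd : R) :
  (1 < q)%N -> (M <= q)%N -> (0 < M)%N -> coprimez a q%:Z ->
  `|beta - a%:~R / q%:R| <= (q%:R ^+ 2)^-1 -> 0 <= Dd ->
  (forall m, (0 < m <= 6 * M ^ 2)%N -> (size (divisors m))%:R <= Dd) ->
  normc (\sum_(n < M) cis (- (2 * pi * beta) * n%:R ^+ 3 + b * n%:R ^+ 2 + c * n%:R + d)) ^+ 4
  <= 10 * M%:R ^+ 3 + 352 * M%:R ^+ 2 * Dd * (4 * M%:R + 8 * q%:R * harmonic_sum (2 * q)).
Proof.
move=> q1 Mq M0 aq hb D0 hd.
apply: (le_trans (normc_cubic_sum _ _ _ _ _)).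
have M1 : 1 <= M%:R :> R by rewrite ler1n.
have q0 : 0 < q%:R :> R by rewrite ltr0n ltnW.
have Mq' : M%:R <= q%:R :> R by rewrite ler_nat.
set W := 4 * M%:R + _.
have W0 : 0 <= W.
  rewrite addr_ge0 ?mulr_ge0 // sumr_ge0 // => j _; by rewrite invr_ge0.
have -> : \sum_(h < M) \sum_(k < M) geom_bound M (3 * - (2 * pi * beta) * (h.+1%:R * k.+1%:R)) =
   \sum_(h < M) \sum_(k < M) geom_bound M (pi * (beta * (6 * (h.+1 * k.+1))%:R)).
  apply: eq_bigr => h _; apply: eq_bigr => k _; rewrite -[RHS]geom_boundN; congr geom_bound.
  by rewrite !natrM; ring.
have h1 := @sum_products_le (fun m => geom_bound M (pi * (beta * m%:R))) M Dd D0
  (fun m => geom_bound_ge0 _ _) hd.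
have h2 := @sum_geom R M q (6 * M ^ 2).+1 beta a q1 aq hb.
set S := \sum_(h < M) _ in h1 *.
have h3 : 3 * (6 * M ^ 2).+1%:R / q%:R + 1 <= 22 * M%:R :> R.
  have : 3 * (6 * M ^ 2).+1%:R / q%:R <= 21 * M%:R :> R.
    rewrite ler_pdivrMr // -[(6 * M ^ 2).+1%:R]natr1 natrM natrX.
    apply: (@le_trans _ _ (21 * M%:R * M%:R)); last by rewrite ler_wpM2l ?mulr_ge0.
    have : 1 <= M%:R ^+ 2 :> R by rewrite exprn_ege1.
    by rewrite expr2; lra.
  lra.
have h4 : S <= Dd * (22 * M%:R * W).
  apply: (le_trans h1); rewrite ler_wpM2l //; apply: (le_trans h2).
  by rewrite ler_wpM2r.
have h5 : M%:R * S <= M%:R * (Dd * (22 * M%:R * W)) by rewrite ler_wpM2l.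
have h6 : M%:R ^+ 2 <= M%:R ^+ 3 :> R by rewrite ler_weXn2l.
rewrite -[16 * _ * _]mulrA.
have -> : 352 * M%:R ^+ 2 * Dd * W = 16 * (M%:R * (Dd * (22 * M%:R * W))) by ring.
lra.
Qed.

(** For large [M] the first denominator reaching [M] is at most [M^(1 + eta)], because its
    predecessor is below [M]. With [y = M^eta], the divisor function, the harmonic sum and the ratio
    of denominator to length each cost one factor [y], so the fourth power of the sum is
    O([M^3 y^3]). *)
Lemma weyl_khinchin_levy (beta eta : R) : khinchin_levy beta -> 0 < eta -> eta <= 1 ->
  exists2 D : R, 0 <= D & forall (b c d : R) (M : nat),
  normc (\sum_(n < M) cis (- (2 * pi * beta) * n%:R ^+ 3 + b * n%:R ^+ 2 + c * n%:R + d))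
  <= D * M%:R `^ (3 / 4 + eta).
Proof.
move=> [_ [q [q0 qm hq ha]]] e0 e1.
have [N hN] := hq eta e0.
have qinc : {homo q : i j / (i < j)%N} by apply: homo_ltn => //; exact: ltn_trans.
have qge n : (n <= q n)%N by elim: n => // n ih; apply: leq_ltn_trans ih (qm n).
(* This gives [eta * k >= 2]: the [k]-th root of O([M^2]), which bounds the number of divisors, is
   then O([M^eta]). *)
pose k := (nceil (2 / eta)).+1.
have [C C0 hC] := divisor_bound (ltn0Sn (nceil (2 / eta))).
rewrite -/k in hC.
have ek : 2 <= eta * k%:R.
  have d0 : 0 <= 2 / eta by rewrite divr_ge0 // ltW.
  have [h _] := nceilP d0.
  rewrite mulrC -ler_pdivrMr //; apply: (le_trans h); by rewrite ler_nat.
pose M0 := (q N.+1).+1.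
have [E EE] : exists E : R, E = 10 + 352 * (6 * C%:R) * (4 + 8 * (2 + 2 / eta)) by eexists.
have C1 : 1 <= C%:R :> R by rewrite ler1n.
have ie : 0 < 2 / eta by rewrite divr_gt0.
have E1 : 1 <= E.
  have : 0 <= 352 * (6 * C%:R) * (4 + 8 * (2 + 2 / eta)).
    by apply: mulr_ge0; lra.
  by rewrite EE; lra.
have E0 : 0 <= E by lra.
exists (M0%:R + E); first by rewrite addr_ge0.
move=> b c d M; set S := normc _.
have SM : S <= M%:R.
  have := @normc_sum_cis_le R (fun n => - (2 * pi * beta) * n%:R ^+ 3 + b * n%:R ^+ 2 + c * n%:R + d) 0 M.
  by rewrite big_mkord subn0.
have [Mz|Mp] := posnP M.
  by apply: (le_trans SM); rewrite Mz mulr_ge0 ?powR_ge0 ?addr_ge0.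
have M1 : 1 <= M%:R :> R by rewrite ler1n.
have Mp0 : 0 < M%:R :> R by lra.
have Y1 : 1 <= M%:R `^ (3 / 4 + eta) :> R.
  by rewrite -[leLHS](powRr0 M%:R) ler_powR //; lra.
have [MM0|MM0] := leqP M M0.
  apply: (le_trans SM); apply: (@le_trans _ _ (M0%:R * M%:R `^ (3 / 4 + eta))).
    by apply: (@le_trans _ _ M0%:R); rewrite ?ler_nat // ler_peMr.
  by rewrite ler_wpM2r ?powR_ge0 // lerDl.
have exn : exists n, (M <= q n)%N by exists M.
case: (ex_minnP exn) => n Mqn nmin.
have Nn : (N.+1 < n)%N.
  rewrite ltnNge; apply/negP => nN; move: MM0; rewrite ltnNge => /negP; apply.
  apply: (leq_trans Mqn); apply: leqW; move: nN; rewrite leq_eqVlt.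
  by case/predU1P => [->//|/qinc/ltnW].
case: n Mqn nmin Nn => [//|n] Mqn nmin Nn.
have qnM : (q n < M)%N.
  by rewrite ltnNge; apply/negP => /nmin; rewrite ltnn.
pose y : R := M%:R `^ eta.
have y1 : 1 <= y by rewrite -[leLHS](powRr0 M%:R) ler_powR //; lra.
have y0 : 0 < y by lra.
have qy : (q n.+1)%:R <= M%:R * y.
  apply: (le_trans (hN n _)); first by rewrite -ltnS.
  have -> : M%:R * y = M%:R `^ (1 + eta).
    by rewrite powRD ?(gt_eqF Mp0) ?implybT // powRr1 // ltW.
  by rewrite ge0_ler_powR ?nnegrE ?ler_nat ?(ltnW qnM) //; lra.
have lnMy : ln M%:R <= y / eta.
  rewrite ler_pdivlMr // mulrC -ln_powR -/y.
  have := ln_sublinear y0; lra.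
have yk : M%:R ^+ 2 <= y ^+ k.
  rewrite /y -[_ ^+ k]powR_mulrn ?powR_ge0 // -powRrM -powR_mulrn; last exact: ltW.
  by rewrite ler_powR.
have hd m : (0 < m <= 6 * M ^ 2)%N -> (size (divisors m))%:R <= 6 * C%:R * y.
  move=> /andP[m0 mM].
  rewrite -(@ler_pXn2r _ k) ?nnegrE ?mulr_ge0 ?(ltW y0) //.
  apply: (@le_trans _ _ (C * (6 * M ^ 2))%:R).
    by rewrite -natrX ler_nat (leq_trans (hC m m0)) // leq_mul2l mM orbT.
  rewrite exprMn; apply: (@le_trans _ _ (6 * C%:R * M%:R ^+ 2)).
    by rewrite natrM natrM natrX; lra.
  apply: ler_pM; rewrite ?mulr_ge0 ?sqr_ge0 //.
  by rewrite ler_eXnr //; lra.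
have [a [aq hb]] := ha n.+1.
have q1 : (1 < q n.+1)%N by apply: leq_trans (qge n.+1); rewrite ltnS; case: (n) Nn.
have D0 : 0 <= 6 * C%:R * y by rewrite mulr_ge0 ?mulr_ge0 // ltW.
have := cubic_sum_denominator b c d q1 Mqn Mp aq hb D0 hd.
rewrite -/S => hS.
have q0' : 0 < (q n.+1)%:R :> R by rewrite ltr0n.
have hH : harmonic_sum (2 * q n.+1) <= (2 + 2 / eta) * y.
  apply: (le_trans (harmonic_le_ln _)); first by rewrite muln_gt0 q0.
  have qM2 : (2 * q n.+1)%:R <= 2 * (M%:R * y) by rewrite natrM ler_wpM2l.
  have : ln (2 * q n.+1)%:R <= ln (2 * (M%:R * y)) :> R.
    by rewrite ler_ln ?posrE ?natrM ?mulr_gt0 // -natrM.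
  rewrite !lnM ?posrE ?mulr_gt0 //.
  have l2 : ln 2 <= 1 :> R.
    by have := @le_ln1Dx R 1; apply; lra.
  have ly : ln y <= y by have := ln_sublinear y0; lra.
  have yy : y <= y / eta by rewrite ler_pdivlMr // ler_piMr // ltW.
  have -> : (2 + 2 / eta) * y = 2 * y + 2 * (y / eta) by ring.
  move: (y / eta) lnMy yy => w ? ?; lra.
have E3 : 352 * (6 * C%:R) * (4 + 8 * (2 + 2 / eta)) = E - 10 by rewrite EE; ring.
have c2 : 0 <= 2 + 2 / eta by lra.
have qH : (q n.+1)%:R * harmonic_sum (2 * q n.+1) <= M%:R * y * ((2 + 2 / eta) * y).
  apply: ler_pM => //; first by apply: sumr_ge0 => j _; rewrite invr_ge0.
have y2 : 1 <= y ^+ 2 by rewrite exprn_ege1.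
have hW : 4 * M%:R + 8 * (q n.+1)%:R * harmonic_sum (2 * q n.+1) <=
    (4 + 8 * (2 + 2 / eta)) * (M%:R * y ^+ 2).
  have h : M%:R <= M%:R * y ^+ 2 by rewrite ler_peMr // ltW.
  apply: (@le_trans _ _ (4 * (M%:R * y ^+ 2) + 8 * (M%:R * y * ((2 + 2 / eta) * y)))).
    by rewrite -[8 * _ * _]mulrA; lra.
  by rewrite le_eqVlt; apply/orP; left; apply/eqP; ring.
have S4 : S ^+ 4 <= E * (M%:R ^+ 3 * y ^+ 3).
  apply: (le_trans hS).
  apply: (@le_trans _ _ (10 * (M%:R ^+ 3 * y ^+ 3) + 352 * M%:R ^+ 2 * (6 * C%:R * y) *
      ((4 + 8 * (2 + 2 / eta)) * (M%:R * y ^+ 2)))).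
    apply: lerD.
      by rewrite ler_wpM2l // ler_peMr ?exprn_ge0 ?exprn_ege1 // ltW.
    apply: ler_wpM2l; last exact: hW.
    by apply: mulr_ge0; [apply: mulr_ge0; [lra|exact: sqr_ge0]|exact: D0].
  rewrite (_ : E = 10 + (E - 10)); last by ring.
  by rewrite -E3 le_eqVlt; apply/orP; left; apply/eqP; ring.
have Y4 : (M%:R `^ (3 / 4 + eta)) ^+ 4 = M%:R ^+ 3 * y ^+ 4 :> R.
  rewrite -[LHS]powR_mulrn ?powR_ge0 // -powRrM -!powR_mulrn ?powR_ge0 ?(ltW Mp0) //.
  rewrite /y -powRrM -powRD; last by rewrite (gt_eqF Mp0) implybT.
  by congr (_ `^ _); field.
have SE : S <= E * M%:R `^ (3 / 4 + eta).
  rewrite -(@ler_pXn2r _ 4) ?nnegrE ?mulr_ge0 ?powR_ge0 ?normc_ge0 //.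
  rewrite exprMn Y4; apply: (le_trans S4).
  have M3 : 0 <= M%:R ^+ 3 :> R by rewrite exprn_ge0 // ltW.
  have y3 : 0 <= y ^+ 3 by rewrite exprn_ge0 // ltW.
  apply: ler_pM => //; first exact: mulr_ge0.
    by rewrite ler_eXnr.
  by rewrite ler_wpM2l // ler_weXn2l.
by apply: (le_trans SE); rewrite ler_wpM2r ?powR_ge0 // lerDr.
Qed.

End WeylBound.

(** * Exponential sums with the gravity-capillary dispersion relation *)

Section DispersionSums.
Context {R : realType}.
Implicit Types (t x alpha eta : R).

Lemma tanh_itv x : 1 <= x -> x ^+ 3 * (1 - tanh x) <= x /\ 0 <= tanh x <= 1.
Proof.
move=> x1; rewrite /tanh; set e := expR x; set f := expR (- x).
have e0 : 0 < e by exact: expR_gt0.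
have f0 : 0 < f by exact: expR_gt0.
have ef : e * f = 1 by exact: expRxMexpNx_1.
have fe : f <= e by rewrite ler_expR; lra.
have x0 : 0 < x by lra.
have ee : 1 + 2 * x ^+ 2 <= e * e.
  rewrite -expRD; have xx0 : 0 <= x + x by lra.
  have := expR_ge1Dxn 1 xx0.
  have -> : (x + x) ^+ 2 / (2`!)%:R = 2 * x ^+ 2 by rewrite (_ : 2`!%N = 2%N) //; field.
  by [].
have ef0 : 0 < e + f by lra.
split; last first.
  by rewrite divr_ge0 ?subr_ge0 ?(ltW ef0) //= ler_pdivrMr // mul1r; lra.
have -> : 1 - (e - f) / (e + f) = 2 * f / (e + f) by field; rewrite gt_eqF.
rewrite mulrA ler_pdivrMr //.
apply: (@le_trans _ _ (x * e)); last by rewrite ler_wpM2l; lra.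
have h : x * f * (2 * x ^+ 2) <= x * f * (e * e).
  by rewrite ler_wpM2l ?mulr_ge0 ?(ltW x0) ?(ltW f0) //; lra.
have e1 : x * f * (e * e) = x * e * (e * f) by ring.
rewrite e1 ef mulr1 in h.
by rewrite (_ : x ^+ 3 * (2 * f) = x * f * (2 * x ^+ 2)) //; ring.
Qed.

(** The square of [omega n] differs from [n^3] by at most [n]; dividing by the sum of the two roots,
    which is at least [n^(3/2)], gives the claim. *)
Lemma omega_gc_approx (n : nat) : (0 < n)%N ->
  `|omega_gc R n%:Z - n%:R * Num.sqrt n%:R| <= (Num.sqrt n%:R)^-1.
Proof.
move=> n0; rewrite /omega_gc /= -pmulrn; set x : R := n%:R.
have x1 : 1 <= x by rewrite /x ler1n.
have x0 : 0 < x by lra.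
have [h1 /andP[h2 h3]] := tanh_itv x1.
set A := (x + x ^+ 3) * tanh x.
have x30 : 0 < x ^+ 3 by rewrite exprn_gt0.
have A0 : 0 <= A by rewrite mulr_ge0 //; lra.
have hA : `|A - x ^+ 3| <= x.
  have a1 : A <= x + x ^+ 3 by rewrite -[leRHS]mulr1 ler_wpM2l //; lra.
  have a2 : 0 <= x * tanh x by rewrite mulr_ge0 // ltW.
  have a3 : A = x * tanh x + x ^+ 3 * tanh x by rewrite /A mulrDl.
  by rewrite ler_norml; apply/andP; split; lra.
have s0 : 0 < Num.sqrt x by rewrite sqrtr_gt0.
have sx : Num.sqrt x ^+ 2 = x by rewrite sqr_sqrtr // ltW.
have sA : Num.sqrt A ^+ 2 = A by rewrite sqr_sqrtr.
have sA0 : 0 <= Num.sqrt A by exact: sqrtr_ge0.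
have p0 : 0 < x * Num.sqrt x by rewrite mulr_gt0.
have E : A - x ^+ 3 = (Num.sqrt A - x * Num.sqrt x) * (Num.sqrt A + x * Num.sqrt x).
  by rewrite -subr_sqr sA exprMn sx; ring.
rewrite E normrM (ger0_norm (_ : 0 <= Num.sqrt A + x * Num.sqrt x)) in hA; last by lra.
have h : `|Num.sqrt A - x * Num.sqrt x| * (x * Num.sqrt x) <= x.
  by apply: le_trans hA; rewrite ler_wpM2l // lerDr.
rewrite -[leLHS]mulr1 -[leRHS]mul1r ler_pdivlMr // mulr1.
rewrite -(@ler_pM2l _ x) // mulr1; apply: le_trans h.
by rewrite le_eqVlt; apply/orP; left; apply/eqP; ring.
Qed.

Lemma sum_inv_sqrt (N : nat) :
  \sum_(1 <= n < N.+1) (Num.sqrt n%:R)^-1 <= 2 * Num.sqrt N%:R :> R.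
Proof.
elim: N => [|N ih]; first by rewrite big_geq // mulr_ge0 ?sqrtr_ge0.
rewrite big_nat_recr //=; apply: (le_trans (lerD ih (lexx _))).
have ab : Num.sqrt N.+1%:R ^+ 2 = Num.sqrt N%:R ^+ 2 + 1 :> R.
  by rewrite !sqr_sqrtr // natr1.
have b0 : 0 < Num.sqrt N.+1%:R :> R by rewrite sqrtr_gt0 ltr0n.
move: (Num.sqrt N%:R) (Num.sqrt N.+1%:R) ab b0 => a b ab b0.
rewrite -(@ler_pM2r _ b) // mulrDl mulVf ?gt_eqF //.
by have := sqr_ge0 (b - a); rewrite !expr2 in ab *; lra.
Qed.

(** Conjugation reduces negative times to positive ones; the sign of [x] is harmless as the bounds
    are uniform in [x]. *)
Lemma sum_pow32_reflect t x (N : nat) :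
  normc (\sum_(0 <= n < N) cis (- t * (n%:R * Num.sqrt n%:R) + n%:R * x)) =
  normc (\sum_(0 <= n < N) cis (t * (n%:R * Num.sqrt n%:R) + n%:R * - x)).
Proof.
rewrite -normcJ conjc_sum; congr normc; apply: eq_bigr => n _.
by rewrite -cisN; congr cis; ring.
Qed.

Definition sum_bound t alpha := exists2 C : R, 0 <= C & forall x (N : nat), (0 < N)%N ->
  normc (\sum_(0 <= n < N) cis (t * omega_gc R n%:Z + n%:R * x)) <= C * N%:R `^ (1 - alpha).

(** Replacing [omega n] by [n^(3/2)] changes the sum by O([sqrt N]), which [alpha <= 1/2] absorbs.
    The equation between [alpha] and [th] converts powers of [sqrt N] into powers of [N]. *)
Lemma sum_bound_omega t alpha th (D : R) : alpha <= 1 / 2 ->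
  1 - alpha = (1 / 2 + th) / 2 -> 0 <= D ->
  (forall x (N : nat), (0 < N)%N ->
    normc (\sum_(0 <= n < N) cis (t * (n%:R * Num.sqrt n%:R) + n%:R * x))
    <= D * Num.sqrt N%:R `^ (1 / 2 + th)) ->
  sum_bound t alpha.
Proof.
move=> a2 ath D0 hD; exists (D + (2 * `|t| + 2)) => [|x N N0].
  by rewrite addr_ge0 // addr_ge0 // mulr_ge0.
have N1 : 1 <= N%:R :> R by rewrite ler1n.
have e1 : Num.sqrt N%:R `^ (1 / 2 + th) = N%:R `^ (1 - alpha) :> R.
  rewrite -powR12_sqrt // -powRrM ath; congr (_ `^ _); ring.
have e2 : Num.sqrt N%:R <= N%:R `^ (1 - alpha) :> R.
  by rewrite -powR12_sqrt // ler_powR //; lra.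
have e3 : 1 <= N%:R `^ (1 - alpha) :> R.
  by rewrite -[leLHS](powRr0 N%:R) ler_powR //; lra.
have := hD x N N0; rewrite e1.
set S := \sum_(0 <= n < N) _; set S' := \sum_(0 <= n < N) _ => hS.
have : normc (S' - S) <= 2 + `|t| * (2 * Num.sqrt N%:R).
  rewrite /S /S'; case: N N0 {N1 e1 e2 e3 S S' hS} => // N _.
  rewrite -sumrB big_nat_recl //= (le_trans (le_normcD _ _)) // lerD //.
    by rewrite (le_trans (normc_le_sub _ _)) // !normc_cis; lra.
  apply: (@le_trans _ _ (\sum_(1 <= n < N.+1) `|t| * (Num.sqrt n%:R)^-1)); last first.
    rewrite -mulr_sumr ler_wpM2l // (le_trans (sum_inv_sqrt N)) //.
    by rewrite ler_wpM2l // ler_wsqrtr // ler_nat.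
  rewrite (le_trans (normc_sum _ _ _)) // [leRHS]big_add1 /=.
  apply: ler_sum_nat => n _; rewrite (le_trans (normc_cisB _ _)) //.
  rewrite (_ : _ - _ = t * (omega_gc R n.+1%:Z - n.+1%:R * Num.sqrt n.+1%:R)); last by ring.
  by rewrite normrM ler_wpM2l // omega_gc_approx.
have := le_normcD (S' - S) S; rewrite subrK.
have : `|t| * (2 * Num.sqrt N%:R) <= `|t| * (2 * N%:R `^ (1 - alpha)).
  by rewrite ler_wpM2l // ler_wpM2l.
rewrite !mulrDl; move: (N%:R `^ _) e3 hS => Y e3 hS; lra.
Qed.

(** The dual sum is estimated by its number of terms, that is [th = 1]. *)
Lemma sum_bound_quarter t : t != 0 -> sum_bound t (1 / 4).
Proof.
have pos s : 0 < s -> exists2 D : R, 0 <= D & forall x (N : nat), (0 < N)%N ->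
    normc (\sum_(0 <= n < N) cis (s * (n%:R * Num.sqrt n%:R) + n%:R * x))
    <= D * Num.sqrt N%:R `^ (1 / 2 + 1).
  move=> s0; apply: (@exp_sum_transfer R s 1 1 s0) => //; first by lra.
  move=> s1 M; rewrite mul1r powRr1 //.
  have := @normc_sum_cis_le R (fun j => - (s * (s1 + 2 * block_radius s * j%:R) ^+ 3 / 2)) 0 M.
  by rewrite big_mkord subn0.
rewrite neq_lt => /orP[t0|/pos[D D0 hD]]; last first.
  by apply: (@sum_bound_omega t (1 / 4) 1 D) => //; lra.
have [|D D0 hD] := pos (- t); first by rewrite oppr_gt0.
apply: (@sum_bound_omega t (1 / 4) 1 D) => //; [lra|lra|].
by move=> x N N0; rewrite -[t]opprK sum_pow32_reflect; exact: hD.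
Qed.

Lemma sum_bound_khinchin_levy t eta : t != 0 -> 0 < eta -> eta <= 1 / 4 ->
  khinchin_levy (4 / 27 * (t / (2 * pi)) ^- 2) -> sum_bound t (3 / 8 - eta / 2).
Proof.
move=> t0 e0 e4.
have pos s : 0 < s -> khinchin_levy (4 / 27 * (s / (2 * pi)) ^- 2) ->
    exists2 D : R, 0 <= D & forall x (N : nat), (0 < N)%N ->
    normc (\sum_(0 <= n < N) cis (s * (n%:R * Num.sqrt n%:R) + n%:R * x))
    <= D * Num.sqrt N%:R `^ (1 / 2 + (3 / 4 + eta)).
  move=> s0 hkl; have e1 : eta <= 1 by lra.
  have [D D0 hD] := weyl_khinchin_levy hkl e0 e1.
  have p0 := @pi_gt0 R.
  apply: (@exp_sum_transfer R s _ D s0) => //; [lra|lra|].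
  move=> s1 M; set r := block_radius s.
  apply: le_trans (hD (- (s / 2 * (3 * s1 * (2 * r) ^+ 2))) (- (s / 2 * (3 * s1 ^+ 2 * (2 * r))))
    (- (s / 2 * s1 ^+ 3)) M).
  rewrite le_eqVlt; apply/orP; left; apply/eqP; congr normc; apply: eq_bigr => j _.
  (* The coefficient of [j^3] in [s (s1 + 2 r j)^3 / 2], with [s] the time: here the constant 4/27
     and the inverse square of the time arise. *)
  congr cis; have -> : 2 * pi * (4 / 27 * (s / (2 * pi)) ^- 2) = s / 2 * (2 * r) ^+ 3.
    rewrite /r /block_radius; move: (pi : R) p0 => p p0.
    by field; rewrite !gt_eqF.
  by field.
rewrite neq_lt in t0; case/orP: t0 => [t0|t0] hkl; last first.
  have [D D0 hD] := pos t t0 hkl.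
  by apply: (@sum_bound_omega t _ (3 / 4 + eta) D) => //; lra.
have [||D D0 hD] := pos (- t); first by rewrite oppr_gt0.
  by rewrite mulNr sqrrN.
apply: (@sum_bound_omega t _ (3 / 4 + eta) D) => //; [lra|lra|].
by move=> x N N0; rewrite -[t]opprK sum_pow32_reflect; exact: hD.
Qed.

End DispersionSums.

(** * Step functions on the circle as combinations of jumps *)

Section StepFunctions.
Context {R : realType}.
Implicit Types (x y a b : R) (L : seq (R[i] * R)).

Lemma countableU (T : Type) (A B : set T) : countable A -> countable B -> countable (A `|` B).
Proof.
move=> cA cB; have -> : A `|` B = \bigcup_(i in [set: bool]) (if i then A else B).
  apply/seteqP; split => z.
    by case=> h; [exists true|exists false].
  by case=> -[] _ h; [left|right].
by apply: bigcup_countable => // -[].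
Qed.

Definition turn x y : R := (Num.floor ((x - y) / (2 * pi)))%:~R.

Definition lattice a : set R := [set x | exists k : int, x = a + 2 * pi * k%:~R].

Lemma countable_lattice a : countable (lattice a).
Proof.
have -> : lattice a = \bigcup_(k in [set: int]) [set a + 2 * pi * k%:~R].
  by apply/seteqP; split => z; [case=> k ->; exists k|case=> k _ ->; exists k].
by apply: bigcup_countable.
Qed.

Lemma floor_between (u v : R) : v <= u -> u <= v + 1 ->
  (forall k : int, u <> k%:~R) -> (forall k : int, v <> k%:~R) ->
  (exists k : int, v < k%:~R < u) /\ (Num.floor u)%:~R - (Num.floor v)%:~R = 1 :> R \/
  (~ exists k : int, v < k%:~R < u) /\ (Num.floor u)%:~R - (Num.floor v)%:~R = 0 :> R.
Proof.
move=> vu uv nu nv.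
have fu := floor_le u; have fu1 := floorD1_gt u.
have fv := floor_le v; have fv1 := floorD1_gt v.
set U := Num.floor u in fu fu1 *; set V := Num.floor v in fv fv1 *.
have {}fu : U%:~R < u by rewrite lt_neqAle fu andbT eq_sym; apply/eqP; exact: nu.
have {}fv : V%:~R < v by rewrite lt_neqAle fv andbT eq_sym; apply/eqP; exact: nv.
have VU : (V < U + 1)%R by rewrite -(ltr_int R); lra.
have UV : (U < V + 1 + 1)%R by rewrite -(ltr_int R) [in ltRHS]intrD; lra.
rewrite ltzD1 in VU; rewrite ltzD1 in UV.
have [E|NE] := eqVneq U V; [right|left].
  split; last by rewrite E subrr.
  case=> k /andP[k1 k2]; have : (k < V + 1)%R by rewrite -(ltr_int R) -E; lra.
  have : (V < k)%R by rewrite -(ltr_int R); lra.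
  by rewrite ltzD1 => /lt_le_trans h /h; rewrite ltxx.
have E : U = V + 1.
  by apply/eqP; rewrite eq_le UV lezD1 lt_neqAle VU eq_sym NE.
split; last by rewrite E intrD addrC addKr.
by exists U; rewrite fu E andbT.
Qed.

(** Off the end points, the indicator of the arc from [a] to [b] is thus [turn x a - turn x b]: the
    first term counts entries into the arc, the second exits. *)
Lemma turn_between a b x : a <= b -> b <= a + 2 * pi -> ~ lattice a x -> ~ lattice b x ->
  (exists k : int, a < x + 2 * pi * k%:~R < b) /\ turn x a - turn x b = 1 \/
  (~ exists k : int, a < x + 2 * pi * k%:~R < b) /\ turn x a - turn x b = 0.
Proof.
have p0 : 0 < 2 * pi :> R by rewrite mulr_gt0 // pi_gt0.
rewrite /turn /lattice /=; move: (2 * pi : R) p0 => p p0 ab ba xa xb.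
have uE c : x = c + p * ((x - c) / p) by rewrite mulrCA divff ?gt_eqF // mulr1 addrC subrK.
have h (k : int) : (a < x + p * k%:~R < b) = ((x - b) / p < (- k)%:~R < (x - a) / p).
  rewrite ltr_pdivrMr // ltr_pdivlMr // mulrNz.
  by apply/andP/andP => -[h1 h2]; split; lra.
have vu : (x - b) / p <= (x - a) / p by rewrite ler_pM2r ?invr_gt0 //; lra.
have uv : (x - a) / p <= (x - b) / p + 1.
  have E : ((x - b) / p + 1) * p = x - b + p by field; rewrite gt_eqF.
  by rewrite ler_pdivrMr // E; lra.
have na (k : int) : (x - a) / p <> k%:~R by move=> E; apply: xa; exists k; rewrite -E.
have nb (k : int) : (x - b) / p <> k%:~R by move=> E; apply: xb; exists k; rewrite -E.
case: (floor_between vu uv na nb) => -[h1 h2]; [left|right]; split=> //.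
  by case: h1 => k hk; exists (- k); rewrite h opprK.
by case=> k; rewrite h => hk; apply: h1; exists (- k).
Qed.

Definition turn_node a : R := a - 2 * pi * (Num.floor (a / (2 * pi)))%:~R.

Lemma turn_node_itv a : 0 <= turn_node a < 2 * pi.
Proof.
have p0 : 0 < 2 * pi :> R by rewrite mulr_gt0 // pi_gt0.
rewrite /turn_node; move: (2 * pi : R) p0 => p p0.
have h1 := floor_le (a / p); have h2 := floorD1_gt (a / p).
rewrite ler_pdivlMr // in h1; rewrite ltr_pdivrMr // intrD in h2.
by apply/andP; split; lra.
Qed.

Lemma turn_nodeE a x : turn x (turn_node a) = turn x a + (Num.floor (a / (2 * pi)))%:~R.
Proof.
have p0 : 0 < 2 * pi :> R by rewrite mulr_gt0 // pi_gt0.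
rewrite /turn /turn_node; move: (2 * pi : R) p0 => p p0.
set k := Num.floor (a / p).
have -> : (x - (a - p * k%:~R)) / p = (x - a) / p + k%:~R by field; rewrite gt_eqF.
by rewrite floorDrz ?intr_int // intrKfloor intrD.
Qed.

(* [f] agrees off a countable set with a constant plus a combination of the
   jumps [turn _ y] (nondecreasing step functions jumping by 1 on [y + 2 pi Z]). *)
Definition jump_form (f : R -> R[i]) : Prop :=
  exists L (A : R[i]) (B : set R), [/\ countable B, \sum_(p <- L) p.1 = 0,
    forall p, p \in L -> 0 <= p.2 < 2 * pi &
    forall x, ~ B x -> f x = A + \sum_(p <- L) p.1 * (turn x p.2)%:C].

Lemma jump_form_cst (c : R[i]) (B : set R) (f : R -> R[i]) : countable B ->
  (forall x, ~ B x -> f x = c) -> jump_form f.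
Proof.
move=> cB fc; exists [::], c, B; split => // [|x xB]; first by rewrite big_nil.
by rewrite big_nil addr0 fc.
Qed.

Lemma jump_formD f g : jump_form f -> jump_form g -> jump_form (fun x => f x + g x).
Proof.
move=> [L [A [B [cB s0 hL fE]]]] [L' [A' [B' [cB' s0' hL' gE]]]].
exists (L ++ L'), (A + A'), (B `|` B'); split; first exact: countableU.
- by rewrite big_cat /= s0 s0' addr0.
- by move=> p; rewrite mem_cat => /orP[/hL|/hL'].
- move=> x /not_orP[xB xB']; rewrite big_cat /= fE // gE //; ring.
Qed.

Lemma jump_formZ c f : jump_form f -> jump_form (fun x => c * f x).
Proof.
move=> [L [A [B [cB s0 hL fE]]]].
exists [seq (c * p.1, p.2) | p <- L], (c * A), B; split => //.
- by rewrite big_map /= -mulr_sumr s0 mulr0.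
- by move=> p /mapP[p' /hL h ->].
- move=> x xB; rewrite fE // mulrDr big_map mulr_sumr; congr (_ + _).
  by apply: eq_bigr => p _; rewrite mulrA.
Qed.

Lemma torus_arc_setT (I : interval R) a b : a + 2 * pi <= b ->
  (forall x, a <= x <= b -> x \in I) -> torus_arc I = setT.
Proof.
have p0 : 0 < 2 * pi :> R by rewrite mulr_gt0 // pi_gt0.
move=> ab hI; apply/seteqP; split => // x _; rewrite /torus_arc /=.
move: (2 * pi : R) p0 ab => p p0 ab.
exists (Num.ceil ((a - x) / p)); apply: hI.
have h1 := ceil_ge ((a - x) / p); have h2 := ceilB1_lt ((a - x) / p).
rewrite ler_pdivrMr // in h1; rewrite intrD mulrN1z ltr_pdivlMr // in h2.
by apply/andP; split; lra.
Qed.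

(** An unbounded nonempty interval, or one longer than [2 pi], covers the circle and gives a
    constant; an inverted one gives 0. Only the remaining case produces jumps, one up and one down,
    so the jumps sum to 0. *)
Lemma jump_form_arc (I : interval R) : jump_form (\1_(torus_arc I)).
Proof.
have p0 : 0 < 2 * pi :> R by rewrite mulr_gt0 // pi_gt0.
have full : torus_arc I = setT -> jump_form (\1_(torus_arc I)).
  by move=> ->; apply: (@jump_form_cst 1 set0) => // x _; rewrite indicE in_setT.
have empty : torus_arc I = set0 -> jump_form (\1_(torus_arc I)).
  by move=> ->; apply: (@jump_form_cst 0 set0) => // x _; rewrite indicE in_set0.
case: I full empty => [[bl a|[]] [bu b|[]]] full empty.
- have [ba|ab] := ltP b a.
    apply: empty; apply/seteqP; split => // x [k]; rewrite in_itv /= => /andP[h1 h2].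
    by have := le_lt_trans (lteifW h2) ba; have := lteifW h1 => + /lt_le_trans h => /h; rewrite ltxx.
  have [abp|abp] := ltP (a + 2 * pi) b.
    pose c := (b - a - 2 * pi) / 4.
    apply/full/(@torus_arc_setT _ (a + c) (b - c)); rewrite /c; first by lra.
    move=> x /andP[h1 h2]; rewrite in_itv /=; apply/andP; split.
      by apply: lteifS; lra.
    by apply: lteifS; lra.
  (* The end points are moved into one period; this shifts the two [turn] functions by integers,
     compensated by the constant. *)
  exists [:: (1, turn_node a); (-1, turn_node b)],
    ((Num.floor (b / (2 * pi)))%:~R - (Num.floor (a / (2 * pi)))%:~R)%:C, (lattice a `|` lattice b).
  split.
  + by apply: countableU; exact: countable_lattice.
  + by rewrite big_cons big_seq1 /= subrr.
  + by move=> p; rewrite !inE => /orP[] /eqP ->; exact: turn_node_itv.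
  + move=> x /not_orP[xa xb].
    rewrite big_cons big_seq1 /= !turn_nodeE mul1r mulN1r.
    rewrite (_ : _ + _ = (turn x a - turn x b)%:C); last first.
      by rewrite !rmorphB !rmorphD /=; ring.
    have ne k : x + 2 * pi * k%:~R <> a /\ x + 2 * pi * k%:~R <> b.
      by split => E; [apply: xa|apply: xb]; exists (- k); rewrite -E mulrNz mulrN addrK.
    case: (turn_between ab abp xa xb) => -[h ->].
      rewrite indicE mem_set //; case: h => k /andP[h1 h2]; exists k.
      by rewrite in_itv /=; apply/andP; split; apply: lteifS.
    rewrite indicE memNset // => -[k]; rewrite in_itv /= => /andP[h1 h2]; apply: h.
    have [n1 n2] := ne k; exists k; rewrite !lt_neqAle (lteifW h1) (lteifW h2) !andbT.
    by apply/andP; split; apply/eqP => // E; apply: n1.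
- apply: empty; apply/seteqP; split => // x [k]; rewrite in_itv /= andbF //.
- apply/full/(@torus_arc_setT _ (a + 1) (a + 1 + 2 * pi)) => // x /andP[h1 h2].
  by rewrite in_itv /= andbT; apply: lteifS; lra.
- apply/full/(@torus_arc_setT _ (b - 1 - 2 * pi) (b - 1)) => [|x /andP[h1 h2]]; first by lra.
  by rewrite in_itv /=; apply: lteifS; lra.
- apply: empty; apply/seteqP; split => // x [k]; rewrite in_itv //.
- apply/full/(@torus_arc_setT _ 0 (2 * pi)) => [|x _]; first by rewrite add0r.
  by rewrite in_itv.
- by apply: empty; apply/seteqP; split => // x [k]; rewrite in_itv /=.
- by apply: empty; apply/seteqP; split => // x [k]; rewrite in_itv /=.
- by apply: empty; apply/seteqP; split => // x [k]; rewrite in_itv /=.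
Qed.

Lemma jump_form_step g : step_function g -> jump_form g.
Proof.
move=> [m [c [I gE]]].
suff h (r : seq 'I_m) : jump_form (fun x => \sum_(j <- r) c j * \1_(torus_arc (I j)) x).
  by have := h (index_enum 'I_m); congr jump_form; apply/funext => x; rewrite gE.
elim: r => [|j r ih].
  by apply: (@jump_form_cst 0 set0) => // x _; rewrite big_nil.
have := jump_formD (jump_formZ (c j) (jump_form_arc (I j))) ih.
by congr jump_form; apply/funext => x; rewrite big_cons.
Qed.

(** The list of jumps may repeat a node, so only the total weight at each node is meaningful. *)
Lemma sum_by_nodes L (f : R -> R[i]) :
  (forall y, \sum_(p <- L | p.2 == y) p.1 = 0) -> \sum_(p <- L) p.1 * f p.2 = 0.
Proof.
move=> h; have [n] := ubnP (size L); elim: n L h => // n ih [|p L] h sz.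
  by rewrite big_nil.
rewrite (bigID (fun q : R[i] * R => q.2 == p.2)) /=.
rewrite (eq_bigr (fun q => q.1 * f p.2)) => [|q /eqP -> //].
rewrite -mulr_suml h mul0r add0r -big_filter.
apply: ih => [y|].
  rewrite big_filter_cond; have [->|yp] := eqVneq y p.2.
    by apply: big_pred0 => q; case: (q.2 == p.2).
  rewrite -[RHS](h y); apply: eq_bigl => q.
  by case: (eqVneq q.2 y) => [->|]; rewrite ?andbF // yp.
move: sz => /=; rewrite eqxx /= !ltnS; apply: leq_ltn_trans.
by rewrite size_filter count_size.
Qed.

End StepFunctions.

(** * Integrals over one period *)

Section FourierCoefficients.
Context {R : realType}.
Implicit Types (x y c : R) (f h : R -> R[i]) (v : R[i]).

Local Notation mu := (@lebesgue_measure R).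

Lemma integral_trunc (h H : R -> R) y c : 0 <= y -> y <= c ->
  (forall x, is_derive x 1 H (h x)) -> continuous h ->
  mu.-integrable `[0, c] (EFin \o (fun x => if x < y then h x else 0)) /\
  \int[mu]_(x in `[0, c]) (if x < y then h x else 0) = H y - H 0.
Proof.
move=> y0 yc dH ch.
have inth : mu.-integrable `[0, y] (EFin \o h).
  apply: continuous_compact_integrable; first exact: segment_compact.
  exact: continuous_subspaceT.
have inth' : mu.-integrable `[0, y[ (EFin \o h).
  apply: integrableS inth => //.
  by move=> x /=; rewrite !in_itv /= => /andP[-> /ltW].
have E : {in `[0, c]%classic, (fun x => if x < y then h x else 0) =1 h \_ `[0, y[}.
  move=> x; rewrite inE /= in_itv /= => /andP[x0 _]; rewrite patchE.
  have [xy|xy] := ltP x y; first by rewrite mem_set //= in_itv /= x0.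
  by rewrite memNset //= in_itv /= => /andP[_]; rewrite ltNge xy.
split.
  have h1 : mu.-integrable `[0, c] (EFin \o (h \_ `[0, y[)).
    rewrite -restrict_EFin; apply: (@integrableS _ _ _ _ setT) => //.
    exact: ((@integrable_mkcond _ _ _ mu `[0, y[%classic (EFin \o h) (measurable_itv _)).1 inth').
  by apply: eq_integrable h1 => // x xD /=; rewrite E.
transitivity (\int[mu]_(x in `[0, c]) (h \_ `[0, y[) x).
  by apply: eq_Rintegral => x xD; exact: E.
rewrite -Rintegral_mkcondr.
have -> : `[0, c]%classic `&` `[0, y[%classic = `[0, y[%classic :> set R.
  apply/seteqP; split => x /=; first by case.
  rewrite !in_itv /= => /andP[x0 xy]; split; apply/andP; split => //.
  by rewrite ltW // (lt_le_trans xy).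
rewrite Rintegral_itv_bndo_bndc //.
move: y0; rewrite le_eqVlt => /predU1P[<-|y0].
  by rewrite set_itv1 Rintegral_set1 subrr.
have cH x : {for x, continuous H}.
  by apply: differentiable_continuous; apply/derivable1_diffP; have [] := dH x.
rewrite /Rintegral (@continuous_FTC2 _ h H) //.
- exact: continuous_subspaceT.
- split => [x _||]; first by have [] := dH x.
    by apply: cvg_at_right_filter; exact: cH.
  by apply: cvg_at_left_filter; exact: cH.
- by move=> x _; rewrite derive1E; have [] := dH x.
Qed.

(** Integrability of both parts travels with the value, so that integrals can be added. *)
Definition cint_on f v := [/\
  mu.-integrable `[0, 2 * pi] (EFin \o (fun x => complex.Re (f x))),
  mu.-integrable `[0, 2 * pi] (EFin \o (fun x => complex.Im (f x))) &
  torus_integral f = v].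

Lemma cint_on0 : cint_on (fun=> 0) 0.
Proof.
split; [exact: integrable0|exact: integrable0|].
by rewrite /torus_integral /= !Rintegral_cst // !mul0r.
Qed.

Lemma cint_onD f g v w : cint_on f v -> cint_on g w ->
  cint_on (fun x => f x + g x) (v + w).
Proof.
move=> [f1 f2 <-] [g1 g2 <-]; split.
- by apply: eq_integrable (integrableD _ f1 g1) => // x _ /=; rewrite ReD.
- by apply: eq_integrable (integrableD _ f2 g2) => // x _ /=; rewrite ImD.
- rewrite /torus_integral; apply: complex_eq => /=.
    by rewrite -RintegralD //; apply: eq_Rintegral => x _; rewrite ReD.
  by rewrite -RintegralD //; apply: eq_Rintegral => x _; rewrite ImD.
Qed.

Lemma cint_onZ f v w : cint_on f v -> cint_on (fun x => w * f x) (w * v).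
Proof.
move=> [f1 f2 <-]; case: w => a b.
have h1 : mu.-integrable `[0, 2 * pi] (EFin \o (fun x => a * complex.Re (f x))).
  exact: (@integrableZl _ _ _ mu `[0, 2 * pi]%classic (measurable_itv _) a _ f1).
have h2 : mu.-integrable `[0, 2 * pi] (EFin \o (fun x => - b * complex.Im (f x))).
  exact: (@integrableZl _ _ _ mu `[0, 2 * pi]%classic (measurable_itv _) (- b) _ f2).
have h3 : mu.-integrable `[0, 2 * pi] (EFin \o (fun x => a * complex.Im (f x))).
  exact: (@integrableZl _ _ _ mu `[0, 2 * pi]%classic (measurable_itv _) a _ f2).
have h4 : mu.-integrable `[0, 2 * pi] (EFin \o (fun x => b * complex.Re (f x))).
  exact: (@integrableZl _ _ _ mu `[0, 2 * pi]%classic (measurable_itv _) b _ f1).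
split.
- apply: eq_integrable (integrableD _ h1 h2) => // x _ /=.
  by rewrite ReM /= mulNr EFinB.
- by apply: eq_integrable (integrableD _ h3 h4) => // x _ /=; rewrite ImM.
- rewrite /torus_integral; apply: complex_eq; rewrite ?ReM ?ImM /=.
    rewrite -mulNr -!RintegralZl // -RintegralD //.
    by apply: eq_Rintegral => x _; rewrite ReM /= mulNr.
  rewrite -!RintegralZl // -RintegralD //.
  by apply: eq_Rintegral => x _; rewrite ImM.
Qed.


(** Subsets of a countable set are measurable. This covers the exceptional set of a jump form, where
    nothing is said about the function. *)
Lemma measurable_off_countable (D B : set R) (f h : R -> R) : measurable D ->
  countable B -> measurable_fun D h -> (forall x, D x -> ~ B x -> f x = h x) ->
  measurable_fun D f.
Proof.
move=> mD cB mh fh _ Y mY.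
have mc (A : set R) : countable A -> measurable A.
  by move=> cA; apply: countable_measurable.
have -> : D `&` f @^-1` Y = ((D `&` h @^-1` Y) `\` B) `|` ((D `&` f @^-1` Y) `&` B).
  apply/seteqP; split => x /=.
    move=> [Dx Yx]; have [Bx|Bx] := pselect (B x); [by right|left].
    by split => //; split => //; rewrite /preimage /= -fh.
  by case=> [[[Dx Yx] Bx]|[[]]] //; split => //; rewrite fh.
apply: measurableU.
  by apply: measurableD; [exact: mh|exact: mc].
apply: mc; apply: sub_countable cB; apply: subset_card_le; exact: subIsetr.
Qed.

Lemma cint_on_ae f h v (B : set R) : cint_on h v -> countable B ->
  (forall x, 0 <= x <= 2 * pi -> ~ B x -> f x = h x) -> torus_integral f = v.
Proof.
move=> [h1 h2 <-] cB fh.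
have key (u w : R -> R) : mu.-integrable `[0, 2 * pi] (EFin \o w) ->
    (forall x, 0 <= x <= 2 * pi -> ~ B x -> u x = w x) ->
    \int[mu]_(x in `[0, 2 * pi]) u x = \int[mu]_(x in `[0, 2 * pi]) w x.
  move=> iw uw; have mw : measurable_fun `[0, 2 * pi]%classic w.
    by move/integrableP : iw => -[/measurable_EFinP].
  have mu' : measurable_fun `[0, 2 * pi]%classic u.
    apply: measurable_off_countable cB mw _ => // x; rewrite /= in_itv /=; exact: uw.
  congr fine; apply: ae_eq_integral => //; [exact/measurable_EFinP|exact/measurable_EFinP|].
  exists B; split; first by apply: countable_measurable.
    exact: countable_lebesgue_measure0.
  move=> x /= nx; apply: contrapT => Bx; apply: nx => D; congr EFin.
  by apply: uw => //; move: D; rewrite /= in_itv.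
rewrite /torus_integral; congr Complex.
  by apply: key => // x hx Bx; rewrite fh.
by apply: key => // x hx Bx; rewrite fh.
Qed.

Lemma cint_on_trunc (n : int) y : n != 0 -> 0 <= y <= 2 * pi ->
  cint_on (fun x => if x < y then cis (- (n%:~R * x)) else 0)
    ((Complex 0 n%:~R)^-1 * (1 - cis (- (n%:~R * y)))).
Proof.
move=> n0 /andP[y0 yp].
have n0' : n%:~R != 0 :> R by rewrite intr_eq0.
have dl x : is_derive x 1 (fun x : R => - (n%:~R * x)) (- (n%:~R * 1)).
  exact: is_deriveN1 (is_deriveZ1 _ (is_derive_id1 x)).
have d1 x : is_derive x 1 (fun x : R => - n%:~R^-1 * sin (- (n%:~R * x))) (cos (- (n%:~R * x))).
  apply: is_derive_eq (is_deriveZ1 _ (is_derive_comp1 (dl x) (is_derive_sin _))) _.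
  by field.
have d2 x : is_derive x 1 (fun x : R => n%:~R^-1 * cos (- (n%:~R * x))) (sin (- (n%:~R * x))).
  apply: is_derive_eq (is_deriveZ1 _ (is_derive_comp1 (dl x) (is_derive_cos _))) _.
  by field.
have cont (u du : R -> R) : (forall x, is_derive x 1 u (du x)) -> continuous u.
  move=> du' x; apply: differentiable_continuous; apply/derivable1_diffP.
  by have [] := du' x.
have c1 : continuous (fun x : R => cos (- (n%:~R * x))).
  apply: cont => x; exact: (is_derive_comp1 (dl x) (is_derive_cos _)).
have c2 : continuous (fun x : R => sin (- (n%:~R * x))).
  apply: cont => x; exact: (is_derive_comp1 (dl x) (is_derive_sin _)).
have [i1 e1] := integral_trunc y0 yp d1 c1.
have [i2 e2] := integral_trunc y0 yp d2 c2.
have r1 x : complex.Re (if x < y then cis (- (n%:~R * x)) else 0) =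
  if x < y then cos (- (n%:~R * x)) else 0 by case: ifP.
have r2 x : complex.Im (if x < y then cis (- (n%:~R * x)) else 0) =
  if x < y then sin (- (n%:~R * x)) else 0 by case: ifP.
split.
- by apply: eq_integrable i1 => // x _ /=; rewrite r1.
- by apply: eq_integrable i2 => // x _ /=; rewrite r2.
- have -> : (Complex 0 n%:~R)^-1 = Complex 0 (- n%:~R^-1) :> R[i].
    apply: (mulfI (_ : Complex 0 n%:~R != 0 :> R[i])).
      by rewrite eq_complex /= negb_and n0' orbT.
    rewrite divff; last by rewrite eq_complex /= negb_and n0' orbT.
    by apply: complex_eq; rewrite ?ReM ?ImM /=; field.
  rewrite /torus_integral; apply: complex_eq; rewrite ?ReM ?ImM ?ReB ?ImB /=.
    under eq_Rintegral do rewrite r1.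
    rewrite e1 mulr0 oppr0 sin0; ring.
  under eq_Rintegral do rewrite r2.
  rewrite e2 mulr0 oppr0 cos0; ring.
Qed.

End FourierCoefficients.

(** * Fourier coefficients of a step function in terms of its jumps *)

Section FourierJumps.
Context {R : realType}.
Implicit Types (x y : R) (g : R -> R[i]).

Lemma turn_small x y : 0 <= x < 2 * pi -> 0 <= y < 2 * pi ->
  turn x y = if x < y then -1 else 0.
Proof.
have p0 : 0 < 2 * pi :> R by rewrite mulr_gt0 // pi_gt0.
rewrite /turn; move: (2 * pi : R) p0 => p p0 /andP[x0 xp] /andP[y0 yp].
have [xy|xy] := ltP x y.
  have -> : Num.floor ((x - y) / p) = -1.
    apply: floor_def; rewrite addNr mulrN1z ltr_pdivrMr // mul0r ler_pdivlMr //.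
    by apply/andP; split; lra.
  by rewrite mulrN1z.
have -> : Num.floor ((x - y) / p) = 0; last by [].
apply: floor_def; rewrite add0r ltr_pdivrMr // ler_pdivlMr //.
by apply/andP; split; lra.
Qed.

Definition node_weight (L : seq (R[i] * R)) (y : R) : R[i] := \sum_(p <- L | p.2 == y) p.1.

(** Within a period [turn x y] is minus the indicator of [x < y], whose coefficients are explicit;
    the terms without exponential cancel because the jumps sum to 0. If all node weights vanished,
    [g] would be almost everywhere equal to the constant of its jump form. *)
Lemma fourier_coef_step g : step_function g -> nonconstant g ->
  exists L : seq (R[i] * R), [/\ forall p, p \in L -> 0 <= p.2 < 2 * pi,
    exists y0, node_weight L y0 != 0 &
    forall n : int, n != 0 -> fourier_coef g n =
      (Complex 0 (2 * pi * n%:~R))^-1 * \sum_(p <- L) p.1 * cis (- (n%:~R * p.2))].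
Proof.
move=> /jump_form_step[L [A [B [cB s0 hL gE]]]] gnc; exists L; split => //.
  apply: contrapT => /forallNP h; apply: gnc; exists A; exists B; split.
  - by apply: countable_measurable.
  - exact: countable_lebesgue_measure0.
  - move=> x /= nx; apply: contrapT => xB; apply: nx.
    rewrite gE // (@sum_by_nodes R L (fun y => (turn x y)%:C)) ?addr0 // => y.
    by have /negP/negbNE/eqP := h y.
move=> n n0; have p0 : 0 < 2 * pi :> R by rewrite mulr_gt0 // pi_gt0.
have n0' : n%:~R != 0 :> R by rewrite intr_eq0.
pose F (p : R[i] * R) x := p.1 * (if x < p.2 then cis (- (n%:~R * x)) else 0).
pose v (p : R[i] * R) := p.1 * ((Complex 0 n%:~R)^-1 * (1 - cis (- (n%:~R * p.2)))).
have hF p : 0 <= p.2 <= 2 * pi -> cint_on (F p) (v p).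
  by move=> hp; apply: cint_onZ; exact: cint_on_trunc.
(* The constant [A] is treated as a truncation at [2 pi], whose coefficient of order [n]
   vanishes. *)
pose h x := F (A, 2 * pi) x + -1 * \sum_(p <- L) F p x.
have hh : cint_on h (v (A, 2 * pi) + -1 * \sum_(p <- L) v p).
  apply: cint_onD; first by apply: hF => /=; rewrite lexx (ltW p0).
  apply: cint_onZ.
  elim: (L) hL => [|p L' ih] hL'.
    rewrite big_nil; have := @cint_on0 R; congr cint_on.
    by apply/funext => x; rewrite big_nil.
  rewrite big_cons; have hp : 0 <= p.2 <= 2 * pi.
    by have /andP[-> /ltW ->] := hL' p (mem_head _ _).
  have := cint_onD (hF p hp) (ih (fun q qL => hL' q (mem_behead (s := p :: L') qL))).
  by congr cint_on; apply/funext => x; rewrite big_cons.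
have cB' : countable (B `|` [set 2 * pi]) by apply: countableU.
rewrite /fourier_coef (@cint_on_ae R _ h _ _ hh cB'); last first.
  move=> x /andP[x0 xp] /not_orP[xB /= x2].
  have xlt : x < 2 * pi by rewrite lt_neqAle xp andbT; apply/eqP.
  rewrite gE // mulrDl /h /F /= xlt mulN1r; congr (_ + _).
  rewrite mulr_suml -sumrN !big_seq; apply: eq_bigr => p pL.
  rewrite turn_small ?hL ?x0 //; case: ifP => _; last by rewrite rmorph0 !mulr0 mul0r oppr0.
  by rewrite rmorphN rmorph1 mulrN1 mulNr.
have -> : v (A, 2 * pi) = 0.
  by rewrite /v /= mulrC -[n%:~R * _]mulrC -mulrN -mulrNz cis_2pi_int subrr mulr0 mul0r.
rewrite add0r mulN1r /v.
have -> : \sum_(p <- L) p.1 * ((Complex 0 n%:~R)^-1 * (1 - cis (- (n%:~R * p.2)))) =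
  (Complex 0 n%:~R)^-1 * (\sum_(p <- L) p.1 - \sum_(p <- L) p.1 * cis (- (n%:~R * p.2))).
  by rewrite -sumrB mulr_sumr; apply: eq_bigr => p _; ring.
rewrite s0 sub0r !mulrN opprK mulrA; congr (_ * _).
have -> : Complex 0 (2 * pi * n%:~R) = (2 * pi)%:C * Complex 0 n%:~R :> R[i].
  by apply: complex_eq; rewrite ?ReM ?ImM /=; ring.
by rewrite [RHS]invfM fmorphV.
Qed.

End FourierJumps.

(** * Convergence and Hoelder continuity of the series with coefficients [1 / n] *)

Section LacunaryFreeSeries.
Context {R : realType}.
Implicit Types (x y h alpha : R) (phi : nat -> R).

(** From [ln (n + 1) - ln n >= 1 / (n + 1)] and [exp x >= 1 + x]. It lets series of
    [n^(- alpha - 1)] be summed by telescoping. *)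
Lemma powRN_telescope alpha (n : nat) : 0 < alpha -> (0 < n)%N ->
  alpha * n.+1%:R `^ (- alpha - 1) <= n%:R `^ (- alpha) - n.+1%:R `^ (- alpha) :> R.
Proof.
move=> a0 n0; have n0' : 0 < n%:R :> R by rewrite ltr0n.
have n1' : 0 < n.+1%:R :> R by rewrite ltr0n.
have P0 : 0 < n.+1%:R `^ (- alpha) :> R by exact: powR_gt0.
rewrite powRB ?(gt_eqF n1') ?implybT // powRr1 ?(ltW n1') //.
have E : n%:R `^ (- alpha) = n.+1%:R `^ (- alpha) * expR (alpha * (ln n.+1%:R - ln n%:R)) :> R.
  rewrite /powR !gt_eqF // -expRD; congr expR; ring.
rewrite E.
have l1 : (n.+1%:R)^-1 <= ln n.+1%:R - ln n%:R :> R.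
  have : ln (n%:R / n.+1%:R) <= - (n.+1%:R)^-1 :> R.
    have -> : n%:R / n.+1%:R = 1 + - (n.+1%:R)^-1 :> R.
      have -> : n%:R = n.+1%:R - 1 :> R by rewrite -natr1 addrK.
      by field; rewrite gt_eqF.
    apply: le_ln1Dx; rewrite ltrN2 invf_lt1 // ltr1n //.
  by rewrite ln_div ?posrE //; move: (n.+1%:R^-1) => w; lra.
have h := expR_ge1Dx (alpha * (ln n.+1%:R - ln n%:R)).
have h2 : alpha * (n.+1%:R)^-1 <= alpha * (ln n.+1%:R - ln n%:R) by rewrite ler_wpM2l // ltW.
set l := ln n.+1%:R - ln n%:R in h h2 l1 *; set i : R := n.+1%:R^-1 in h2 l1 *.
move: (expR _) h => e h; rewrite -[_ / n.+1%:R]/(_ * i).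
move: (n.+1%:R `^ (- alpha)) P0 => P P0.
have : P * (alpha * i) <= P * (e - 1) by rewrite ler_pM2l //; lra.
lra.
Qed.

Section Oscillating.
Variables (phi : nat -> R) (alpha C : R).
Hypotheses (a0 : 0 < alpha) (a1 : alpha < 1) (C0 : 0 <= C).

Definition mode (n : nat) x : R[i] := cis (phi n + n%:R * x).

Definition mode_series (N : nat) x : R[i] :=
  \sum_(n < N) (n.+1%:R^-1)%:C * mode n.+1 x.

Hypothesis hC : forall x (N : nat),
  normc (\sum_(n < N) mode n.+1 x) <= C * N%:R `^ (1 - alpha).

Let K := C * (2 + alpha^-1).
Let K0 : 0 <= K.
Proof. by move: (ltW a0) => a0'; rewrite mulr_ge0 // addr_ge0 // invr_ge0. Qed.

(** Abel summation: the partial sums [P] are O([n^(1 - alpha)]) and the weights [1 / n] have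
    differences O([n^-2]). The induction carries the two boundary terms along, and the remaining sum
    telescopes. *)
Lemma mode_series_tail (M N : nat) x : (0 < M <= N)%N ->
  normc (mode_series N x - mode_series M x) <= K * M%:R `^ (- alpha).
Proof.
move: (a0) (a1) (C0) => a0' a1' C0'.
move=> /andP[M0 MN].
pose P N := \sum_(n < N) mode n.+1 x.
have wP (n : nat) : (0 < n)%N -> normc ((n.+1%:R^-1)%:C * P n) <= C * n%:R `^ (- alpha).
  move=> n0; have n0' : 0 < n%:R :> R by rewrite ltr0n.
  rewrite Normc.normcM normc_real ger0_norm ?invr_ge0 //.
  apply: (@le_trans _ _ (n%:R^-1 * (C * n%:R `^ (1 - alpha)))).
    apply: ler_pM; [by rewrite invr_ge0|exact: normc_ge0| |exact: hC].
    by rewrite lef_pV2 ?posrE ?ltr0n // ler_nat.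
  rewrite powRD; last by rewrite (gt_eqF n0') implybT.
  by rewrite powRr1 ?(ltW n0') // mulrCA mulKf ?gt_eqF.
have h k : (M <= k)%N ->
    normc (mode_series k x - mode_series M x
      - ((k.+1%:R^-1)%:C * P k - (M.+1%:R^-1)%:C * P M))
    <= C * alpha^-1 * (M%:R `^ (- alpha) - k%:R `^ (- alpha)).
  elim: k => [|k ih].
    by rewrite leqNgt M0.
  rewrite leq_eqVlt => /predU1P[<-|].
    by rewrite !subrr Normc.normc0 mulr0.
  rewrite ltnS => Mk; have k0 : (0 < k)%N by apply: leq_trans Mk.
  have -> : mode_series k.+1 x - mode_series M x
      - ((k.+2%:R^-1)%:C * P k.+1 - (M.+1%:R^-1)%:C * P M) =
    (mode_series k x - mode_series M x - ((k.+1%:R^-1)%:C * P k - (M.+1%:R^-1)%:C * P M))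
    + ((k.+1%:R^-1) - (k.+2%:R^-1))%:C * P k.+1.
    by rewrite /mode_series /P !big_ord_recr /= rmorphB /=; ring.
  apply: (le_trans (le_normcD _ _)); rewrite Normc.normcM normc_real.
  have k1' : 0 < k.+1%:R :> R by rewrite ltr0n.
  have k2' : 0 < k.+2%:R :> R by rewrite ltr0n.
  have d : `|k.+1%:R^-1 - k.+2%:R^-1 : R| <= k.+1%:R ^- 2.
    have e : k.+1%:R^-1 - k.+2%:R^-1 = k.+1%:R^-1 * k.+2%:R^-1 :> R.
      have k12 : k.+2%:R = k.+1%:R + 1 :> R by rewrite -natr1.
      move: (k.+1%:R) (k.+2%:R) k1' k2' k12 => p q p0 q0 ->.
      by field; rewrite !gt_eqF //; lra.
    rewrite e ger0_norm; last by rewrite mulr_ge0 ?invr_ge0.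
    rewrite -exprVn expr2 ler_wpM2l ?invr_ge0 // lef_pV2 ?posrE //.
    by rewrite ler_nat.
  have s : `|k.+1%:R^-1 - k.+2%:R^-1 : R| * normc (P k.+1) <=
      C * k.+1%:R `^ (- alpha - 1).
    apply: (@le_trans _ _ (k.+1%:R ^- 2 * (C * k.+1%:R `^ (1 - alpha)))).
      by apply: ler_pM; [exact: normr_ge0|exact: normc_ge0|exact: d|exact: hC].
    rewrite mulrCA ler_wpM2l // -powR_invn ?(ltW k1') // -powRD; last by rewrite (gt_eqF k1') implybT.
    by rewrite le_eqVlt; apply/orP; left; apply/eqP; congr (_ `^ _); ring.
  have := powRN_telescope a0' k0; have := ih Mk => h1 h2.
  apply: (le_trans (lerD h1 s)).
  have : C * alpha^-1 * (alpha * k.+1%:R `^ (- alpha - 1)) <=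
     C * alpha^-1 * (k%:R `^ (- alpha) - k.+1%:R `^ (- alpha)).
    by rewrite ler_wpM2l // mulr_ge0 // invr_ge0 ltW.
  rewrite (_ : C * alpha^-1 * (alpha * _) = C * k.+1%:R `^ (- alpha - 1)); last first.
    by field; rewrite gt_eqF.
  move: (k.+1%:R `^ (- alpha - 1)) => q; lra.
have := h N MN; set T := mode_series N x - _.
have N0 : (0 < N)%N by exact: leq_trans MN.
have w1 := wP N N0; have w2 := wP M M0.
have NM : N%:R `^ (- alpha) <= M%:R `^ (- alpha) :> R.
  rewrite !powRN lef_pV2 ?posrE ?powR_gt0 ?ltr0n //.
  by apply: ge0_ler_powR; rewrite ?nnegrE ?ler_nat // ltW.
have Np : 0 <= C * alpha^-1 * N%:R `^ (- alpha).
  by rewrite mulr_ge0 ?powR_ge0 // mulr_ge0 // invr_ge0 ltW.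
have CN : C * N%:R `^ (- alpha) <= C * M%:R `^ (- alpha) by rewrite ler_wpM2l.
have := normc_addl_le T (- ((N.+1%:R^-1)%:C * P N - (M.+1%:R^-1)%:C * P M)).
rewrite normcN; have := normc_le_sub ((N.+1%:R^-1)%:C * P N) ((M.+1%:R^-1)%:C * P M).
rewrite /K; move: (alpha^-1) Np => ia Np; lra.
Qed.

(** Every [u M - e M] lies below every [u N + e N], so the supremum of the former is within [e M] of
    each [u M]: limit and rate are obtained together. *)
Lemma exists_limit_of_tail (u : nat -> R) (e : nat -> R) :
  (forall M N, (0 < M <= N)%N -> `|u N - u M| <= e M) ->
  exists l, forall M, (0 < M)%N -> `|l - u M| <= e M.
Proof.
move=> h; pose S := [set u M - e M | M in [set M | (0 < M)%N]].
have up M : (0 < M)%N -> ubound S (u M + e M).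
  move=> M0 _ [N /= N0 <-].
  have hM : 0 <= e M by apply: le_trans (h M M _); rewrite ?M0 ?leqnn.
  have hN : 0 <= e N by apply: le_trans (h N N _); rewrite ?N0 ?leqnn.
  case: (leqP M N) => MN.
    by have := h M N; rewrite M0 MN => /(_ isT); rewrite ler_norml => /andP[? ?]; lra.
  by have := h N M; rewrite N0 ltnW // => /(_ isT); rewrite ler_norml => /andP[? ?]; lra.
have S0 : S !=set0 by exists (u 1%N - e 1%N); exists 1%N.
have hs : has_sup S by split => //; exists (u 1%N + e 1%N); exact: up.
exists (sup S) => M M0; rewrite ler_norml; apply/andP; split.
  have : u M - e M <= sup S by apply: ub_le_sup; [exact: hs.2|exists M].
  lra.
have : sup S <= u M + e M by apply: ge_sup => //; exact: up.
lra.
Qed.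

Lemma exists_mode_limit : exists G : R -> R[i], forall x (M : nat), (0 < M)%N ->
  normc (G x - mode_series M x) <= 2 * K * M%:R `^ (- alpha).
Proof.
suff h x : exists z : R[i], forall M : nat, (0 < M)%N ->
    normc (z - mode_series M x) <= 2 * K * M%:R `^ (- alpha).
  by have [G hG] := choice h; exists G.
have hre M N : (0 < M <= N)%N ->
    `|complex.Re (mode_series N x) - complex.Re (mode_series M x)| <= K * M%:R `^ (- alpha).
  by move=> MN; rewrite -ReB (le_trans (Re_le_normc _)) // mode_series_tail.
have him M N : (0 < M <= N)%N ->
    `|complex.Im (mode_series N x) - complex.Im (mode_series M x)| <= K * M%:R `^ (- alpha).
  by move=> MN; rewrite -ImB (le_trans (Im_le_normc _)) // mode_series_tail.
have [a ha] := exists_limit_of_tail hre; have [b hb] := exists_limit_of_tail him.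
exists (Complex a b) => M M0; rewrite (le_trans (normc_le_ReIm _)) // ReB ImB /=.
by have := ha M M0; have := hb M M0; lra.
Qed.

Lemma is_derive_mode_Re (n : nat) x :
  is_derive x 1 (fun x => complex.Re (mode n x)) (- (n%:R * complex.Im (mode n x))).
Proof.
have dl : is_derive x 1 (fun x : R => phi n + n%:R * x) (0 + n%:R * 1).
  exact: is_deriveD1 (is_derive_cst1 _ _) (is_deriveZ1 _ (is_derive_id1 x)).
apply: is_derive_eq (is_derive_comp1 dl (is_derive_cos _)) _.
by rewrite /mode /=; ring.
Qed.

Lemma is_derive_mode_Im (n : nat) x :
  is_derive x 1 (fun x => complex.Im (mode n x)) (n%:R * complex.Re (mode n x)).
Proof.
have dl : is_derive x 1 (fun x : R => phi n + n%:R * x) (0 + n%:R * 1).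
  exact: is_deriveD1 (is_derive_cst1 _ _) (is_deriveZ1 _ (is_derive_id1 x)).
apply: is_derive_eq (is_derive_comp1 dl (is_derive_sin _)) _.
by rewrite /mode /=; ring.
Qed.

Lemma is_derive_mode_series (N : nat) x :
  is_derive x 1 (fun x => complex.Re (mode_series N x))
    (- complex.Im (\sum_(n < N) mode n.+1 x)) /\
  is_derive x 1 (fun x => complex.Im (mode_series N x))
    (complex.Re (\sum_(n < N) mode n.+1 x)).
Proof.
elim: N => [|N [ih1 ih2]].
  split; rewrite big_ord0 ?oppr0.
    rewrite (_ : (fun x => _) = (fun=> 0)); first exact: is_derive_cst1.
    by apply/funext => y; rewrite /mode_series big_ord0.
  rewrite (_ : (fun x => _) = (fun=> 0)); first exact: is_derive_cst1.
  by apply/funext => y; rewrite /mode_series big_ord0.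
have n0 : N.+1%:R != 0 :> R by rewrite pnatr_eq0.
split.
  rewrite (_ : (fun x => _) = (fun x => complex.Re (mode_series N x) +
      N.+1%:R^-1 * complex.Re (mode N.+1 x))); last first.
    by apply/funext => y; rewrite /mode_series big_ord_recr ReD ReM /= mul0r subr0.
  apply: is_derive_eq (is_deriveD1 ih1 (is_deriveZ1 _ (is_derive_mode_Re N.+1 x))) _.
  by rewrite big_ord_recr ImD /= opprD mulrN mulKf.
rewrite (_ : (fun x => _) = (fun x => complex.Im (mode_series N x) +
    N.+1%:R^-1 * complex.Im (mode N.+1 x))); last first.
  by apply/funext => y; rewrite /mode_series big_ord_recr ImD ImM /= mul0r addr0.
apply: is_derive_eq (is_deriveD1 ih2 (is_deriveZ1 _ (is_derive_mode_Im N.+1 x))) _.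
by rewrite big_ord_recr ReD /= mulKf.
Qed.

Lemma mode_series_lipschitz (N : nat) x y : x <= y ->
  normc (mode_series N y - mode_series N x) <= 2 * (C * N%:R `^ (1 - alpha)) * (y - x).
Proof.
move=> xy; rewrite (le_trans (normc_le_ReIm _)) // ReB ImB.
have h1 : `|complex.Re (mode_series N y) - complex.Re (mode_series N x)| <=
    C * N%:R `^ (1 - alpha) * (y - x).
  apply: (@mvt_norm R (fun x => complex.Re (mode_series N x))
    (fun z => - complex.Im (\sum_(n < N) mode n.+1 z))) => // [z _|z _].
    exact: (is_derive_mode_series N z).1.
  by rewrite normrN (le_trans (Im_le_normc _)).
have h2 : `|complex.Im (mode_series N y) - complex.Im (mode_series N x)| <=
    C * N%:R `^ (1 - alpha) * (y - x).
  apply: (@mvt_norm R (fun x => complex.Im (mode_series N x))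
    (fun z => complex.Re (\sum_(n < N) mode n.+1 z))) => // [z _|z _].
    exact: (is_derive_mode_series N z).2.
  by rewrite (le_trans (Re_le_normc _)).
lra.
Qed.

(** The series is cut at [M] about [1 / h] with [h = |y - x|]. The tails contribute [M^(- alpha)],
    and the partial sum, Lipschitz with constant O([M^(1 - alpha)]), contributes
    [h * M^(1 - alpha)]; both are O([h^alpha]). *)
Lemma mode_limit_hoelder (G : R -> R[i]) :
  (forall x (M : nat), (0 < M)%N ->
    normc (G x - mode_series M x) <= 2 * K * M%:R `^ (- alpha)) ->
  forall x y, `|y - x| <= 1 -> normc (G y - G x) <= (4 * K + 4 * C) * `|y - x| `^ alpha.
Proof.
move: (a0) (a1) (C0) (K0) => a0' a1' C0' K0' hG x y.
wlog xy : x y / x <= y.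
  move=> h; have [/h //|/ltW yx] := leP x y.
  by rewrite distrC normc_distC; exact: h.
rewrite ger0_norm ?subr_ge0 // => h1.
move: xy; rewrite -subr_ge0 le_eqVlt => /predU1P[|h0].
  move/eqP; rewrite eq_sym subr_eq0 => /eqP ->.
  rewrite subrr Normc.normc0 mulr_ge0 ?powR_ge0 // addr_ge0 // mulr_ge0 //.
set h := y - x in h0 h1 *.
have i0 : 0 <= h^-1 by rewrite invr_ge0 ltW.
pose M := nceil h^-1; have [hM1 hM2] := nceilP i0; rewrite -/M in hM1 hM2.
have ih1 : 1 <= h^-1 by rewrite invf_ge1.
have Mp : (0 < M)%N by rewrite -(ltr_nat R); lra.
have Mp' : 0 < M%:R :> R by rewrite ltr0n.
have b1 : M%:R `^ (- alpha) <= h `^ alpha.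
  have M1 : 1 <= h * M%:R.
    by have := ler_wpM2l (ltW h0) hM1; rewrite divff ?gt_eqF.
  rewrite powRN -[leLHS]mul1r ler_pdivrMr ?powR_gt0 // -powRM ?(ltW h0) //.
  have := @ge0_ler_powR R alpha (ltW a0') 1 (h * M%:R).
  by rewrite powR1; apply; rewrite ?nnegrE // (le_trans _ M1).
have b2 : h * M%:R `^ (1 - alpha) <= 2 * h `^ alpha.
  have M2 : h * M%:R <= 2.
    have := ler_wpM2l (ltW h0) (ltW hM2); rewrite mulrDr divff ?gt_eqF // mulr1; lra.
  have E : h = h `^ alpha * h `^ (1 - alpha).
    rewrite -powRD ?(gt_eqF h0) ?implybT // (_ : alpha + (1 - alpha) = 1); last by ring.
    by rewrite powRr1 // ltW.
  rewrite {1}E -mulrA -powRM ?(ltW h0) // mulrC ler_wpM2r ?powR_ge0 //.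
  apply: (@le_trans _ _ (2 `^ (1 - alpha))).
    apply: ge0_ler_powR; rewrite ?nnegrE ?mulr_ge0 ?(ltW h0) //; lra.
  by apply: ler1_powR; lra.
have g1 := hG x M Mp; have g2 := hG y M Mp.
have g3 := mode_series_lipschitz M (_ : x <= y); rewrite -subr_ge0 (ltW h0) in g3.
have {}g3 := g3 isT; rewrite -/h in g3.
have -> : G y - G x = (G y - mode_series M y) + (mode_series M y - mode_series M x)
    - (G x - mode_series M x) by ring.
apply: (le_trans (normc_le_sub _ _)).
apply: (le_trans (lerD (le_normcD _ _) (lexx _))).
have kb : K * M%:R `^ (- alpha) <= K * h `^ alpha by rewrite ler_wpM2l.
have cb : C * (h * M%:R `^ (1 - alpha)) <= C * (2 * h `^ alpha) by rewrite ler_wpM2l.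
apply: (le_trans (lerD (lerD g2 g3) g1)).
move: (M%:R `^ (- alpha)) (M%:R `^ (1 - alpha)) (h `^ alpha) kb cb => p q r kb cb; lra.
Qed.

End Oscillating.
End LacunaryFreeSeries.

(** * Partial sums of the evolution in terms of the basic series *)

Section Evolution.
Context {R : realType}.
Implicit Types (t x y alpha : R) (g u v : R -> R[i]).

Local Notation mu := (@lebesgue_measure R).
Local Notation omega := (@omega_gc R).

Lemma omega_gcN (n : int) : omega (- n) = omega n.
Proof.
rewrite /omega_gc /= mulrNz; set x : R := n%:~R; congr Num.sqrt.
rewrite /tanh opprK; move: (expR x) (expR (- x)) => a b.
rewrite [b + a]addrC; move: ((a + b)^-1) => c; ring.
Qed.

Lemma omega_gc0 : omega 0 = 0.
Proof. by rewrite /omega_gc /= expr0n /= addr0 mul0r sqrtr0. Qed.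

Lemma sum_symmetric (V : nmodType) (F : int -> V) (N : nat) :
  \sum_(0 <= k < N.*2.+1) F (k%:Z - N%:Z) =
  F 0 + \sum_(n < N) (F n.+1%:Z + F (- n.+1%:Z)).
Proof.
elim: N => [|N ih]; first by rewrite big_nat1 big_ord0 !addr0.
rewrite doubleS big_nat_recl // big_nat_recr //= big_ord_recr /= [RHS]addrA -ih.
rewrite [LHS]addrC -[LHS]addrA; congr (_ + (_ + _)).
- by apply: eq_bigr => k _; congr F; lia.
- by congr F; lia.
- by congr F; lia.
Qed.

Definition phases t (n : nat) : R := t * omega n%:Z.

(** As [omega] is even, frequencies [n] and [- n] share their phase, and the factors [1 / n] and
    [- 1 / n] give a difference of the same series at [x - y] and [y - x] for each jump [y]. *)
Lemma partial_sum_mode t g L (N : nat) x :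
  (forall n : int, n != 0 -> fourier_coef g n =
      (Complex 0 (2 * pi * n%:~R))^-1 * \sum_(p <- L) p.1 * cis (- (n%:~R * p.2))) ->
  evolution_partial_sum omega t g N x = fourier_coef g 0 +
  (Complex 0 (2 * pi))^-1 * \sum_(p <- L) p.1 *
    (mode_series (phases t) N (x - p.2) - mode_series (phases t) N (p.2 - x)).
Proof.
move=> hg; rewrite /evolution_partial_sum.
rewrite (sum_symmetric (fun n => fourier_coef g n * cis (t * omega n + n%:~R * x))).
rewrite omega_gc0 mulr0 mul0r addr0 cis0 mulr1; congr (_ + _).
rewrite (eq_bigr (fun n : 'I_N => \sum_(p <- L) (Complex 0 (2 * pi))^-1 * (p.1 *
   ((n.+1%:R^-1)%:C * mode (phases t) n.+1 (x - p.2)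
    - (n.+1%:R^-1)%:C * mode (phases t) n.+1 (p.2 - x))))).
  rewrite exchange_big /= mulr_sumr; apply: eq_bigr => p _.
  by rewrite -!mulr_sumr /mode_series sumrB.
move=> n _; rewrite !hg // omega_gcN.
have n0 : (n.+1%:R)%:C != 0 :> R[i] by rewrite eq_complex /= eqxx andbT pnatr_eq0.
have e1 : (Complex 0 (2 * pi * n.+1%:Z%:~R))^-1 = (Complex 0 (2 * pi))^-1 * (n.+1%:R^-1)%:C :> R[i].
  rewrite fmorphV -invfM; congr (_^-1); rewrite -pmulrn.
  by apply: complex_eq; rewrite ?ReM ?ImM /=; ring.
have e2 : (Complex 0 (2 * pi * (- n.+1%:Z)%:~R))^-1 = - ((Complex 0 (2 * pi))^-1 * (n.+1%:R^-1)%:C) :> R[i].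
  rewrite -e1 -invrN; congr (_^-1); rewrite mulrNz.
  by apply: complex_eq; rewrite /= ?oppr0 ?mulrN.
have s1 : (\sum_(p <- L) p.1 * cis (- (n.+1%:Z%:~R * p.2))) *
    cis (t * omega n.+1%:Z + n.+1%:Z%:~R * x) =
    \sum_(p <- L) p.1 * mode (phases t) n.+1 (x - p.2).
  rewrite mulr_suml; apply: eq_bigr => p _; rewrite -mulrA -cisD -pmulrn.
  by congr (_ * cis _); rewrite /phases; ring.
have s2 : (\sum_(p <- L) p.1 * cis (- ((- n.+1%:Z)%:~R * p.2))) *
    cis (t * omega n.+1%:Z + (- n.+1%:Z)%:~R * x) =
    \sum_(p <- L) p.1 * mode (phases t) n.+1 (p.2 - x).
  rewrite mulr_suml; apply: eq_bigr => p _; rewrite -mulrA -cisD mulrNz -pmulrn.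
  by congr (_ * cis _); rewrite /phases; ring.
rewrite e1 e2; move: s1 s2; move: (\sum_(p <- L) p.1 * cis (- (n.+1%:Z%:~R * p.2))) (cis _)
  (\sum_(p <- L) p.1 * cis (- ((- n.+1%:Z)%:~R * p.2))) (cis _) => A c1 B c2 s1 s2.
move: (Complex 0 (2 * pi))^-1 (n.+1%:R^-1)%:C => K w.
transitivity (K * w * (A * c2) - K * w * (B * c1)); first by ring.
rewrite s1 s2 !mulr_sumr -sumrB.
by apply: eq_bigr => p _; ring.
Qed.

End Evolution.

(** * The limit profile: uniform rate of convergence and Hoelder bound *)

Section Profile.
Context {R : realType}.
Implicit Types (t x y alpha : R) (g u v : R -> R[i]).

Local Notation mu := (@lebesgue_measure R).
Local Notation omega := (@omega_gc R).

Lemma mode_sum_bound t alpha : sum_bound t alpha -> 0 < alpha -> alpha < 1 ->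
  exists2 C : R, 0 <= C & forall x (N : nat),
    normc (\sum_(n < N) mode (phases t) n.+1 x) <= C * N%:R `^ (1 - alpha).
Proof.
move=> [C C0 hC] a0 a1; exists (2 * C + 1) => [|x N]; first by rewrite addr_ge0 ?mulr_ge0.
have [->|N0] := posnP N.
  by rewrite big_ord0 Normc.normc0 mulr_ge0 ?powR_ge0 ?addr_ge0 ?mulr_ge0.
have := hC x N.+1 isT; rewrite big_nat_recl //= big_mkord.
set S := \sum_(i < N) _; set c := cis _ => h.
have := normc_addl_le S c; rewrite normc_cis [S + c]addrC => h1.
have N1 : 1 <= N%:R :> R by rewrite ler1n.
have Y1 : 1 <= N%:R `^ (1 - alpha) :> R.
  by rewrite -[leLHS](powRr0 N%:R) ler_powR //; lra.
have Y2 : N.+1%:R `^ (1 - alpha) <= 2 * N%:R `^ (1 - alpha) :> R.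
  apply: (@le_trans _ _ ((2 * N%:R) `^ (1 - alpha))).
    by apply: ge0_ler_powR; rewrite ?nnegrE ?mulr_ge0 //; [lra|rewrite -natr1; lra].
  rewrite powRM // ler_wpM2r ?powR_ge0 //.
  by apply: ler1_powR; lra.
have Y3 : C * N.+1%:R `^ (1 - alpha) <= C * (2 * N%:R `^ (1 - alpha)) by rewrite ler_wpM2l.
by move: (N%:R `^ _) Y1 Y3 => Y Y1 Y3; lra.
Qed.

Lemma powRN_small alpha (e : R) : 0 < alpha -> 0 < e ->
  exists2 M, (0 < M)%N & forall N, (M <= N)%N -> N%:R `^ (- alpha) < e.
Proof.
move=> a0 e0; exists (nceil (e^-1 `^ alpha^-1)).+1 => // N hN.
have [h1 _] := nceilP (powR_ge0 e^-1 alpha^-1).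
have h2 : e^-1 `^ alpha^-1 < N%:R by apply: (le_lt_trans h1); rewrite ltr_nat.
have i0 : 0 < e^-1 by rewrite invr_gt0.
have N0 : 0 < N%:R :> R by apply: le_lt_trans h2; exact: powR_ge0.
rewrite powRN -[ltRHS]invrK ltf_pV2 ?posrE ?powR_gt0 //.
have := @gt0_ltr_powR R alpha a0 (e^-1 `^ alpha^-1) N%:R.
rewrite -powRrM mulVf ?gt_eqF // powRr1 ?(ltW i0) //; apply => //.
  by rewrite nnegrE powR_ge0.
by rewrite nnegrE.
Qed.

Lemma eq0_of_powRN alpha (c : R) (z : R[i]) : 0 < alpha -> 0 <= c ->
  (forall N : nat, (0 < N)%N -> normc z <= c * N%:R `^ (- alpha)) -> z = 0.
Proof.
move=> a0 c0 h; apply: Normc.eq0_normc; apply/eqP; rewrite eq_le normc_ge0 andbT.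
rewrite leNgt; apply/negP => z0.
have d0 : 0 < normc z / (c + 1) by rewrite divr_gt0 //; lra.
have [M M0 hM] := powRN_small a0 d0.
have := h M M0; have := hM M (leqnn M); rewrite ltr_pdivlMr; last by lra.
have P0 : 0 <= M%:R `^ (- alpha) :> R by exact: powR_ge0.
by move: (M%:R `^ _) P0 => P P0; lra.
Qed.

Lemma hoelder_continuous (f : R -> R) (K alpha : R) : 0 < alpha -> 0 <= K ->
  (forall x y, `|y - x| <= 1 -> `|f y - f x| <= K * `|y - x| `^ alpha) -> continuous f.
Proof.
move=> a0 K0 h x; apply/cvgrPdist_lt => e e0.
have K1 : 0 < K + 1 by lra.
have d0 : 0 < (e / (K + 1)) `^ alpha^-1 by rewrite powR_gt0 // divr_gt0.
apply/nbhs_normP; exists (Num.min 1 ((e / (K + 1)) `^ alpha^-1)); first by rewrite /= lt_min ltr01.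
move=> y /=; rewrite lt_min => /andP[yx1 yx]; rewrite distrC in yx; rewrite distrC in yx1.
have {}yx1 := ltW yx1.
rewrite distrC (le_lt_trans (h x y yx1)) //.
have := @gt0_ltr_powR R alpha a0 `|y - x| ((e / (K + 1)) `^ alpha^-1).
rewrite -powRrM mulVf ?gt_eqF // powRr1 ?divr_ge0 ?(ltW e0) ?(ltW K1) //.
rewrite ltr_pdivlMr // => h1.
have {}h1 : `|y - x| `^ alpha * (K + 1) < e by apply: h1; rewrite ?nnegrE ?powR_ge0.
by have := powR_ge0 `|y - x| alpha; move: (_ `^ alpha) h1 => P; lra.
Qed.

Lemma exists_profile t alpha g L : 0 < alpha -> alpha < 1 -> sum_bound t alpha ->
  (forall n : int, n != 0 -> fourier_coef g n =
      (Complex 0 (2 * pi * n%:~R))^-1 * \sum_(p <- L) p.1 * cis (- (n%:~R * p.2))) ->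
  exists u (K : R), [/\ 0 <= K,
    forall x (N : nat), (0 < N)%N ->
      normc (u x - evolution_partial_sum omega t g N x) <= K * N%:R `^ (- alpha) &
    forall x y, `|y - x| <= 1 -> normc (u y - u x) <= K * `|y - x| `^ alpha].
Proof.
move=> a0 a1 sb hg; have [C C0 hC] := mode_sum_bound sb a0 a1.
have [G hG] := exists_mode_limit a0 a1 C0 hC.
have hH := mode_limit_hoelder a0 a1 C0 hC hG.
set K1 : R := C * (2 + alpha^-1) in hG hH.
have K10 : 0 <= K1 by rewrite mulr_ge0 // addr_ge0 // invr_ge0 ltW.
pose c : R[i] := (Complex 0 (2 * pi))^-1.
pose W := \sum_(p <- L) normc p.1.
have W0 : 0 <= W by apply: sumr_ge0 => p _; exact: normc_ge0.
have c0 : 0 <= normc c by exact: normc_ge0.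
have key (F : R[i] * R -> R[i]) (B : R) : (forall p, normc (F p) <= B) ->
    normc (c * \sum_(p <- L) p.1 * F p) <= normc c * W * B.
  move=> hF; rewrite Normc.normcM -mulrA ler_wpM2l // (le_trans (normc_sum _ _ _)) //.
  rewrite mulr_suml; apply: ler_sum => p _.
  by rewrite Normc.normcM ler_wpM2l // normc_ge0.
have cW : 0 <= normc c * W by rewrite mulr_ge0.
exists (fun x => fourier_coef g 0 + c * \sum_(p <- L) p.1 * (G (x - p.2) - G (p.2 - x))).
exists (normc c * W * (8 * K1 + 8 * C)); split.
- by rewrite mulr_ge0 // addr_ge0 // mulr_ge0.
- move=> x N N0; rewrite (partial_sum_mode _ _ _ hg) -/c opprD addrACA subrr add0r.
  rewrite -mulrBr -sumrB.
  rewrite (eq_bigr (fun p => p.1 * ((G (x - p.2) - mode_series (phases t) N (x - p.2))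
     - (G (p.2 - x) - mode_series (phases t) N (p.2 - x))))); last by move=> p _; ring.
  apply: (le_trans (key _ (4 * K1 * N%:R `^ (- alpha)) _)) => [p|].
    rewrite (le_trans (normc_le_sub _ _)) //.
    by have := hG (x - p.2) N N0; have := hG (p.2 - x) N N0; lra.
  rewrite -[leRHS]mulrA ler_wpM2l // ler_wpM2r ?powR_ge0 //; lra.
- move=> x y xy; rewrite opprD addrACA subrr add0r -mulrBr -sumrB.
  rewrite (eq_bigr (fun p => p.1 * ((G (y - p.2) - G (x - p.2))
     - (G (p.2 - y) - G (p.2 - x))))); last by move=> p _; ring.
  rewrite -[leRHS]mulrA; apply: key => p.
  have e1 : `|(y - p.2) - (x - p.2)| = `|y - x| by congr `|_|; ring.
  have e2 : `|(p.2 - y) - (p.2 - x)| = `|y - x| by rewrite -normrN; congr `|_|; ring.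
  have := hH (x - p.2) (y - p.2); have := hH (p.2 - x) (p.2 - y).
  rewrite e1 e2 => /(_ xy) h1 /(_ xy) h2.
  by rewrite (le_trans (normc_le_sub _ _)) //; lra.
Qed.

End Profile.

(** * The profile is a continuous representative *)

Section ContinuousRepresentative.
Context {R : realType}.
Implicit Types (t x y alpha : R) (g u v f : R -> R[i]).

Local Notation mu := (@lebesgue_measure R).
Local Notation omega := (@omega_gc R).

Definition cts f := continuous (fun x => complex.Re (f x)) /\ continuous (fun x => complex.Im (f x)).

Lemma ctsB f g : cts f -> cts g -> cts (fun x => f x - g x).
Proof.
move=> [f1 f2] [g1 g2]; split => x.
  rewrite (_ : (fun x => _) = (fun x => complex.Re (f x) - complex.Re (g x))).
    by apply: cvgB; [exact: f1|exact: g1].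
  by apply/funext => y; rewrite ReB.
rewrite (_ : (fun x => _) = (fun x => complex.Im (f x) - complex.Im (g x))).
  by apply: cvgB; [exact: f2|exact: g2].
by apply/funext => y; rewrite ImB.
Qed.

Lemma cts_normc_sqr f : cts f -> continuous (fun x => normc (f x) ^+ 2).
Proof.
move=> [f1 f2] x; rewrite (_ : (fun x => _) =
  (fun x => complex.Re (f x) * complex.Re (f x) + complex.Im (f x) * complex.Im (f x))).
  apply: cvgD; apply: cvgM; by [exact: f1|exact: f2].
by apply/funext => y; rewrite normc_sqr !expr2.
Qed.

Lemma is_derive_continuous (f df : R -> R) : (forall x, is_derive x 1 f (df x)) -> continuous f.
Proof.
move=> h x; apply: differentiable_continuous; apply/derivable1_diffP.
by have [] := h x.
Qed.

Lemma cts_partial_sum t g (N : nat) : cts (evolution_partial_sum omega t g N).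
Proof.
rewrite /evolution_partial_sum; move: N.*2.+1 => m.
have dl a (b x : R) : is_derive x 1 (fun x : R => a + b * x) (0 + b * 1).
  exact: is_deriveD1 (is_derive_cst1 _ _) (is_deriveZ1 _ (is_derive_id1 x)).
have c1 a (b : R) : continuous (fun x : R => cos (a + b * x)).
  apply: is_derive_continuous => x; exact: is_derive_comp1 (dl a b x) (is_derive_cos _).
have c2 a (b : R) : continuous (fun x : R => sin (a + b * x)).
  apply: is_derive_continuous => x; exact: is_derive_comp1 (dl a b x) (is_derive_sin _).
elim: m => [|m [ih1 ih2]].
  split => x.
    rewrite (_ : (fun x => _) = (fun=> 0)); first exact: cst_continuous.
    by apply/funext => y; rewrite big_geq.
  rewrite (_ : (fun x => _) = (fun=> 0)); first exact: cst_continuous.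
  by apply/funext => y; rewrite big_geq.
set n := m%:Z - N%:Z; set a := complex.Re (fourier_coef g n).
set b := complex.Im (fourier_coef g n).
split => x.
  rewrite (_ : (fun x => _) = (fun x => complex.Re (\sum_(0 <= k < m) fourier_coef g (k%:Z - N%:Z) *
     cis (t * omega (k%:Z - N%:Z) + (k%:Z - N%:Z)%:~R * x)) +
     (a * cos (t * omega n + n%:~R * x) - b * sin (t * omega n + n%:~R * x)))).
    apply: cvgD; first exact: ih1.
    apply: cvgB; apply: cvgM; try exact: cst_continuous.
      exact: c1.
    exact: c2.
  by apply/funext => y; rewrite big_nat_recr //= ReD ReM.
rewrite (_ : (fun x => _) = (fun x => complex.Im (\sum_(0 <= k < m) fourier_coef g (k%:Z - N%:Z) *
   cis (t * omega (k%:Z - N%:Z) + (k%:Z - N%:Z)%:~R * x)) +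
   (a * sin (t * omega n + n%:~R * x) + b * cos (t * omega n + n%:~R * x)))).
  apply: cvgD; first exact: ih2.
  apply: cvgD; apply: cvgM; try exact: cst_continuous.
    exact: c2.
  exact: c1.
by apply/funext => y; rewrite big_nat_recr //= ImD ImM.
Qed.

Lemma partial_sum_periodic t g (N : nat) x :
  evolution_partial_sum omega t g N (x + 2 * pi) = evolution_partial_sum omega t g N x.
Proof.
apply: eq_bigr => k _ /=; congr (_ * _).
by rewrite mulrDr addrA [_%:~R * (2 * pi)]mulrC cis_per.
Qed.

Lemma measurable_cont_sqr f (a b : R) : cts f ->
  measurable_fun `[a, b]%classic (fun x => (normc (f x) ^+ 2)%:E : \bar R).
Proof.
move=> cf; apply/measurable_EFinP; apply: measurable_funTS.
by apply: continuous_measurable_fun; exact: cts_normc_sqr.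
Qed.

Section Representative.
Variables (t alpha K : R) (g u : R -> R[i]).
Hypotheses (a0 : 0 < alpha) (K0 : 0 <= K).
Hypothesis hu : forall x (N : nat), (0 < N)%N ->
  normc (u x - evolution_partial_sum omega t g N x) <= K * N%:R `^ (- alpha).
Hypothesis hH : forall x y, `|y - x| <= 1 -> normc (u y - u x) <= K * `|y - x| `^ alpha.

Lemma profile_cts : cts u.
Proof.
split.
  apply: (hoelder_continuous a0 K0) => x y xy; rewrite -ReB.
  by rewrite (le_trans (Re_le_normc _)) // hH.
apply: (hoelder_continuous a0 K0) => x y xy; rewrite -ImB.
by rewrite (le_trans (Im_le_normc _)) // hH.
Qed.

Lemma profile_periodic : periodic_2pi u.
Proof.
move=> x; apply/eqP; rewrite -subr_eq0; apply/eqP.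
apply: (@eq0_of_powRN R alpha (K + K)) => [//||N N0]; first by move: K0; lra.
have h1 := hu (x + 2 * pi) N0; rewrite partial_sum_periodic in h1; have h2 := hu x N0.
set s := evolution_partial_sum _ _ _ _ _ in h1 h2.
have -> : u (x + 2 * pi) - u x = (u (x + 2 * pi) - s) - (u x - s) by ring.
by apply: (le_trans (normc_le_sub _ _)); apply: (le_trans (lerD h1 h2)); rewrite -mulrDl.
Qed.

Lemma profile_representative : continuous_representative omega t g u.
Proof.
have [c1 c2] := profile_cts; split => //; first exact: profile_periodic.
have p0 : 0 < 2 * pi :> R by rewrite mulr_gt0 // pi_gt0.
pose b (N : nat) : R := (K * N%:R `^ (- alpha)) ^+ 2 * (2 * pi).
apply: (@squeeze_cvge _ _ _ _ (fun=> 0%E) _ (fun N => (b N)%:E)).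
- exists 1%N => // N /= N0; apply/andP; split.
    by apply: integral_ge0 => x _; rewrite lee_fin sqr_ge0.
  rewrite [leRHS](_ : _ = (\int[mu]_(x in `[0%R, (2 * pi)%R]) ((K * N%:R `^ (- alpha)) ^+ 2)%R%:E)%E).
    apply: ge0_le_integral => //.
    + by move=> x _; rewrite lee_fin sqr_ge0.
    + by apply: measurable_cont_sqr; apply: ctsB; [exact: profile_cts|exact: cts_partial_sum].
    + by move=> x _; rewrite lee_fin ler_pXn2r ?nnegrE ?normc_ge0 ?mulr_ge0 ?powR_ge0 // hu.
  by rewrite integral_cst //= lebesgue_measure_itv /= lte_fin p0 sube0 -EFinM.
- exact: cvg_cst.
- apply: cvg_EFin; first by near=> N.
  apply/cvgrPdist_lt => e e0.
  pose d := Num.sqrt (e / (2 * pi)) / (K + 1).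
  have K1 : 0 < K + 1 by move: K0; lra.
  have d0 : 0 < d by rewrite divr_gt0 // sqrtr_gt0 divr_gt0.
  have [M M0 hM] := powRN_small a0 d0.
  exists M => // N /= MN; rewrite sub0r normrN /b.
  have h1 := hM N MN; have P0 : 0 <= N%:R `^ (- alpha) :> R by exact: powR_ge0.
  rewrite ltr_pdivlMr // in h1.
  have h2 : K * N%:R `^ (- alpha) < Num.sqrt (e / (2 * pi)) by move: (N%:R `^ _) P0 h1 => P P0 h1; lra.
  have h3 : 0 <= K * N%:R `^ (- alpha) by rewrite mulr_ge0.
  rewrite ger0_norm; last by rewrite mulr_ge0 ?sqr_ge0 // ltW.
  rewrite -ltr_pdivlMr // -[ltRHS]sqr_sqrtr ?divr_ge0 ?(ltW e0) ?(ltW p0) //.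
  by rewrite ltr_pXn2r ?nnegrE // sqrtr_ge0.
Unshelve. all: by end_near. Qed.

End Representative.
End ContinuousRepresentative.

(** * Uniqueness of the continuous representative *)

Section Uniqueness.
Context {R : realType}.
Implicit Types (t x y : R) (g u v : R -> R[i]).

Local Notation mu := (@lebesgue_measure R).
Local Notation omega := (@omega_gc R).

(** If [u] and [v] differed at [x], they would differ by a fixed amount on a segment of positive
    length, and the partial sums could not be close to both in the mean square. *)
Lemma representative_eq_on t g u v x :
  continuous_representative omega t g u -> continuous_representative omega t g v ->
  0 <= x <= 2 * pi -> u x = v x.
Proof.
move=> [_ u1 u2 uI] [_ v1 v2 vI] /andP[x0 x1].
have p0 : 0 < 2 * pi :> R by rewrite mulr_gt0 // pi_gt0.
have cu : cts u by split.
have cv : cts v by split.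
apply/eqP; rewrite -subr_eq0; apply/eqP/Normc.eq0_normc/eqP/negPn/negP => nz.
have d0 : 0 < normc (u x - v x) ^+ 2 by rewrite exprn_gt0 // lt_neqAle eq_sym nz normc_ge0.
pose d := normc (u x - v x) ^+ 2 / 2.
have dd0 : 0 < d by rewrite divr_gt0.
have /cvgrPdist_lt /(_ d dd0) /nbhs_normP[r /= r0 hr] := cts_normc_sqr (ctsB cu cv) (x := x).
(* The neighbourhood of [x] is clipped to the period; it keeps positive length even if [x] is an end
   point. *)
pose a := Num.max 0 (x - r / 2); pose b := Num.min (2 * pi) (x + r / 2).
have ab : a < b.
  rewrite /a /b lt_min !gt_max p0 /=.
  by apply/and3P; split; move: r0 x0 x1 p0 => /=; move: (2 * pi : R) => p; lra.
have a0 : 0 <= a by rewrite /a le_max lexx.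
have bp : b <= 2 * pi by rewrite /b ge_min lexx.
have hd y : a <= y <= b -> d <= normc (u y - v y) ^+ 2.
  rewrite /a /b le_min ge_max => /andP[/andP[_ y1] /andP[_ y2]].
  have yr : `|x - y| < r by rewrite ltr_norml; apply/andP; split; lra.
  have /= := hr y yr; rewrite ltr_norml => /andP[_].
  by rewrite /d; lra.
pose A (N : nat) (y : R) : R := normc (u y - evolution_partial_sum omega t g N y) ^+ 2.
pose B (N : nat) (y : R) : R := normc (v y - evolution_partial_sum omega t g N y) ^+ 2.
have A0 N y : 0 <= A N y by exact: sqr_ge0.
have B0 N y : 0 <= B N y by exact: sqr_ge0.
have hAB N y : a <= y <= b -> d / 2 <= A N y + B N y.
  move=> /hd h; have := normc_le_sub (u y - evolution_partial_sum omega t g N y)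
     (v y - evolution_partial_sum omega t g N y).
  rewrite opprB addrA subrK => h1.
  have q (p q s : R) : 0 <= s -> s <= p + q -> s ^+ 2 / 2 <= p ^+ 2 + q ^+ 2.
    move=> s0 spq; have : s ^+ 2 <= (p + q) ^+ 2 by rewrite ler_pXn2r ?nnegrE // (le_trans s0).
    by have := sqr_ge0 (p - q); rewrite !expr2; lra.
  have := q _ _ _ (normc_ge0 _) h1; rewrite /A /B.
  by move: h; move: (normc _ ^+ 2) => s; lra.
have mA (N : nat) (c e : R) : measurable_fun `[c, e]%classic (fun y => (A N y)%:E : \bar R).
  by apply: measurable_cont_sqr; apply: ctsB => //; exact: cts_partial_sum.
have mB (N : nat) (c e : R) : measurable_fun `[c, e]%classic (fun y => (B N y)%:E : \bar R).
  by apply: measurable_cont_sqr; apply: ctsB => //; exact: cts_partial_sum.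
pose c := d / 2 * (b - a).
have c0 : 0 < c by rewrite mulr_gt0 ?divr_gt0 // subr_gt0.
have lower N : (c%:E <= \int[mu]_(y in `[0%R, (2 * pi)%R]) (A N y)%:E +
     \int[mu]_(y in `[0%R, (2 * pi)%R]) (B N y)%:E)%E.
  rewrite -(@ge0_integralD _ _ _ mu `[0%R, 2 * pi]%classic (measurable_itv _)) //;
    try (by move=> y _; rewrite lee_fin); try exact: mA; try exact: mB.
  have sub : `[a, b]%classic `<=` `[0%R, 2 * pi]%classic.
    by move=> y /=; rewrite !in_itv /= => /andP[y1 y2]; rewrite (le_trans a0 y1) (le_trans y2 bp).
  apply: (@le_trans _ _ (\int[mu]_(y in `[a, b]) ((A N y)%:E + (B N y)%:E))%E); last first.
    apply: ge0_subset_integral => //.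
      by apply: emeasurable_funD; [exact: mA|exact: mB].
    by move=> y _; rewrite -EFinD lee_fin addr_ge0.
  apply: (@le_trans _ _ (\int[mu]_(y in `[a, b]) (d / 2)%:E)%E).
    by rewrite integral_cst //= lebesgue_measure_itv /= lte_fin ab -EFinB -EFinM.
  apply: ge0_le_integral => //.
  - by move=> y _; rewrite lee_fin divr_ge0 // ltW.
  - by apply: emeasurable_funD; [exact: mA|exact: mB].
  - by move=> y /=; rewrite in_itv /= => yab; rewrite -EFinD lee_fin hAB.
have h0 : (0 < (c / 2)%:E)%E by rewrite lte_fin divr_gt0.
have := uI _ (open_ereal_lt' h0); have := vI _ (open_ereal_lt' h0).
move=> [N1 _ hN1] [N2 _ hN2].
have := lower (maxn N1 N2).
have := hN1 (maxn N1 N2) (leq_maxl _ _).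
have := hN2 (maxn N1 N2) (leq_maxr _ _).
rewrite /= => h1 h2; apply/negP; rewrite -ltNge.
by rewrite (splitr c) EFinD lteD.
Qed.

Lemma periodic_int (V : Type) (f : R -> V) (k : int) x :
  periodic_2pi f -> f (x + (2 * pi) * k%:~R) = f x.
Proof.
move=> hf; have nat_case (n : nat) z : f (z + 2 * pi * n%:R) = f z.
  elim: n => [|n ih]; first by rewrite mulr0 addr0.
  by rewrite -[n.+1%:R]natr1 [_ * (_ + 1)]mulrDr mulr1 addrA hf.
case: k => n; first exact: nat_case.
have := nat_case n.+1 (x - 2 * pi * n.+1%:R).
by rewrite subrK NegzE mulrNz mulrN.
Qed.

(** [evolution] selects some representative; uniqueness on one period together with periodicity
    identifies it with [u]. *)
Lemma evolution_eq t g u :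
  continuous_representative omega t g u -> evolution omega t g = u.
Proof.
move=> hu; rewrite /evolution.
have := @xgetPex _ (fun=> 0) [set u | continuous_representative omega t g u] (ex_intro _ u hu).
set v := xget _ _ => /= hv; apply/funext => x.
have [pu _ _ _] := hu; have [pv _ _ _] := hv.
have p0 : 0 < 2 * pi :> R by rewrite mulr_gt0 // pi_gt0.
pose k := - Num.floor (x / (2 * pi)).
rewrite -(periodic_int k x pu) -(periodic_int k x pv).
apply: (representative_eq_on hv hu); rewrite /k mulrNz mulrN.
have := floor_itv (x / (2 * pi)) => /andP[].
move: (Num.floor _) => m; move: (2 * pi : R) p0 => p p0.
rewrite ler_pdivlMr // ltr_pdivrMr // intrD mulrDl mul1r => h1 h2.
by apply/andP; split; rewrite mulrC in h1 h2 *; lra.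
Qed.

End Uniqueness.

(** * Covering numbers, and the upper bound for Hoelder graphs *)

Section FractalDimension.
Context {R : realType}.
Implicit Types (E : set (R * R)) (f : R -> R) (d eps alpha K : R).

Lemma fractal_dim_le E d (C : R) : 0 <= d -> 1 <= C ->
  (forall eps, 0 < eps -> eps < 1 -> covering_number E eps <= C * eps `^ (- d)) ->
  (fractal_dim E <= d%:E)%E.
Proof.
move=> d0 C1 h; apply/lee_addgt0Pr => e e0; apply: ge_ereal_inf.
have lC : 0 <= ln C by exact: ln_ge0.
(* Below this scale [ln C + 1 < e * ln (1 / eps)], so the constant [C] is absorbed by [e]. *)
have r0 : 0 < expR (- ((ln C + 1) / e)) by exact: expR_gt0.
have r1 : expR (- ((ln C + 1) / e)) < 1.
  by rewrite expR_lt1 oppr_lt0 divr_gt0 // ltr_wpDl.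
set r := expR _ in r0 r1.
eexists.
  exists [set x | 0 < x < r]; last by reflexivity.
  exists r => //= x /=; rewrite sub0r normrN => xr x0.
  by rewrite x0 -(gtr0_norm x0).
apply: ge_ereal_sup => _ [x /= /andP[x0 xr] <-]; rewrite lee_fin.
have lx : (ln C + 1) / e < ln x^-1.
  rewrite lnV ?posrE // ltrNr -(expRK (- _)) ltr_ln ?posrE //.
have l0 : 0 < ln x^-1 by apply: lt_trans lx; rewrite divr_gt0 // ltr_wpDl.
rewrite ler_pdivrMr //; rewrite ltr_pdivrMr // in lx.
have P0 : 0 < x `^ (- d) by rewrite powR_gt0.
have lY : ln (C * x `^ (- d)) = ln C + d * ln x^-1.
  by rewrite lnM ?posrE // ?(lt_le_trans ltr01) // ln_powR lnV ?posrE // mulNr mulrN.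
have Y1 : 0 <= ln (C * x `^ (- d)) by rewrite lY addr_ge0 // mulr_ge0 // ltW.
suff : ln (covering_number E x) <= ln (C * x `^ (- d)) by rewrite lY; lra.
have [c0|c0] := leP (covering_number E x) 0; first by rewrite ln0.
have hx := h x x0 (lt_trans xr r1).
by rewrite ler_ln ?posrE // mulr_gt0 // (lt_le_trans ltr01).
Qed.

(** An upper dimension below [d] bounds the covering numbers at all small scales, so the scale may
    be chosen freely in the lower bound. *)
Lemma fractal_dim_lt E d : (fractal_dim E < d%:E)%E ->
  exists2 r, 0 < r & forall eps, 0 < eps -> eps < r -> covering_number E eps <= eps `^ (- d).
Proof.
move=> /ereal_inf_lt[_ [V /= /nbhs_normP[r /= r0 hr] <-] hV].
exists (Num.min r 1) => [|e e0]; first by rewrite lt_min r0 ltr01.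
rewrite lt_min => /andP[er e1].
have Ve : V e by apply: (hr e) => //=; rewrite sub0r normrN gtr0_norm.
have l0 : 0 < ln e^-1 by rewrite ln_gt0 // invf_gt1.
have : ((ln (covering_number E e) / ln e^-1)%:E < d%:E)%E.
  by apply: le_lt_trans hV; apply: ereal_sup_ubound; exists e.
rewrite lte_fin ltr_pdivrMr // => h.
have [c0|c0] := leP (covering_number E e) 0; first by rewrite (le_trans c0) // powR_ge0.
rewrite -ler_ln ?posrE ?powR_gt0 // ln_powR.
by rewrite lnV ?posrE // in h; rewrite mulNr -mulrN ltW.
Qed.

Lemma covering_number_le E eps (n : nat) (c : 'I_n -> R * R) :
  E `<=` \bigcup_j disc (c j) eps -> covering_number E eps <= n%:R.
Proof.
move=> h; apply: ge_inf; last by exists n => //; exists c.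
by exists 0 => _ [m _ <-].
Qed.

Lemma exists_cover E eps : (exists (n : nat) (c : 'I_n -> R * R), E `<=` \bigcup_j disc (c j) eps) ->
  exists (n : nat) (c : 'I_n -> R * R),
    E `<=` \bigcup_j disc (c j) eps /\ n%:R <= covering_number E eps + 1.
Proof.
move=> [n [c h]].
have := @inf_adherent R [set n%:R | n in [set n : nat | exists c : 'I_n -> R * R,
                          E `<=` \bigcup_j disc (c j) eps]] 1 ltr01.
case.
  split; first by exists n%:R, n => //; exists c.
  by exists 0 => _ [m _ <-].
move=> _ [m [c' h'] <-] hm; exists m, c'; split => //; exact: ltW.
Qed.

(** About [1 / eps] columns of width [eps / 2] are each filled with O([1 + K eps^(alpha - 1)])
    discs; [eps <= eps^alpha] absorbs the rounding. A point is less than [eps / 2] away from a grid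
    point in each coordinate, hence within [eps]. *)
Lemma hoelder_graph_cover f K alpha eps : 0 <= K -> 0 <= alpha -> alpha <= 1 ->
  (forall x y, `|y - x| <= 1 -> `|f y - f x| <= K * `|y - x| `^ alpha) ->
  0 < eps -> eps < 1 ->
  exists (n : nat) (c : 'I_n -> R * R), torus_graph f `<=` \bigcup_j disc (c j) eps /\
    n%:R <= (2 * (2 * pi) + 1) * (4 * K + 1) * eps `^ (- (2 - alpha)).
Proof.
move=> K0 a0 a1 hf e0 e1; pose h := eps / 2.
have h0 : 0 < h by rewrite divr_gt0.
have eh : eps = 2 * h by rewrite /h mulrC divfK.
have p0 : 0 <= 2 * pi :> R by rewrite mulr_ge0 // pi_ge0.
pose Y := eps `^ alpha; have Y0 : 0 < Y by rewrite powR_gt0.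
have Ye : eps <= Y.
  rewrite -[leLHS](powRr1 (ltW e0)); apply: ger_powR => //; by rewrite e0 ltW.
pose A := (Num.truncn ((2 * pi) / h)).+1; pose B := (Num.truncn (2 * K * Y / h)).+1.
(* The index [k] encodes the column as [k] divided by [B] and the height as the remainder. *)
pose c (k : 'I_(A * B)) : R * R :=
  ((k %/ B)%:R * h, f ((k %/ B)%:R * h) - K * Y + (k %% B)%:R * h).
exists (A * B)%N, c; split.
  move=> _ [x /= + <-]; rewrite in_itv /= => /andP[x0 x1].
  pose i := Num.truncn (x / h).
  have /andP[i1 i2] := truncn_itv (divr_ge0 x0 (ltW h0)); rewrite -/i in i1 i2.
  have iA : (i < A)%N by rewrite ltnS le_truncn // ler_pM2r ?invr_gt0.
  rewrite ler_pdivlMr // in i1; rewrite ltr_pdivrMr // -natr1 mulrDl mul1r in i2.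
  have dx : `|x - i%:R * h| <= eps by rewrite ger0_norm; lra.
  have := hf (i%:R * h) x (le_trans dx (ltW e1)).
  move=> /le_trans /(_ (_ : _ <= K * Y)) fx.
  have {}fx : `|f x - f (i%:R * h)| <= K * Y.
    by apply: fx; rewrite ler_wpM2l // ge0_ler_powR ?nnegrE // ltW.
  move: fx; rewrite ler_norml => /andP[f1 f2].
  pose z := f x - f (i%:R * h) + K * Y.
  have z0 : 0 <= z by rewrite /z; lra.
  pose j := Num.truncn (z / h).
  have /andP[j1 j2] := truncn_itv (divr_ge0 z0 (ltW h0)); rewrite -/j in j1 j2.
  have jB : (j < B)%N by rewrite ltnS le_truncn // ler_pM2r ?invr_gt0 // /z; lra.
  rewrite ler_pdivlMr // in j1; rewrite ltr_pdivrMr // -natr1 mulrDl mul1r in j2.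
  have kAB : (i * B + j < A * B)%N.
    by apply: (@leq_trans (i.+1 * B)%N); [rewrite mulSn addnC ltn_add2r|rewrite leq_mul2r iA orbT].
  exists (Ordinal kAB) => //; rewrite /disc /c /= divnMDl // modnMDl divn_small // addn0.
  rewrite modn_small //.
  rewrite -[ltRHS]gtr0_norm // -sqrtr_sqr ltr_sqrt ?exprn_gt0 //.
  set d1 := x - _; set d2 := f x - _.
  have d11 : 0 <= d1 < h by rewrite /d1; apply/andP; split; lra.
  have d22 : 0 <= d2 < h by move: j1 j2; rewrite /d2 /z => j1 j2; apply/andP; split; lra.
  move: d11 d22 => /andP[? ?] /andP[? ?]; rewrite eh !expr2; nra.
have YE : eps `^ (- (2 - alpha)) = Y / eps * eps^-1.
  rewrite -mulrA -invfM -expr2 -(powR_mulrn _ (ltW e0)) -powRN -powRD; first by congr (_ `^ _); lra.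
  by rewrite (gt_eqF e0) implybT.
have i0 : 0 < eps^-1 by rewrite invr_gt0.
have i1 : 1 <= eps^-1 by rewrite invf_ge1 // ltW.
have y1 : 1 <= Y / eps by rewrite ler_pdivlMr // mul1r.
have hi : h^-1 = 2 * eps^-1 by rewrite /h invf_div.
have A1 : A%:R <= (2 * (2 * pi) + 1) * eps^-1 :> R.
  have /andP[q _] := truncn_itv (divr_ge0 p0 (ltW h0)).
  rewrite /A -natr1; apply: (le_trans (lerD q (lexx 1))); rewrite hi.
  by move: (2 * pi : R) => p; lra.
have KY : 0 <= 2 * K * Y by rewrite !mulr_ge0 // ltW.
have B1 : B%:R <= (4 * K + 1) * (Y / eps) :> R.
  have /andP[q _] := truncn_itv (divr_ge0 KY (ltW h0)).
  rewrite /B -natr1; apply: (le_trans (lerD q (lexx 1))); rewrite hi.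
  by move: y1; move: (eps^-1) => e; lra.
rewrite natrM YE.
apply: le_trans (ler_pM _ _ A1 B1) _ => //.
by rewrite mulrACA [eps^-1 * _]mulrC.
Qed.

Lemma fractal_dim_hoelder f K alpha : 0 <= K -> 0 <= alpha -> alpha <= 1 ->
  (forall x y, `|y - x| <= 1 -> `|f y - f x| <= K * `|y - x| `^ alpha) ->
  (fractal_dim (torus_graph f) <= (2 - alpha)%:E)%E.
Proof.
move=> K0 a0 a1 hf; have p0 : 0 <= 2 * pi :> R by rewrite mulr_ge0 // pi_ge0.
apply: (@fractal_dim_le _ _ ((2 * (2 * pi) + 1) * (4 * K + 1))).
- lra.
- rewrite -[leLHS]mulr1; apply: ler_pM => //; last by lra.
  by move: (2 * pi : R) p0 => p p0; lra.
- move=> eps e0 e1; have [n [c [hc hn]]] := hoelder_graph_cover K0 a0 a1 hf e0 e1.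
  exact: le_trans (covering_number_le hc) hn.
Qed.

End FractalDimension.

(** * Geometric sums at and off a jump, and discrete Parseval *)

Section Correlation.
Context {R : realType}.
Implicit Types (x y h theta : R).

Lemma normc_weighted_geom (N : nat) theta : (0 < N)%N -> sin (theta / 2) != 0 ->
  normc (\sum_(i < N) ((N + i)%:R^-1)%:C * cis ((N + i)%:R * theta)) <=
    N%:R^-1 * `|sin (theta / 2)|^-1.
Proof.
move=> N0 s0; pose w i : R := (N + i)%:R^-1; pose z i : R[i] := cis ((N + i)%:R * theta).
have hz (j : nat) : (j <= N)%N ->
    normc (\sum_(i < j) cis ((N + i)%:R * theta)) <= `|sin (theta / 2)|^-1.
  move=> _; rewrite (eq_bigr (fun i : 'I_j => cis (N%:R * theta) * cis (i%:R * theta))).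
    by rewrite -mulr_sumr Normc.normcM normc_cis mul1r sum_cis_geom.
  by move=> i _; rewrite natrD mulrDl cisD.
apply: le_trans (@abel_bounded_variation R w z _ N hz) _.
have w0 i : 0 <= w i by rewrite invr_ge0.
have dw (i : nat) : `|w i.+1 - w i| = w i - w i.+1.
  rewrite distrC ger0_norm // subr_ge0 lef_pV2 ?posrE ?ltr0n ?ler_nat ?addnS //.
  by rewrite addn_gt0 N0.
rewrite (eq_bigr (fun i : 'I_N => - (w i.+1 - w i))); last by move=> i _; rewrite dw opprB.
rewrite sumrN -(big_mkord xpredT (fun i => w i.+1 - w i)) telescope_sumr //.
rewrite [`|w N|]ger0_norm // opprB [w 0 + _]addrC addrA subrr add0r /w addn0.
by rewrite mulrC.
Qed.

(** For [N <= n < 2 N] the angle [n pi / (2 N)] lies in the second quadrant, so [1 - cis] has real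
    part at least 1, while the weights [1 / n] sum to at least 1/2. *)
Lemma normc_weighted_diff (N : nat) : (0 < N)%N ->
  2^-1 <= normc (\sum_(i < N) ((N + i)%:R^-1)%:C *
     (cis ((N + i)%:R * (pi / (2 * N%:R))) - 1)) :> R.
Proof.
move=> N0; rewrite -normcN; apply: le_trans (Re_le_normc _).
apply: le_trans (ler_norm _); rewrite -sumrN Re_sum.
have N0' : 0 < N%:R :> R by rewrite ltr0n.
rewrite [leLHS](_ : _ = \sum_(i < N) (2 * N%:R)^-1 :> R); last first.
  by rewrite sumr_const card_ord -[_ *+ N]mulr_natl invfM mulrC -mulrA mulVf ?mulr1 // gt_eqF.
apply: ler_sum => i _; rewrite ReN ReM ReB /= mul0r subr0.
have iN : (i%:R < N%:R :> R) by rewrite ltr_nat.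
have m0 : 0 < (N + i)%:R :> R by rewrite ltr0n addn_gt0 N0.
have c0 : cos ((N + i)%:R * (pi / (2 * N%:R))) <= 0 :> R.
  rewrite -[X in cos X](subrK (pi / 2)) cosDpihalf oppr_le0 sin_ge0_pi //.
  have := @pi_gt0 R; move: (pi : R) => p pp.
  have -> : (N + i)%:R * (p / (2 * N%:R)) - p / 2 = p * (i%:R / (2 * N%:R)).
    by rewrite natrD; field; rewrite gt_eqF.
  rewrite mulr_ge0 ?divr_ge0 ?mulr_ge0 ?(ltW pp) //= -[leRHS]mulr1 ler_wpM2l ?(ltW pp) //.
  by rewrite ler_pdivrMr ?mulr_gt0 // mul1r; lra.
rewrite -mulrN -[leLHS]mulr1; apply: ler_pM => //; last by lra.
rewrite lef_pV2 ?posrE ?mulr_gt0 // natrD; lra.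
Qed.

Lemma cis_neq1 (m : int) (Q : nat) : m != 0 -> (`|m| < Q)%N ->
  cis (m%:~R * (2 * pi / Q%:R)) != 1 :> R[i].
Proof.
move=> m0 mQ; have Q0 : 0 < Q%:R :> R by rewrite ltr0n (leq_ltn_trans _ mQ).
have s0 : sin (m%:~R * (pi / Q%:R)) != 0 :> R.
  wlog mp : m m0 mQ / 0 < m.
    move=> h; have [mp|mn|me] := ltgtP 0 m; [exact: h| |by rewrite -me eqxx in m0].
    have := h (- m); rewrite oppr_eq0 abszN => /(_ m0 mQ).
    by rewrite oppr_gt0 => /(_ mn); rewrite mulrNz mulNr sinN oppr_eq0.
  rewrite gt_eqF // sin_gt0_pi //.
  have mq : (m%:~R : R) < Q%:R.
    have : (`|m|%N%:R : R) < Q%:R by rewrite ltr_nat.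
    by rewrite -{2}(gtz0_abs mp).
  have m1 : 0 < (m%:~R : R) by rewrite ltr0z.
  have := @pi_gt0 R; move: (pi : R) => p pp.
  rewrite mulr_gt0 ?divr_gt0 //= mulrA ltr_pdivrMr // mulrC ltr_pM2l //.
apply: contraNneq s0 => e1.
have := cisB1E (m%:~R * (2 * pi / Q%:R) : R); rewrite e1 subrr => /esym/(congr1 normc).
rewrite !Normc.normcM normc_cis mulr1 normc_real Normc.normc0 => /eqP.
rewrite mulf_eq0 => /orP[/eqP/Normc.eq0_normc/eqP|].
  by rewrite eq_complex /= eqxx /= pnatr_eq0.
rewrite normr_eq0; congr (sin _ == 0).
by move: (pi : R) => p; field; rewrite gt_eqF.
Qed.

Lemma sum_cis_sample (m : int) (Q : nat) : m != 0 -> (`|m| < Q)%N ->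
  \sum_(j < Q) cis (m%:~R * (2 * pi * j%:R / Q%:R)) = 0 :> R[i].
Proof.
move=> m0 mQ; have z1 := cis_neq1 m0 mQ.
have Q0 : 0 < Q%:R :> R by rewrite ltr0n (leq_ltn_trans _ mQ).
set a : R := m%:~R * (2 * pi / Q%:R) in z1.
rewrite (eq_bigr (fun j : 'I_Q => cis a ^+ j)) => [|j _]; last first.
  rewrite -cis_nat_mul /a; congr cis.
  by move: (2 * pi : R) => p; field; rewrite gt_eqF.
have := subrX1 (cis a) Q; rewrite -cis_nat_mul.
have -> : Q%:R * a = 2 * pi * m%:~R.
  by rewrite /a; move: (2 * pi : R) => p; field; rewrite gt_eqF.
rewrite cis_2pi_int subrr => /esym/eqP; rewrite mulf_eq0 subr_eq0 (negPf z1) /=.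
by move/eqP.
Qed.

(** Averaging over [Q] equidistant points is exact for trigonometric polynomials whose frequencies
    differ by less than [Q]; it replaces an integral over the period. *)
Lemma discrete_parseval (Q k l : nat) (n : 'I_k -> int) (m : 'I_l -> int)
    (a : 'I_k -> R[i]) (b : 'I_l -> R[i]) :
  (forall i j, (`|n i - m j| < Q)%N) ->
  \sum_(s < Q) (\sum_i a i * cis ((n i)%:~R * (2 * pi * s%:R / Q%:R))) *
     conjc (\sum_j b j * cis ((m j)%:~R * (2 * pi * s%:R / Q%:R))) =
  Q%:R * \sum_j \sum_(i | n i == m j) a i * conjc (b j).
Proof.
move=> hQ.
transitivity (\sum_(s < Q) \sum_j \sum_i a i * conjc (b j) *
    cis ((n i - m j)%:~R * (2 * pi * s%:R / Q%:R))).
  apply: eq_bigr => s _; rewrite conjc_sum mulr_sumr; apply: eq_bigr => j _.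
  rewrite mulr_suml; apply: eq_bigr => i _.
  rewrite conjcM -cisN mulrACA -cisD; congr (_ * cis _).
  by rewrite intrB mulrBl.
rewrite exchange_big mulr_sumr; apply: eq_bigr => j _.
rewrite exchange_big mulr_sumr [RHS]big_mkcond; apply: eq_bigr => i _ /=.
rewrite -mulr_sumr; case: eqVneq => [->|nm]; last first.
  by rewrite sum_cis_sample ?mulr0 // subr_eq0.
rewrite (eq_bigr (fun=> 1)) => [|s _]; last by rewrite subrr mul0r cis0.
by rewrite sumr_const card_ord mulrC.
Qed.

(** At the arguments [x - y] and [x - y + h], with [h = pi / (2 N)], the geometric sums are bounded
    uniformly once [h] is small; weights [1 / n] with [n >= N] then give the factor [1 / N]. *)
Lemma off_node_small x y : 0 <= x < 2 * pi -> 0 <= y < 2 * pi -> x != y ->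
  exists2 B : R, 0 <= B & exists N0, forall N, (N0 <= N)%N -> (0 < N)%N ->
    normc (\sum_(i < N) ((N + i)%:R^-1)%:C *
      ((cis ((N + i)%:R * (pi / (2 * N%:R))) - 1) * cis ((N + i)%:R * (x - y)))) <= B * N%:R^-1.
Proof.
move=> /andP[x0 x1] /andP[y0 y1] xy.
have p0 := @pi_gt0 R.
have s0 : sin ((x - y) / 2) != 0 :> R.
  have d0 : x - y != 0 by rewrite subr_eq0.
  have d1 : - (2 * pi) < x - y < 2 * pi by apply/andP; split; move: (2 * pi : R) x1 y1 => p; lra.
  move: (x - y) d0 d1 => d d0 /andP[d1 d2].
  have [dp|dn|de] := ltgtP 0 d; last by rewrite -de eqxx in d0.
    by rewrite gt_eqF // sin_gt0_pi //; apply/andP; split; move: (pi : R) d2 => p; lra.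
  rewrite -(opprK (d / 2)) sinN oppr_eq0 gt_eqF // sin_gt0_pi //.
  by apply/andP; split; move: (pi : R) d1 => p; lra.
have a0 : 0 < `|sin ((x - y) / 2)| by rewrite normr_gt0.
pose a := `|sin ((x - y) / 2)|; have a00 : 0 <= a by exact: ltW.
exists (2 * a^-1 + a^-1); first by rewrite addr_ge0 ?mulr_ge0 ?invr_ge0.
exists (nceil (pi / (2 * a))) => N hN N0.
have N0' : 0 < N%:R :> R by rewrite ltr0n.
pose h : R := pi / (2 * N%:R).
have h0 : 0 <= h by rewrite divr_ge0 ?mulr_ge0 // ltW.
have ha : h <= a.
  have [+ _] := nceilP (divr_ge0 (ltW p0) (mulr_ge0 (ler0n R 2) a00) : 0 <= pi / (2 * a)).
  rewrite /h; move: (pi : R) p0 hN => p p0 hN hn.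
  have {}hn : p / (2 * a) <= N%:R by rewrite (le_trans hn) // ler_nat.
  rewrite ler_pdivrMr ?mulr_gt0 // in hn; rewrite ler_pdivrMr ?mulr_gt0 //.
  by apply: (le_trans hn); lra.
have dsin : `|sin ((x - y + h) / 2) - sin ((x - y) / 2)| <= h / 2.
  have := normc_cisB ((x - y + h) / 2) ((x - y) / 2); move=> /(le_trans (Im_le_normc _)).
  rewrite ImB /= => /le_trans; apply.
  by rewrite (_ : _ - _ = h / 2) ?ger0_norm ?divr_ge0 //; lra.
have sh : a / 2 <= `|sin ((x - y + h) / 2)|.
  have := ler_distD (sin ((x - y + h) / 2)) (sin ((x - y) / 2)) 0.
  by rewrite !subr0 -/a distrC; move: dsin ha; lra.
have sh0 : sin ((x - y + h) / 2) != 0 by rewrite -normr_gt0 (lt_le_trans _ sh) ?divr_gt0.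
rewrite (eq_bigr (fun i : 'I_N => ((N + i)%:R^-1)%:C * cis ((N + i)%:R * (x - y + h)) -
   ((N + i)%:R^-1)%:C * cis ((N + i)%:R * (x - y)))); last first.
  by move=> i _; rewrite -/h mulrBl mul1r -cisD -mulrDr [h + _]addrC mulrBr.
rewrite sumrB (le_trans (normc_le_sub _ _)) // mulrDl; apply: lerD.
  apply: (le_trans (normc_weighted_geom N0 sh0)); rewrite mulrC ler_wpM2r ?invr_ge0 //.
  have a2 : 0 < a / 2 by rewrite divr_gt0.
  by rewrite -(invf_div a 2) lef_pV2 ?posrE // (lt_le_trans a2).
by apply: (le_trans (normc_weighted_geom N0 s0)); rewrite mulrC.
Qed.

End Correlation.

(** * Lower bound for the mean increment of the evolution *)

Section IncrementLowerBound.
Context {R : realType}.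
Implicit Types (x y h : R) (L : seq (R[i] * R)).

Local Notation omega := (@omega_gc R).

(** Contribution of a unit jump at distance [y] to the correlation with the test sum, up to the
    factor [1 / (2 pi i)]. *)
Definition node_sum (N : nat) y : R[i] :=
  \sum_(i < N) ((N + i)%:R^-1)%:C *
      ((cis ((N + i)%:R * (pi / (2 * N%:R))) - 1) * cis ((N + i)%:R * y)).

Lemma off_nodes_small L x : (forall p, p \in L -> 0 <= p.2 < 2 * pi) -> 0 <= x < 2 * pi ->
  exists2 B : R, 0 <= B & exists N0, forall N, (N0 <= N)%N -> (0 < N)%N ->
    normc (\sum_(p <- L | p.2 != x) p.1 * node_sum N (x - p.2)) <= B * N%:R^-1.
Proof.
elim: L => [|p L ih] hL hx.
  by exists 0 => //; exists 0%N => N _ _; rewrite big_nil Normc.normc0 mul0r.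
have [B B0 [N0 hN0]] := ih (fun q qL => hL q (mem_behead (s := p :: L) qL)) hx.
have [px|px] := eqVneq p.2 x.
  by exists B => //; exists N0 => N h1 h2; rewrite big_cons px eqxx /= hN0.
rewrite eq_sym in px.
have [B' B'0 [N1 hN1]] := off_node_small hx (hL p (mem_head _ _)) px.
exists (normc p.1 * B' + B); first by rewrite addr_ge0 ?mulr_ge0 ?normc_ge0.
exists (maxn N0 N1) => N; rewrite geq_max => /andP[h0 h1] h2.
rewrite big_cons eq_sym px /= (le_trans (le_normcD _ _)) // mulrDl lerD ?hN0 //.
by rewrite Normc.normcM -mulrA ler_wpM2l ?normc_ge0 // hN1.
Qed.

Section Profile.
Variables (t alpha K y0 : R) (g u : R -> R[i]) (L : seq (R[i] * R)).
Hypotheses (a0 : 0 < alpha) (a1 : alpha < 1) (K0 : 0 <= K).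
Hypothesis sb : sum_bound t alpha.
Hypothesis hL : forall p, p \in L -> 0 <= p.2 < 2 * pi.
Hypothesis hE : node_weight L y0 != 0.
Hypothesis hg : forall n : int, n != 0 -> fourier_coef g n =
      (Complex 0 (2 * pi * n%:~R))^-1 * \sum_(p <- L) p.1 * cis (- (n%:~R * p.2)).
Hypothesis hu : forall x (N : nat), (0 < N)%N ->
  normc (u x - evolution_partial_sum omega t g N x) <= K * N%:R `^ (- alpha).

Lemma node_itv : 0 <= y0 < 2 * pi.
Proof.
have [/hasP[p pL /eqP <-]|no] := boolP (has (fun p => p.2 == y0) L); first exact: hL.
move: hE; rewrite /node_weight big_seq_cond big_pred0 ?eqxx // => p.
by apply/negP => /andP[pL pe]; move/hasPn: no => /(_ p pL); rewrite pe.
Qed.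

(** The jump at [y0] contributes at least half its weight and the other nodes together at most a
    quarter of it for large [N]; the factor [1 / (2 pi)] turns the remaining quarter into
    [1 / (8 pi)]. *)
Lemma correlation_lower_bound : exists N0, forall N, (N0 <= N)%N -> (0 < N)%N ->
  normc (node_weight L y0) / (8 * pi) <= normc (\sum_(i < N) fourier_coef g (N + i)%:Z *
    ((cis ((N + i)%:R * (pi / (2 * N%:R))) - 1) * cis ((N + i)%:R * y0))).
Proof.
have [B B0 [N0 hN0]] := off_nodes_small hL node_itv.
have E0 : 0 < normc (node_weight L y0).
  by rewrite lt_neqAle normc_ge0 eq_sym andbT; apply: contra hE => /eqP/Normc.eq0_normc ->.
set E := node_weight L y0 in E0 *.
have p0 : 0 < pi :> R by exact: pi_gt0.
exists (maxn N0 (nceil (B * 4 / normc E))) => N; rewrite geq_max => /andP[h0 h1] N0'.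
have Np : 0 < N%:R :> R by rewrite ltr0n.
pose c : R[i] := (Complex 0 (2 * pi))^-1.
have -> : \sum_(i < N) fourier_coef g (N + i)%:Z *
    ((cis ((N + i)%:R * (pi / (2 * N%:R))) - 1) * cis ((N + i)%:R * y0)) =
    c * \sum_(p <- L) p.1 * node_sum N (y0 - p.2).
  transitivity (\sum_(i < N) \sum_(p <- L) c * (p.1 * (((N + i)%:R^-1)%:C *
      ((cis ((N + i)%:R * (pi / (2 * N%:R))) - 1) * cis ((N + i)%:R * (y0 - p.2)))))).
    apply: eq_bigr => i _; rewrite hg; last by rewrite eqz_nat -lt0n addn_gt0 N0'.
    have -> : (Complex 0 (2 * pi * (N + i)%:Z%:~R))^-1 = c * ((N + i)%:R^-1)%:C :> R[i].
      rewrite /c fmorphV -invfM; congr (_^-1); rewrite -pmulrn.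
      by apply: complex_eq; rewrite ?ReM ?ImM /=; ring.
    rewrite mulr_sumr mulr_suml; apply: eq_bigr => p _.
    rewrite -pmulrn [cis (_ * (_ - _))](_ : _ = cis ((N + i)%:R * y0) * cis (- ((N + i)%:R * p.2))).
      by move: (cis _ - 1) (cis (- _)) => d e; ring.
    by rewrite -cisD mulrBr.
  rewrite exchange_big mulr_sumr; apply: eq_bigr => p _.
  by rewrite /node_sum !mulr_sumr.
rewrite (bigID (fun p => p.2 == y0)) /=.
rewrite (eq_bigr (fun p => p.1 * node_sum N 0)) => [|p /eqP ->]; last by rewrite subrr.
rewrite -mulr_suml -/(node_weight L y0) -/E Normc.normcM.
have -> : normc c = (2 * pi)^-1.
  rewrite /c Normc.normcV /= expr0n add0r sqrtr_sqr ger0_norm //.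
  by rewrite mulr_ge0 // ltW.
have n0 : 2^-1 <= normc (node_sum N 0).
  rewrite /node_sum (eq_bigr (fun i : 'I_N => ((N + i)%:R^-1)%:C *
     (cis ((N + i)%:R * (pi / (2 * N%:R))) - 1))); first exact: normc_weighted_diff.
  by move=> i _; rewrite mulr0 cis0 mulr1.
have b0 : B * N%:R^-1 <= normc E / 4.
  have [+ _] := nceilP (divr_ge0 (mulr_ge0 B0 (ler0n R 4)) (ltW E0)).
  move=> /le_trans /(_ (_ : _ <= N%:R)); rewrite ler_nat => /(_ h1).
  rewrite ler_pdivrMr // ler_pdivrMr // => h; rewrite mulrC in h; lra.
have h2 := hN0 N h0 N0'.
have := normc_addl_le (E * node_sum N 0) (\sum_(p <- L | p.2 != y0) p.1 * node_sum N (y0 - p.2)).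
rewrite Normc.normcM.
have h3 : normc E / 2 <= normc E * normc (node_sum N 0) by rewrite ler_wpM2l ?normc_ge0.
set w := normc (_ + _) => h4.
have h5 : normc E / 4 <= w by move: h2 h3 h4 b0; rewrite /w; lra.
rewrite [leLHS](_ : _ = (2 * pi)^-1 * (normc E / 4)).
  by rewrite ler_wpM2l // invr_ge0 mulr_ge0 // ltW.
by move: (normc E) p0 => e; move: (pi : R) => p p0; field; rewrite gt_eqF.
Qed.

Let S := evolution_partial_sum omega t g.

(** A dyadic block of frequencies carrying the phases of the evolution, so that these cancel in the
    correlation with [u]. *)
Definition test_sum (N : nat) x : R[i] :=
  \sum_(i < N) cis (t * omega (N + i)%:Z + (N + i)%:R * (x - y0)).

Lemma normc_test_sum : exists2 C : R, 0 < C & forall N x, (0 < N)%N ->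
  normc (test_sum N x) <= C * N%:R `^ (1 - alpha).
Proof.
have [C C0 hC] := sb; exists (3 * C + 1) => [|N x N0]; first by lra.
have -> : test_sum N x =
    \sum_(0 <= n < (2 * N)%N) cis (t * omega n%:Z + n%:R * (x - y0)) -
    \sum_(0 <= n < N) cis (t * omega n%:Z + n%:R * (x - y0)).
  rewrite (@big_cat_nat _ _ _ N 0 (2 * N)%N) //=; last by rewrite leq_pmull.
  rewrite addrAC subrr add0r -[X in \sum_(X <= _ < _) _]add0n big_addn mul2n -addnn addnK big_mkord.
  by apply: eq_bigr => i _; rewrite addnC.
rewrite (le_trans (normc_le_sub _ _)) //.
have h1 := hC (x - y0) N N0.
have h2 := hC (x - y0) (2 * N)%N (_ : 0 < 2 * N)%N; rewrite muln_gt0 N0 in h2.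
have {}h2 := h2 isT.
have Y0 : 0 <= N%:R `^ (1 - alpha) :> R by exact: powR_ge0.
have Y2 : (2 * N)%:R `^ (1 - alpha) <= 2 * N%:R `^ (1 - alpha) :> R.
  by rewrite natrM powRM // ler_wpM2r //; apply: ler1_powR => //; move: a0 a1; lra.
have h3 : C * (2 * N)%:R `^ (1 - alpha) <= C * (2 * N%:R `^ (1 - alpha)) by rewrite ler_wpM2l.
by move: (N%:R `^ _) Y0 h1 h3 => Y Y0 h1 h3; lra.
Qed.

Lemma correlation (N M Q : nat) h : (0 < N)%N -> (2 * N <= M)%N -> (M + 2 * N < Q)%N ->
  \sum_(s < Q) (S M (2 * pi * s%:R / Q%:R + h) - S M (2 * pi * s%:R / Q%:R)) *
     conjc (test_sum N (2 * pi * s%:R / Q%:R)) =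
  Q%:R * \sum_(i < N) fourier_coef g (N + i)%:Z *
    ((cis ((N + i)%:R * h) - 1) * cis ((N + i)%:R * y0)).
Proof.
move=> N0 MN QN.
pose n (k : 'I_M.*2.+1) : int := k%:Z - M%:Z.
pose m (i : 'I_N) : int := (N + i)%:Z.
pose a k := fourier_coef g (n k) * cis (t * omega (n k)) * (cis ((n k)%:~R * h) - 1).
pose b i := cis (t * omega (m i)) * cis (- ((m i)%:~R * y0)) : R[i].
transitivity (\sum_(s < Q) (\sum_i a i * cis ((n i)%:~R * (2 * pi * s%:R / Q%:R))) *
     conjc (\sum_j b j * cis ((m j)%:~R * (2 * pi * s%:R / Q%:R)))).
  apply: eq_bigr => s _; move: (2 * pi * s%:R / Q%:R : R) => x; congr (_ * conjc _).
    rewrite /S /evolution_partial_sum !big_mkord -sumrB; apply: eq_bigr => k _ /=.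
    rewrite /a /n mulrDr addrA addrAC !cisD.
    by move: (cis _) (cis _) (cis _) (fourier_coef _ _) => e1 e2 e3 f; ring.
  apply: eq_bigr => i _; rewrite /b -!cisD; congr cis.
  by rewrite /m -pmulrn; ring.
(* The frequencies of [S M] lie in [[- M, M]] and those of the test sum below [2 * N], so all
   differences are smaller than [Q]. *)
rewrite discrete_parseval => [|k i]; last first.
  by have := ltn_ord k; have := ltn_ord i; rewrite /n /m; lia.
congr (_ * _); apply: eq_bigr => i _.
have hk : (M + (N + i) < M.*2.+1)%N by have := ltn_ord i; lia.
rewrite (big_pred1 (Ordinal hk)) => [|k]; last first.
  by rewrite /n /m; apply/eqP/eqP => [?|-> /=]; [apply/val_inj => /=; lia|lia].
have nk : n (Ordinal hk) = (N + i)%:Z by rewrite /n /=; lia.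
rewrite /a /b nk /m conjcM !cisN -pmulrn conjcK.
have := cisNK (t * omega (N + i)%:Z); rewrite cisN.
move: (cis (t * _)) => e e1.
transitivity (fourier_coef g (N + i)%:Z * (e * conjc e) *
  ((cis ((N + i)%:R * h) - 1) * cis ((N + i)%:R * y0))); first by ring.
by rewrite e1 mulr1.
Qed.

(** Duality: the correlation is bounded below and the test sum is at most [C N^(1 - alpha)]
    everywhere, so the mean of the increments is at least a multiple of [N^(alpha - 1)]. *)
Lemma increment_lower_bound : exists2 c : R, 0 < c & exists N0, forall N, (N0 <= N)%N -> (0 < N)%N ->
  exists Q0, forall Q, (Q0 <= Q)%N -> c * N%:R `^ (alpha - 1) * Q%:R <=
    \sum_(s < Q) normc (u (2 * pi * s%:R / Q%:R + pi / (2 * N%:R)) - u (2 * pi * s%:R / Q%:R)).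
Proof.
have [C C0 hC] := normc_test_sum.
have [N0 hN0] := correlation_lower_bound.
have E0 : 0 < normc (node_weight L y0).
  by rewrite lt_neqAle normc_ge0 eq_sym andbT; apply: contra hE => /eqP/Normc.eq0_normc ->.
have p0 : 0 < pi :> R by exact: pi_gt0.
have : exists e, e = normc (node_weight L y0) / (8 * pi) by eexists.
move=> [e eE]; have e0 : 0 < e by rewrite eE divr_gt0 // mulr_gt0.
exists (e / (2 * C)); first by rewrite divr_gt0 // mulr_gt0.
exists N0 => N NN0 Np; have := hN0 N NN0 Np; rewrite -eE.
set h := pi / _; set G := \sum_(i < N) _ => hG.
have NR : 0 < N%:R :> R by rewrite ltr0n.
pose Y : R := N%:R `^ (1 - alpha); have Y0 : 0 < Y by rewrite powR_gt0.
(* [M] is taken so large that replacing [u] by its partial sum costs at most half of the lower bound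
   [e]. *)
have d0 : 0 < e / (4 * (K + 1) * C * Y) by rewrite divr_gt0 // !mulr_gt0 // ltr_wpDl.
have [M0 M0p hM0] := powRN_small a0 d0.
pose M := maxn M0 (2 * N)%N.
have Mp : (0 < M)%N by rewrite leq_max M0p.
have hP := hM0 M (leq_maxl _ _).
exists (M + 2 * N).+1 => Q hQ.
have QR : 0 < Q%:R :> R by rewrite ltr0n (leq_trans _ hQ).
have := correlation h Np (leq_maxr _ _ : (2 * N <= M)%N) hQ.
rewrite -/G => /(congr1 normc); rewrite Normc.normcM.
have -> : normc (Q%:R : R[i]) = Q%:R.
  rewrite (_ : (Q%:R : R[i]) = (Q%:R)%:C); last by rewrite rmorph_nat.
  by rewrite normc_real ger0_norm.
set x := fun s : nat => 2 * pi * s%:R / Q%:R : R.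
set P : R := M%:R `^ (- alpha) in hP.
have step : normc (\sum_(s < Q) (S M (x s + h) - S M (x s)) * conjc (test_sum N (x s))) <=
   \sum_(s < Q) (normc (u (x s + h) - u (x s)) + 2 * (K * P)) * (C * Y).
  rewrite (le_trans (normc_sum _ _ _)) //; apply: ler_sum => s _.
  rewrite Normc.normcM normcJ; apply: ler_pM; rewrite ?normc_ge0 ?hC //.
  have -> : S M (x s + h) - S M (x s) = (u (x s + h) - u (x s)) -
     ((u (x s + h) - S M (x s + h)) - (u (x s) - S M (x s))) by ring.
  rewrite (le_trans (normc_le_sub _ _)) // lerD2l (le_trans (normc_le_sub _ _)) //.
  by have := hu (x s + h) Mp; have := hu (x s) Mp; rewrite -/P -/S; lra.
move=> eq; rewrite eq -mulr_suml big_split /= sumr_const card_ord -(mulr_natl (2 * (K * P)) Q) in step.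
set Z := \sum_(s < Q) _ in step *.
have h1 : Q%:R * e <= (Z + Q%:R * (2 * (K * P))) * (C * Y).
  by apply: le_trans step; rewrite ler_wpM2l // ltW.
have K1 : 0 < K + 1 by rewrite ltr_wpDl.
have h2 : 2 * (K * P) * (C * Y) <= e / 2.
  have P0 : 0 <= P by exact: powR_ge0.
  have CY : 0 < C * Y by rewrite mulr_gt0.
  have : P * (4 * (K + 1) * C * Y) < e by rewrite -ltr_pdivlMr // !mulr_gt0.
  have : P * (4 * K * C * Y) <= P * (4 * (K + 1) * C * Y).
    by rewrite ler_wpM2l // !ler_wpM2r ?(ltW C0) ?(ltW Y0) //; lra.
  have -> : P * (4 * K * C * Y) = 2 * (2 * (K * P) * (C * Y)) by ring.
  by lra.
have h3 : Q%:R * (2 * (K * P) * (C * Y)) <= Q%:R * (e / 2) by rewrite ler_wpM2l // ltW.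
have h4 : Q%:R * e / 2 <= Z * (C * Y).
  by move: h1; rewrite [X in _ <= X -> _]mulrDl -mulrA; lra.
have -> : N%:R `^ (alpha - 1) = Y^-1 :> R by rewrite /Y -powRN opprB.
rewrite (_ : e / (2 * C) / Y * Q%:R = Q%:R * e / 2 / (C * Y)).
  by rewrite ler_pdivrMr // mulr_gt0.
by field; rewrite !gt_eqF.
Qed.

End Profile.
End IncrementLowerBound.

(** * Increments of a function bounded by the number of discs covering its graph *)

Section GraphLowerBound.
Context {R : realType}.
Implicit Types (x y a b eps : R) (f : R -> R).

(** Induction on the number of centres: some [d] covers the right end [b]. Removing it leaves a
    cover of the segment up to [d - eps], which that open interval misses. *)
Lemma interval_cover_length (s : seq R) eps a b : 0 < eps -> a <= b ->
  (forall v, a <= v <= b -> exists2 d, d \in s & `|v - d| < eps) ->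
  b - a <= 2 * eps * (size s)%:R.
Proof.
move=> e0; have [n] := ubnP (size s); elim: n => // n ih in s b * => sn ab h.
have [|d ds hd] := h b; first by rewrite ab lexx.
have sz : size s = (size (rem d s)).+1 by rewrite size_rem // prednK //; case: (s) ds.
move: hd; rewrite ltr_norml => /andP[hd1 hd2].
rewrite sz -[(size (rem d s)).+1%:R]natr1 mulrDr mulr1.
have z0 : 0 <= 2 * eps * (size (rem d s))%:R by rewrite !mulr_ge0 // ltW.
have [da|ad] := ltP (d - eps) a; first by lra.
suff : d - eps - a <= 2 * eps * (size (rem d s))%:R by lra.
apply: ih => //; first by rewrite sz ltnS in sn.
move=> v /andP[v1 v2]; have [|d' ds' hd'] := h v; first by rewrite v1 /=; lra.
exists d' => //; have := perm_mem (perm_to_rem ds) d'; rewrite ds' inE => /esym/orP[/eqP de|//].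
by move: hd'; rewrite de ltr_norml => /andP[hd3 _]; lra.
Qed.

Lemma disc_abs (c : R * R) eps x y : 0 < eps -> disc c eps (x, y) ->
  `|x - c.1| < eps /\ `|y - c.2| < eps.
Proof.
move=> e0; rewrite /disc /=; set d1 := x - c.1; set d2 := y - c.2 => h.
have h2 : d1 ^+ 2 + d2 ^+ 2 < eps ^+ 2.
  by rewrite -ltr_sqrt ?exprn_gt0 // sqrtr_sqr gtr0_norm.
have q1 := sqr_ge0 d1; have q2 := sqr_ge0 d2.
have sq (d : R) : d ^+ 2 < eps ^+ 2 -> `|d| < eps.
  by rewrite -[d ^+ 2]real_normK ?num_real // ltr_pXn2r ?nnegrE // ltW.
by split; apply: sq; lra.
Qed.

(** By the intermediate value theorem each value between [f x] and [f (x + eps)] is taken on that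
    segment, at a graph point in some disc, whose centre is then within [2 eps] of [x] horizontally.
    The heights of such centres therefore cover the segment of values. *)
Lemma graph_increment_le f (n : nat) (c : 'I_n -> R * R) eps x :
  continuous f -> 0 < eps -> 0 <= x -> x + eps <= 2 * pi ->
  torus_graph f `<=` \bigcup_j disc (c j) eps ->
  `|f (x + eps) - f x| <= 2 * eps * \sum_(l < n) (`|(c l).1 - x| < 2 * eps)%R%:R.
Proof.
move=> cf e0 x0 x1 hc.
pose s := [seq (c l).2 | l <- index_enum 'I_n & `|(c l).1 - x| < 2 * eps].
have -> : \sum_(l < n) (`|(c l).1 - x| < 2 * eps)%R%:R = (size s)%:R :> R.
  rewrite size_map size_filter -sum1_count natr_sum [RHS]big_mkcond /=.
  by apply: eq_bigr => l _; case: ifP.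
have -> : `|f (x + eps) - f x| = Num.max (f x) (f (x + eps)) - Num.min (f x) (f (x + eps)).
  have [h|h] := leP (f x) (f (x + eps)); first by rewrite ger0_norm // subr_ge0.
  by rewrite ltr0_norm ?subr_lt0 // opprB.
apply: interval_cover_length => //; first by rewrite ge_min !le_max lexx.
move=> v hv; have xe : x <= x + eps by rewrite lerDl ltW.
have [|y] := IVT xe _ hv; first by apply: continuous_subspaceT => z; exact: cf.
rewrite in_itv /= => /andP[y0 y1] fy.
have [|l _] := hc (y, f y); first by exists y => //=; rewrite in_itv /= (le_trans x0) //= (le_trans y1).
move=> /(disc_abs e0)[]; rewrite fy => l1 l2.
exists (c l).2 => //; apply: map_f; rewrite mem_filter mem_index_enum andbT.
by move: l1; rewrite !ltr_norml => /andP[? ?]; apply/andP; split; lra.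
Qed.

Lemma count_close (Q : nat) (s a r : R) : 0 < s -> 0 < r ->
  \sum_(j < Q) (`|a - j%:R * s| < r)%R%:R <= 2 * r / s + 1.
Proof.
move=> s0 r0; pose F (q : nat) : R := \sum_(j < q) (`|a - j%:R * s| < r)%R%:R.
(* Once the progression has entered the interval, the first inequality measures how far it has moved
   past the left end [a - r]; at each new hit it yields the second. *)
rewrite -/(F Q); suff : F Q = 0 \/ (F Q - 1) * s <= (Q%:R - 1) * s - (a - r) /\ (F Q - 1) * s <= 2 * r.
  move=> [->|[_ h]]; first by rewrite addr_ge0 // divr_ge0 ?mulr_ge0 // ltW.
  by rewrite -lerBlDr ler_pdivlMr.
elim: Q => [|q ih]; first by left; rewrite /F big_ord0.
have FS : F q.+1 = F q + (`|a - q%:R * s| < r)%R%:R by rewrite /F big_ord_recr.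
have -> : (q.+1%:R - 1 : R) = q%:R by rewrite -[q.+1%:R]natr1 addrK.
rewrite FS; case: (boolP (`|a - q%:R * s| < r)) => /= [|_]; rewrite ?addr0.
  rewrite ltr_norml => /andP[h1 h2]; right; case: ih => [->|[i1 i2]].
    by rewrite add0r subrr mul0r; split; lra.
  by rewrite addrK; split; move: i1 i2; rewrite !mulrBl !mul1r; lra.
case: ih => [->|[i1 i2]]; [by left|right]; split => //.
by move: i1; rewrite !mulrBl !mul1r; lra.
Qed.

(** Double counting: each disc is near at most [2 eps Q] sample points. The sample points within
    [eps] of the end of the period, where the increment leaves the graph, are equally few and are
    estimated by [B]. *)
Lemma sampled_increments_le f (n : nat) (c : 'I_n -> R * R) (B eps : R) (Q : nat) :
  continuous f -> 0 < eps -> 1 <= eps * Q%:R -> 0 <= B ->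
  (forall x, `|f (x + eps) - f x| <= B) ->
  torus_graph f `<=` \bigcup_j disc (c j) eps ->
  \sum_(s < Q) `|f (2 * pi * s%:R / Q%:R + eps) - f (2 * pi * s%:R / Q%:R)| <=
    (4 * eps ^+ 2 * n%:R + 2 * B * eps) * Q%:R.
Proof.
move=> cf e0 eQ B0 hB hc.
have Q0 : 0 < Q%:R :> R by rewrite -(pmulr_rgt0 _ e0) (lt_le_trans ltr01).
have p4 : 4 <= 2 * pi :> R by have := @pi_ge2 R; lra.
pose st : R := 2 * pi / Q%:R; have st0 : 0 < st by rewrite divr_gt0 // (lt_le_trans _ p4).
have xE (s : nat) : 2 * pi * s%:R / Q%:R = s%:R * st by rewrite mulrAC [RHS]mulrC.
have cnt a (r : R) : 0 < r -> r <= 2 * eps ->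
    \sum_(s < Q) (`|a - s%:R * st| < r)%R%:R <= 2 * eps * Q%:R.
  move=> r0 re; apply: (le_trans (count_close _ _ st0 r0)).
  have : 2 * r / st <= eps * Q%:R.
    have Qst : Q%:R * st = 2 * pi by rewrite mulrC /st divfK // gt_eqF.
    rewrite ler_pdivrMr // -mulrA Qst.
    apply: (@le_trans _ _ (eps * 4)); first by lra.
    by rewrite ler_wpM2l // ltW.
  lra.
apply: (@le_trans _ _ (\sum_(s < Q) (2 * eps * (\sum_(l < n) (`|(c l).1 - s%:R * st| < 2 * eps)%R%:R) +
    B * (`|2 * pi - s%:R * st| < eps)%R%:R))).
  apply: ler_sum => s _; rewrite xE.
  have x0 : 0 <= s%:R * st by rewrite mulr_ge0 // ltW.
  have x1 : s%:R * st < 2 * pi.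
    rewrite /st mulrCA -[ltRHS]mulr1 ltr_pM2l ?(lt_le_trans _ p4) //.
    by rewrite ltr_pdivrMr // mul1r ltr_nat.
  have S0 : 0 <= \sum_(l < n) (`|(c l).1 - s%:R * st| < 2 * eps)%R%:R :> R.
    by apply: sumr_ge0 => l _.
  have [xe|xe] := leP (s%:R * st + eps) (2 * pi).
    rewrite (le_trans (graph_increment_le cf e0 x0 xe hc)) // lerDl mulr_ge0 //.
  have -> : `|2 * pi - s%:R * st| < eps.
    by move: x1 xe; move: (2 * pi : R) => p x1 xe; rewrite gtr0_norm; lra.
  by rewrite mulr1 (le_trans (hB _)) // lerDr mulr_ge0 // mulr_ge0 // ltW.
rewrite big_split /= -!mulr_sumr exchange_big /= [leRHS]mulrDl; apply: lerD.
  apply: (@le_trans _ _ (2 * eps * \sum_(l < n) (2 * eps * Q%:R))).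
    rewrite ler_wpM2l ?mulr_ge0 ?(ltW e0) //; apply: ler_sum => l _.
    by apply: cnt => //; rewrite mulr_gt0.
  by rewrite sumr_const card_ord -(mulr_natl _ n) expr2; lra.
rewrite -[2 * B * eps * _]mulrA [2 * B]mulrC -mulrA ler_wpM2l //.
by rewrite mulrA; apply: cnt => //; lra.
Qed.

End GraphLowerBound.

(** * Lower bound for the dimension *)

Section DimensionLowerBound.
Context {R : realType}.
Implicit Types (x y : R) (L : seq (R[i] * R)).

Variables (alpha K : R) (u : R -> R[i]).
Hypotheses (a0 : 0 < alpha) (a1 : alpha < 1) (K0 : 0 <= K).
Hypothesis hH : forall x y, `|y - x| <= 1 -> normc (u y - u x) <= K * `|y - x| `^ alpha.
Hypothesis cu : cts u.
Variable c : R.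
Hypothesis c0 : 0 < c.
Hypothesis hI : exists N0, forall N, (N0 <= N)%N -> (0 < N)%N ->
  exists Q0, forall Q, (Q0 <= Q)%N -> c * N%:R `^ (alpha - 1) * Q%:R <=
    \sum_(s < Q) normc (u (2 * pi * s%:R / Q%:R + pi / (2 * N%:R)) - u (2 * pi * s%:R / Q%:R)).

Lemma increments_le_covers eps (n1 n2 : nat) (c1 : 'I_n1 -> R * R) (c2 : 'I_n2 -> R * R) (Q : nat) :
  0 < eps -> eps <= 1 -> 1 <= eps * Q%:R ->
  torus_graph (fun x => complex.Re (u x)) `<=` \bigcup_j disc (c1 j) eps ->
  torus_graph (fun x => complex.Im (u x)) `<=` \bigcup_j disc (c2 j) eps ->
  \sum_(s < Q) normc (u (2 * pi * s%:R / Q%:R + eps) - u (2 * pi * s%:R / Q%:R)) <=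
   (4 * eps ^+ 2 * (n1%:R + n2%:R) + 4 * (K * eps `^ alpha) * eps) * Q%:R.
Proof.
move=> e0 e1 eQ h1 h2; have [k1 k2] := cu.
have P0 : 0 <= eps `^ alpha by exact: powR_ge0.
have B0 : 0 <= K * eps `^ alpha by rewrite mulr_ge0.
have b x : normc (u (x + eps) - u x) <= K * eps `^ alpha.
  by have := @hH x (x + eps); rewrite addrAC subrr add0r (gtr0_norm e0); exact.
have b1 x : `|complex.Re (u (x + eps)) - complex.Re (u x)| <= K * eps `^ alpha.
  by rewrite -ReB (le_trans (Re_le_normc _)).
have b2 x : `|complex.Im (u (x + eps)) - complex.Im (u x)| <= K * eps `^ alpha.
  by rewrite -ImB (le_trans (Im_le_normc _)).
have s1 := sampled_increments_le k1 e0 eQ B0 b1 h1.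
have s2 := sampled_increments_le k2 e0 eQ B0 b2 h2.
apply: (@le_trans _ _ (\sum_(s < Q)
    (`|complex.Re (u (2 * pi * s%:R / Q%:R + eps)) - complex.Re (u (2 * pi * s%:R / Q%:R))| +
     `|complex.Im (u (2 * pi * s%:R / Q%:R + eps)) - complex.Im (u (2 * pi * s%:R / Q%:R))|))).
  by apply: ler_sum => s _; rewrite -ReB -ImB normc_le_ReIm.
rewrite big_split /=; apply: (le_trans (lerD s1 s2)).
rewrite -[leLHS]mulrDl ler_wpM2r //; lra.
Qed.

(** If both dimensions were below some [d < 1 + alpha], covers at the scale [eps = pi / (2 N)] would
    make the mean increment O([eps^(2 - d)]), whereas it is at least a multiple of
    [eps^(1 - alpha)]. *)
Lemma fractal_dim_lower :
  ((1 + alpha)%:E <= maxe (fractal_dim (torus_graph (fun x => complex.Re (u x))))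
                          (fractal_dim (torus_graph (fun x => complex.Im (u x)))))%E.
Proof.
rewrite leNgt; apply/negP => hlt.
(* [1 - alpha <= d] makes the boundary term [eps^(1 + alpha)] at most [eps^(2 - d)]. *)
have [d [d0 d1 hd]] : exists d, [/\ 1 - alpha <= d, d < 1 + alpha &
  (maxe (fractal_dim (torus_graph (fun x => complex.Re (u x))))
        (fractal_dim (torus_graph (fun x => complex.Im (u x)))) < d%:E)%E].
  move: hlt; case: (maxe _ _) => [r| |] //.
    rewrite lte_fin => hr; exists (Num.max (1 - alpha) ((r + (1 + alpha)) / 2)).
    split; first by rewrite le_max lexx.
      by rewrite gt_max; apply/andP; split; move: a0; lra.
    by rewrite lte_fin lt_max; apply/orP; right; move: hr; lra.
  by move=> _; exists (1 - alpha); rewrite ltNyr; split => //; move: a0; lra.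
move: hd; rewrite gt_max => /andP[/fractal_dim_lt[r1 r10 hr1] /fractal_dim_lt[r2 r20 hr2]].
pose k := 1 + alpha - d; have k0 : 0 < k by rewrite subr_gt0.
have c'0 : 0 < c / (2 * (16 + 4 * K)) by rewrite divr_gt0 // mulr_gt0 //; move: K0; lra.
(* Below [r3] the gain [eps^k] is smaller than [c / (2 (16 + 4 K))], which contradicts the
   comparison of the two bounds at the end. *)
pose r3 := (c / (2 * (16 + 4 * K))) `^ k^-1; have r30 : 0 < r3 by rewrite powR_gt0.
pose r := Num.min (Num.min r1 r2) (Num.min r3 1).
have r0 : 0 < r by rewrite !lt_min r10 r20 r30 ltr01.
have [N0 hN0] := hI.
have p0 := @pi_gt0 R.
pose N := (maxn N0 (nceil (pi / r))).+1.
have NN0 : (N0 <= N)%N by exact: leq_trans (leq_maxl _ _) (leqnSn _).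
have Np : 0 < N%:R :> R by [].
have [Q0 hQ0] := hN0 N NN0 isT.
have : exists eps, eps = pi / (2 * N%:R) :> R by eexists.
move=> [eps eE]; rewrite -eE in hQ0.
have e0 : 0 < eps by rewrite eE divr_gt0 // mulr_gt0.
have er : eps < r.
  have [h1 _] := nceilP (divr_ge0 (ltW p0) (ltW r0)).
  have h2 : pi / r <= N%:R by rewrite (le_trans h1) // ler_nat (leq_trans (leq_maxr _ _) (leqnSn _)).
  rewrite eE; move: (pi : R) p0 h2 {h1} => p p0'.
  rewrite ler_pdivrMr // => h2; rewrite ltr_pdivrMr ?mulr_gt0 //.
  have : 0 < N%:R * r by rewrite mulr_gt0.
  by lra.
move: er; rewrite !lt_min => /andP[/andP[er1 er2] /andP[er3 er4]].
have eN : eps * N%:R < 2.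
  have -> : eps * N%:R = pi / 2 by rewrite eE; move: (pi : R) => p; field; rewrite gt_eqF.
  exact: pihalf_lt2.
have cov (f : R -> R) : (forall x y, `|y - x| <= 1 -> `|f y - f x| <= K * `|y - x| `^ alpha) ->
   covering_number (torus_graph f) eps <= eps `^ (- d) ->
   exists (n : nat) (c : 'I_n -> R * R), torus_graph f `<=` \bigcup_j disc (c j) eps /\
     n%:R <= eps `^ (- d) + 1.
  move=> hf hcov; have [n [cc [h1 h2]]] : exists (n : nat) (c : 'I_n -> R * R),
     torus_graph f `<=` \bigcup_j disc (c j) eps /\ n%:R <= covering_number (torus_graph f) eps + 1.
    apply: exists_cover.
    have [n [cc [h _]]] := hoelder_graph_cover K0 (ltW a0) (ltW a1) hf e0 er4.
    by exists n, cc.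
  by exists n, cc; split => //; lra.
have [x y xy|n1 [c1 [k1 m1]]] := cov (fun x => complex.Re (u x)) _ (hr1 _ e0 er1).
  by rewrite -ReB (le_trans (Re_le_normc _)) // hH.
have [x y xy|n2 [c2 [k2 m2]]] := cov (fun x => complex.Im (u x)) _ (hr2 _ e0 er2).
  by rewrite -ImB (le_trans (Im_le_normc _)) // hH.
pose Q := maxn Q0 (nceil eps^-1).+1.
have eQ : 1 <= eps * Q%:R.
  have ie : 0 <= eps^-1 by rewrite invr_ge0 ltW.
  have [h1 _] := nceilP ie.
  have h2 : eps^-1 <= Q%:R by rewrite (le_trans h1) // ler_nat (leq_trans (leqnSn _) (leq_maxr _ _)).
  by rewrite mulrC -ler_pdivrMr // mul1r.
have Qp : 0 < Q%:R :> R by rewrite -(pmulr_rgt0 _ e0) (lt_le_trans ltr01).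
have := le_trans (hQ0 Q (leq_maxl _ _)) (increments_le_covers e0 (ltW er4) eQ k1 k2).
rewrite ler_pM2r //.
pose E := eps `^ (1 - alpha); have E0 : 0 < E by rewrite powR_gt0.
pose X := eps `^ k; have X0 : 0 < X by rewrite powR_gt0.
have ene : eps != 0 by rewrite gt_eqF.
have pw a b : eps `^ a * eps `^ b = eps `^ (a + b).
  by rewrite powRD //; rewrite (negPf ene) implybT.
have mono a b : a <= b -> eps `^ b <= eps `^ a.
  by move=> ab; apply: ger_powR => //; rewrite e0 ltW.
have lhs : E / 2 <= N%:R `^ (alpha - 1).
  have -> : N%:R `^ (alpha - 1) = (N%:R `^ (1 - alpha))^-1 :> R by rewrite -powRN opprB.
  rewrite -[E / 2]invrK invf_div lef_pV2 ?posrE ?divr_gt0 ?powR_gt0 // ler_pdivlMr //.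
  rewrite -powRM ?(ltW e0) // mulrC.
  apply: (@le_trans _ _ (2 `^ (1 - alpha))).
    by apply: ge0_ler_powR; rewrite ?nnegrE ?mulr_ge0 ?(ltW e0) ?(ltW eN) //; move: a1; lra.
  by apply: ler1_powR; move: a0 a1; lra.
have e2 : eps ^+ 2 * eps `^ (- d) = E * X.
  by rewrite -(powR_mulrn 2 (ltW e0)) !pw; congr (_ `^ _); rewrite /k; lra.
have e3 : eps ^+ 2 <= E * X.
  by rewrite -(powR_mulrn 2 (ltW e0)) pw mono // /k; move: a0 a1 d0 d1; lra.
have e4 : eps `^ alpha * eps <= E * X.
  by rewrite -[X in _ * X](powRr1 (ltW e0)) !pw mono // /k; move: a0 a1 d0 d1; lra.
have X1 : X < c / (2 * (16 + 4 * K)).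
  have h1 : 0 <= r3 by exact: ltW.
  have := @gt0_ltr_powR R k k0 eps r3; rewrite !nnegrE (ltW e0) h1 => /(_ isT isT er3).
  by rewrite /r3 -powRrM mulVf ?gt_eqF // powRr1 // ltW.
rewrite ltr_pdivlMr in X1; last by rewrite mulr_gt0 //; move: K0; lra.
move=> fin.
have f1 : c * (E / 2) <= 4 * (eps ^+ 2 * (n1%:R + n2%:R)) + 4 * (K * (eps `^ alpha * eps)).
  apply: le_trans (_ : c * N%:R `^ (alpha - 1) <= _); first by rewrite ler_wpM2l // ltW.
  by move: fin; rewrite !mulrA.
have f2 : eps ^+ 2 * (n1%:R + n2%:R) <= 4 * (E * X).
  apply: (@le_trans _ _ (eps ^+ 2 * (2 * eps `^ (- d) + 2))).
    by rewrite ler_wpM2l ?sqr_ge0 //; lra.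
  rewrite mulrDr mulrCA e2; lra.
have f3 : K * (eps `^ alpha * eps) <= K * (E * X) by rewrite ler_wpM2l.
have f4 : E * c <= E * (X * (2 * (16 + 4 * K))) by lra.
by rewrite ler_pM2l // leNgt X1 in f4.
Qed.

End DimensionLowerBound.

(** * Numbers of Diophantine exponent 1 are Khinchin-Levy *)

Section DiophantineToKhinchinLevy.
Context {R : realType}.
Implicit Types (b eps : R) (a : int) (q r Q : nat).

Lemma dirichlet b Q : (0 < Q)%N ->
  exists q a, [/\ (0 < q <= Q)%N & `|q%:R * b - a%:~R| < Q%:R^-1].
Proof.
move=> Q0; have QR : 0 < Q%:R :> R by rewrite ltr0n.
pose fr (i : nat) : R := i%:R * b - (Num.floor (i%:R * b))%:~R.
have fr0 i : 0 <= fr i < 1.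
  have /andP[] := floor_itv (i%:R * b); rewrite /fr intrD.
  by move: (Num.floor _) => m h1 h2; apply/andP; split; lra.
have hb (i : 'I_Q.+1) : (Num.truncn (Q%:R * fr i) < Q)%N.
  have /andP[h1 h2] := fr0 i.
  have /andP[h _] := truncn_itv (mulr_ge0 (ltW QR) h1).
  by rewrite -(ltr_nat R) (le_lt_trans h) // -[ltRHS]mulr1 ltr_pM2l.
pose F (i : 'I_Q.+1) : 'I_Q := Ordinal (hb i).
have /injectivePn[x [y xy Fxy]] : ~~ injectiveb F.
  by apply/injectiveP => /leq_card; rewrite !card_ord ltnn.
wlog ltxy : x y xy Fxy / (x < y)%N.
  move=> h; have [lt|gt|/val_inj eq] := ltngtP x y; first exact: (h x y).
    by apply: (h y x) => //; rewrite eq_sym.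
  by rewrite eq eqxx in xy.
exists (y - x)%N, (Num.floor (y%:R * b) - Num.floor (x%:R * b)); split.
  by rewrite subn_gt0 ltxy (leq_trans (leq_subr _ _)) // -ltnS.
have /andP[hx _] := fr0 x; have /andP[hy _] := fr0 y.
have /andP[x1 x2] := truncn_itv (mulr_ge0 (ltW QR) hx).
have /andP[y1 y2] := truncn_itv (mulr_ge0 (ltW QR) hy).
have e : Num.truncn (Q%:R * fr x) = Num.truncn (Q%:R * fr y) by have := congr1 val Fxy.
rewrite e in x1 x2; move: (Num.truncn _) x1 x2 y1 y2 {e} => m x1 x2 y1 y2.
have -> : (y - x)%:R * b - (Num.floor (y%:R * b) - Num.floor (x%:R * b))%:~R = fr y - fr x.
  by rewrite natrB 1?ltnW // intrB /fr; ring.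
rewrite -(ltr_pM2l QR) mulfV ?gt_eqF // -[X in X * `|_|](gtr0_norm QR) -normrM mulrBr.
by rewrite -[m.+1%:R]natr1 in x2 y2; rewrite ltr_norml; apply/andP; split; lra.
Qed.

Lemma dirichlet_coprime b Q : (0 < Q)%N ->
  exists q a, [/\ (0 < q <= Q)%N, coprimez a q%:Z & `|q%:R * b - a%:~R| < Q%:R^-1].
Proof.
move=> Q0; have [q [a [/andP[q0 qQ] h]]] := dirichlet b Q0.
pose d := gcdn q `|a|; have d0 : (0 < d)%N by rewrite gcdn_gt0 q0.
have /dvdnP[q1 q1E] : (d %| q)%N by exact: dvdn_gcdl.
have /dvdnP[a1 a1E] : (d %| `|a|)%N by exact: dvdn_gcdr.
have q10 : (0 < q1)%N by move: q0; rewrite q1E muln_gt0 => /andP[].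
exists q1, ((-1) ^+ (a < 0)%R * a1%:Z); split.
- by rewrite q10 (leq_trans _ qQ) // q1E leq_pmulr.
- rewrite coprimezE abszMsign /= coprime_sym /coprime.
  by rewrite -(eqn_pmul2r d0) muln_gcdl -q1E -a1E mul1n.
- have dR : 1 <= d%:R :> R by rewrite ler1n.
  apply: le_lt_trans h; have -> : (a%:~R : R) = d%:R * ((-1) ^+ (a < 0)%R * a1%:Z)%:~R.
    by rewrite [in LHS](intEsign a) a1E PoszM !intrM mulrA mulrC.
  have -> : q%:R = d%:R * q1%:R :> R by rewrite [in LHS]q1E natrM mulrC.
  rewrite -mulrA -mulrBr normrM (gtr0_norm (lt_le_trans ltr01 dR)).
  by rewrite -[leLHS]mul1r ler_wpM2r.
Qed.

Lemma irrational_dist b q : irrational b -> (0 < q)%N ->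
  exists2 Q, (0 < Q)%N & forall a, Q%:R^-1 <= `|q%:R * b - a%:~R|.
Proof.
move=> irr q0; have qR : 0 < q%:R :> R by rewrite ltr0n.
have nz a : q%:R * b - a%:~R != 0.
  apply: contra_notN irr; rewrite subr_eq0 => /eqP e; apply/rationalP; exists a, q.
  by rewrite -e mulrC mulKf // gt_eqF.
pose m := Num.floor (q%:R * b); have /andP[h1 h2] := floor_itv (q%:R * b); rewrite -/m in h1 h2.
have z1 := nz m; have z2 := nz (m + 1); rewrite intrD in h2 z2.
pose d := Num.min (q%:R * b - m%:~R) (m%:~R + 1 - q%:R * b).
have d0 : 0 < d by rewrite lt_min !lt_neqAle eq_sym z1 -subr_eq0 sub0r opprB z2 /=; apply/andP; split; lra.
have id0 : 0 < d^-1 by rewrite invr_gt0.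
have [h _] := nceilP (ltW id0).
exists (nceil d^-1).+1 => // a.
apply: (@le_trans _ _ d).
  by rewrite invf_ple ?posrE ?ltr0n // (le_trans h) // ler_nat.
have [am|am] := leP a m.
  have : a%:~R <= m%:~R :> R by rewrite ler_int.
  move=> am'; rewrite ger0_norm; last by lra.
  by rewrite ge_min; apply/orP; left; lra.
have : (m + 1)%:~R <= a%:~R :> R by rewrite ler_int lezD1.
rewrite intrD => am'; rewrite ler0_norm; last by lra.
by rewrite ge_min; apply/orP; right; lra.
Qed.

Lemma irrational_dist_upto b q : irrational b ->
  exists2 Q, (0 < Q)%N & forall r a, (0 < r <= q)%N -> Q%:R^-1 <= `|r%:R * b - a%:~R|.
Proof.
move=> irr; elim: q => [|q [Q Q0 hQ]].
  by exists 1%N => // r a; rewrite leqn0; case: r.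
have [Q' Q'0 hQ'] := irrational_dist irr (ltn0Sn q).
exists (maxn Q Q') => [|r a /andP[r0]]; first by rewrite leq_max Q0.
have le (P P' : nat) : (0 < P)%N -> (P <= P')%N -> P'%:R^-1 <= P%:R^-1 :> R.
  by move=> P0 PP; rewrite lef_pV2 ?posrE ?ltr0n ?ler_nat // (leq_trans P0).
rewrite leq_eqVlt => /predU1P[->|rq].
  by apply: le_trans (hQ' a); apply: le => //; exact: leq_maxr.
apply: le_trans (hQ r a _); last by rewrite r0.
by apply: le => //; exact: leq_maxl.
Qed.

(** Let [Q] be least such that all multiples [r b] with [r <= q] stay at distance at least [1 / Q]
    from the integers. Dirichlet at level [Q] gives a denominator [q' <= Q], which must exceed [q];
    minimality of [Q] bounds [q'] by the inverse distance of some earlier multiple, plus 1. *)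
Lemma next_approximation b q : irrational b -> (0 < q)%N -> exists q',
  [/\ (q < q')%N,
   exists a, coprimez a q'%:Z /\ `|b - a%:~R / q'%:R| <= (q'%:R ^+ 2)^-1 &
   exists r a, (0 < r <= q)%N /\ q'%:R <= `|r%:R * b - a%:~R|^-1 + 1].
Proof.
move=> irr q0.
pose P (Q : nat) := `[< (0 < Q)%N /\ forall r a, (0 < r <= q)%N -> Q%:R^-1 <= `|r%:R * b - a%:~R| >].
have exP : exists Q, P Q.
  by have [Q Q0 hQ] := irrational_dist_upto q irr; exists Q; apply/asboolP.
case: (ex_minnP exP) => Q /asboolP[Q0 hQ] minQ.
have [q' [a [/andP[q'0 q'Q] cop h]]] := dirichlet_coprime b Q0.
have qR : 0 < q'%:R :> R by rewrite ltr0n.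
exists q'; split.
- rewrite ltnNge; apply/negP => q'q; have := hQ q' a; rewrite q'0 q'q => /(_ isT).
  by rewrite leNgt h.
- exists a; split => //.
  have -> : b - a%:~R / q'%:R = (q'%:R * b - a%:~R) / q'%:R.
    by rewrite mulrBl [q'%:R * b]mulrC mulfK ?gt_eqF.
  rewrite normrM normfV (gtr0_norm qR) expr2 invfM ler_wpM2r ?invr_ge0 ?(ltW qR) //.
  rewrite (le_trans (ltW h)) // lef_pV2 ?posrE ?ltr0n // ler_nat //.
- have [Q1|Q1] := leqP Q 1.
    exists 1%N, 0; split => //; rewrite (@le_trans _ _ 1) ?lerDr ?invr_ge0 //.
    by rewrite (ler_nat R q' 1) (leq_trans q'Q).
  have : ~~ P Q.-1 by apply/negP => /minQ; rewrite leqNgt prednK // leqnn.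
  move=> /asboolPn; rewrite -ltnS prednK // => np.
  have {np} : exists r a, (0 < r <= q)%N /\ ~~ (Q.-1%:R^-1 <= `|r%:R * b - a%:~R|).
    apply: contrapT => no; apply: np; split => // r a2 rq.
    by apply: contrapT => /negP nle; apply: no; exists r, a2.
  move=> [r [a' [rq]]]; rewrite -ltNge => lt; exists r, a'; split => //.
  have Q'0 : 0 < Q.-1%:R :> R by rewrite ltr0n -ltnS prednK.
  have x0 : 0 < `|r%:R * b - a'%:~R|.
    by have := hQ r a' rq; apply: lt_le_trans; rewrite invr_gt0 ltr0n.
  rewrite (@le_trans _ _ (Q.-1%:R + 1)) //.
    by rewrite natr1 ler_nat prednK.
  by rewrite lerD2r ltW // -[ltLHS]invrK ltf_pV2 ?posrE ?invr_gt0.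
Qed.

(** Iterate [next_approximation]: the Diophantine lower bound, used with exponent [1 + eps / 2],
    turns its last clause into [q' <= q^(1 + eps)], the spare [eps / 2] absorbing constants.
    Rational [b] are excluded since infinitely many of their multiples are integers. *)
Lemma khinchin_levy_of_diophantine b :
  (forall eps, 0 < eps -> exists q0, forall q a, (q0 <= q)%N -> (0 < q)%N ->
      q%:R `^ (- (1 + eps)) <= `|q%:R * b - a%:~R|) -> khinchin_levy b.
Proof.
move=> H.
have irr : irrational b.
  move=> /rationalP[a [p bE]]; have [q0 hq0] := H 1 ltr01.
  (* The denominator given by [rationalP] may be 0; then [b = 0] by the convention for inverses. *)
  have [p0|p0] := posnP p.
    have := hq0 q0.+1 0 (leqnSn _) isT.
    rewrite bE p0 invr0 !mulr0 subrr normr0 => h.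
    have : 0 < q0.+1%:R `^ (- (1 + 1)) :> R by rewrite powR_gt0.
    by lra.
  have := hq0 (p * q0.+1)%N (a * q0.+1%:Z) _ _.
  rewrite muln_gt0 p0 => /(_ _ isT).
  have le : (q0 <= p * q0.+1)%N by rewrite (leq_trans (leqnSn _)) // leq_pmull.
  move=> /(_ le).
  have -> : (p * q0.+1)%:R * b - (a * q0.+1%:Z)%:~R = 0.
    rewrite bE natrM intrM -pmulrn; have pR : p%:R != 0 :> R by rewrite pnatr_eq0 -lt0n.
    by rewrite mulrAC mulrCA divff // mulr1 mulrC subrr.
  have : 0 < (p * q0.+1)%:R `^ (- (1 + 1)) :> R by rewrite powR_gt0 // ltr0n muln_gt0 p0.
  by rewrite normr0; lra.
split => //.
pose rel q q' := (0 < q)%N -> [/\ (q < q')%N,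
   exists a, coprimez a q'%:Z /\ `|b - a%:~R / q'%:R| <= (q'%:R ^+ 2)^-1 &
   exists r a, (0 < r <= q)%N /\ q'%:R <= `|r%:R * b - a%:~R|^-1 + 1].
have /choice[nx hnx] q : exists q', rel q q'.
  have [q0|q0] := posnP q; first by exists 0%N; rewrite /rel q0.
  by have [q' h] := next_approximation irr q0; exists q'.
pose s n := iter n.+1 nx 1%N.
have s0 n : (0 < s n)%N.
  elim: n => [|n ih]; first by have [h _ _] := hnx 1%N isT; apply: leq_trans h.
  by have [h _ _] := hnx (s n) ih; apply: leq_trans h; rewrite ltnS.
have sn n : (n < s n)%N.
  elim: n => [|n ih]; first exact: s0.
  by have [h _ _] := hnx (s n) (s0 n); apply: leq_ltn_trans h.
exists s; split => //.
- by move=> n; have [] := hnx (s n) (s0 n).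
- move=> eps e0; have e2 : 0 < eps / 2 by rewrite divr_gt0.
  have [q0 hq0] := H _ e2.
  have [C C0 hC] := irrational_dist_upto q0 irr.
  (* Beyond this index [q^(eps / 2) >= C + 2], where [C] bounds the inverse distances for the
     finitely many [r] below [q0]. *)
  exists (nceil ((C%:R + 2) `^ (eps / 2)^-1)) => n hn.
  have [_ _ [r [a [/andP[r0 rs] h]]]] := hnx (s n) (s0 n).
  rewrite -/(s n.+1) in h; apply: (le_trans h).
  set x := `|_| in h *.
  have [nR _] := nceilP (powR_ge0 (C%:R + 2 : R) (eps / 2)^-1).
  pose q : R := (s n)%:R.
  have q1 : 1 <= q by rewrite ler1n.
  have Y1 : 1 <= q `^ (1 + eps / 2).
    by rewrite -[leLHS](powRr0 q) ler_powR //; lra.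
  have Y2 : C%:R + 2 <= q `^ (eps / 2).
    have h1 : (C%:R + 2) `^ (eps / 2)^-1 <= q.
      by rewrite (le_trans nR) // ler_nat (leq_trans (ltnW hn)) // ltnW.
    have := @ge0_ler_powR R (eps / 2) (ltW e2) ((C%:R + 2) `^ (eps / 2)^-1) q.
    rewrite -powRrM mulVf ?gt_eqF // powRr1 ?addr_ge0 //; apply => //.
      by rewrite nnegrE powR_ge0.
    by rewrite nnegrE (le_trans ler01).
  have -> : q `^ (1 + eps) = q `^ (1 + eps / 2) * q `^ (eps / 2).
    rewrite -powRD; first by congr (_ `^ _); lra.
    by rewrite (gt_eqF (lt_le_trans ltr01 q1)) implybT.
  have hx : x^-1 <= C%:R + q `^ (1 + eps / 2).
    have [rq|rq] := leqP q0 r.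
      have h1 := hq0 r a rq r0; rewrite -/x in h1.
      have p0 : 0 < r%:R `^ (- (1 + eps / 2)) :> R by rewrite powR_gt0 // ltr0n.
      rewrite (@le_trans _ _ (q `^ (1 + eps / 2))) ?lerDr //.
      rewrite (@le_trans _ _ (r%:R `^ (1 + eps / 2))) //.
        rewrite powRN in h1 p0; rewrite -[leRHS]invrK lef_pV2 ?posrE //.
        exact: lt_le_trans h1.
      by apply: ge0_ler_powR; rewrite ?nnegrE ?ler_nat ?(le_trans ler01 q1) //; lra.
    have h1 := hC r a; rewrite r0 (ltnW rq) -/x in h1; have {}h1 := h1 isT.
    have c0 : 0 < C%:R^-1 :> R by rewrite invr_gt0 ltr0n.
    rewrite (@le_trans _ _ C%:R) ?lerDl ?powR_ge0 //.
    by rewrite -[leRHS]invrK lef_pV2 ?posrE // (lt_le_trans c0).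
  have : q `^ (1 + eps / 2) * (C%:R + 2) <= q `^ (1 + eps / 2) * q `^ (eps / 2).
    by rewrite ler_wpM2l // powR_ge0.
  have C1 : 0 <= C%:R :> R by [].
  have : C%:R * 1 <= C%:R * q `^ (1 + eps / 2) by rewrite ler_wpM2l.
  by move: (q `^ (1 + eps / 2)) (q `^ (eps / 2)) Y1 hx => Y Z Y1; lra.
- move=> [|n]; first by have [_ [a ha] _] := hnx 1%N isT; exists a.
  by have [_ [a ha] _] := hnx (s n) (s0 n); exists a.
Qed.

End DiophantineToKhinchinLevy.

(** * Almost every time is Khinchin-Levy *)

Section AlmostEveryTime.
Context {R : realType}.
Implicit Types (t x y : R) (q i : nat).

Local Notation mu := (@lebesgue_measure R).

Lemma sum_powRN (eps : R) (n : nat) : 0 < eps ->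
  \sum_(0 <= q < n) q.+1%:R `^ (- eps - 1) <= 1 + eps^-1 :> R.
Proof.
move=> e0; have i0 : 0 < eps^-1 by rewrite invr_gt0.
have [->|n0] := posnP n; first by rewrite big_geq // addr_ge0 // ltW.
suff : \sum_(0 <= q < n) q.+1%:R `^ (- eps - 1) <= 1 + eps^-1 * (1 - n%:R `^ (- eps)) :> R.
  have : 0 <= eps^-1 * n%:R `^ (- eps) :> R by rewrite mulr_ge0 ?powR_ge0 // ltW.
  by rewrite mulrBr mulr1; lra.
elim: n n0 => // -[_ _|n ih _]; first by rewrite big_nat1 !powR1 subrr mulr0 addr0.
rewrite big_nat_recr //=; have := ih isT; have := powRN_telescope e0 (ltn0Sn n).
set a := n.+2%:R `^ (- eps); set b := n.+1%:R `^ (- eps); set d := n.+2%:R `^ _.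
set S := \sum_(0 <= q < n.+1) _ => h1 h2.
have h3 : d <= eps^-1 * (b - a) by rewrite mulrC ler_pdivlMr // mulrC.
by apply: (le_trans (lerD h2 h3)); rewrite -addrA lerD2l -mulrDr; lra.
Qed.

Section Negligible.
Variables (f : R -> R) (J : set R) (D B eps : R).
Hypotheses (D0 : 0 < D) (e0 : 0 < eps).
Hypothesis hf : forall t1 t2, J t1 -> J t2 -> `|t1 - t2| <= D * `|f t1 - f t2|.
Hypothesis hB : forall t, J t -> `|f t| <= B.

(** Borel-Cantelli. As [f] contracts distances by at most the factor [D], the times for which [f t]
    is within [P q / q] of a given fraction lie in an interval of length [4 D P q / q]. Boundedness
    of [f] leaves O([q]) numerators, so the total length at denominator [q] is O([q^(- 1 - eps)]),
    which is summable. *)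
Lemma well_approximable_negligible : mu.-negligible
  [set t | J t /\ forall q0, exists q (a : int), [/\ (q0 <= q)%N, (0 < q)%N &
      `|q%:R * f t - a%:~R| < q%:R `^ (- (1 + eps))]].
Proof.
pose b := (nceil (`|B| + 1)).+1.
have bB : B + 1 <= b%:R.
  have [h _] := nceilP (addr_ge0 (normr_ge0 B) ler01).
  by rewrite (@le_trans _ _ (nceil (`|B| + 1))%:R) ?ler_nat // (le_trans _ h) // lerD2r ler_norm.
pose P q : R := q.+1%:R `^ (- (1 + eps)).
have P0 q : 0 < P q by rewrite powR_gt0.
have P1 q : P q <= 1.
  rewrite /P powRN invf_le1 ?powR_gt0 // -[leLHS](powRr0 q.+1%:R) ler_powR ?ler1n //.
  by move: e0; lra.
pose d q : R := 2 * D * (P q / q.+1%:R).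
have d0 q : 0 < d q by rewrite mulr_gt0 ?mulr_gt0 // divr_gt0.
(* Denominators are shifted by 1 to be positive, and numerators between [- q b] and [q b] are
   indexed by naturals. *)
pose E q i := [set t | J t /\ `|q.+1%:R * f t - (i%:Z - (q.+1 * b)%:Z)%:~R| < P q].
have cov (p : nat * nat) : exists t0, E p.1 p.2 `<=` `[t0 - d p.1, t0 + d p.1].
  have [[t0 [Jt0 ht0]]|no] := pselect (E p.1 p.2 !=set0); last first.
    by exists 0 => t Et; case: no; exists t.
  exists t0 => t [Jt ht] /=; rewrite in_itv /= -ler_distl.
  apply: (le_trans (hf Jt Jt0)); rewrite /d [2 * D]mulrC -mulrA ler_wpM2l ?(ltW D0) //.
  have qR : 0 < p.1.+1%:R :> R by [].
  rewrite mulrA ler_pdivlMr // -[X in _ * X](gtr0_norm qR) -normrM.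
  rewrite mulrC mulrBr; move: ht ht0; set A := _%:~R.
  rewrite !ltr_norml => /andP[? ?] /andP[? ?]; rewrite ler_norml; apply/andP; split; lra.
have [c hc] := choice cov.
pose I q i : set R := `[c (q, i) - d q, c (q, i) + d q]%classic.
have mI q i : measurable (I q i) by exact: measurable_itv.
pose n q := (2 * (q.+1 * b) + 1)%N.
pose F q := \big[setU/set0]_(i < n q) I q i.
have mF q : measurable (F q) by apply: bigsetU_measurable => i _; exact: mI.
pose M : R := 12 * b%:R * D.
have M0 : 0 <= M by rewrite !mulr_ge0 // ltW.
have muF q : (mu (F q) <= (M * q.+1%:R `^ (- eps - 1))%:E)%E.
  apply: le_trans (@Boole_inequality _ _ _ mu (I q) (n q) (fun i _ => mI q i)) _.
  have -> : (\sum_(i < n q) mu (I q i) = \sum_(i < n q) (2 * d q)%:E)%E.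
    apply: eq_bigr => i _; rewrite lebesgue_measure_itv /= lte_fin.
    have -> : c (q, nat_of_ord i) - d q < c (q, nat_of_ord i) + d q by have := d0 q; lra.
    by rewrite -EFinB; congr (_%:E); lra.
  rewrite sumEFin lee_fin sumr_const card_ord -[leLHS](mulr_natl (2 * d q) (n q)).
  have -> : q.+1%:R `^ (- eps - 1) = P q by rewrite /P; congr (_ `^ _); lra.
  have nq : (n q)%:R <= 3 * (q.+1%:R * b%:R) :> R.
    rewrite /n natrD !natrM; have : 1 <= q.+1%:R * b%:R :> R by rewrite -natrM ler1n muln_gt0.
    by move: (_ * _ : R) => z; lra.
  have dq : 0 <= 2 * d q by rewrite mulr_ge0 // ltW.
  apply: (le_trans (ler_wpM2r dq nq)); rewrite /d /M.
  have z0 : q.+1%:R != 0 :> R by rewrite pnatr_eq0.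
  rewrite le_eqVlt; apply/orP; left; apply/eqP.
  by move: (P q) (b%:R) (q.+1%:R) z0 => p b' z z0; field.
have fin : (\sum_(q <oo) mu (F q) < +oo)%E.
  apply: (@le_lt_trans _ _ (M * (1 + eps^-1))%:E); last by rewrite ltry.
  apply: (@le_trans _ _ (\sum_(q <oo) (M * q.+1%:R `^ (- eps - 1))%:E)%E).
    by apply: lee_nneseries => // q _; exact: muF.
  apply: lime_le.
    by apply: is_cvg_nneseries => q _ _; rewrite lee_fin mulr_ge0 // powR_ge0.
  apply: nearW => m; rewrite sumEFin lee_fin -mulr_sumr ler_wpM2l //.
  exact: sum_powRN.
have null : mu (lim_sup_set F) = 0%E by exact: (@lim_sup_set_cvg0 _ _ _ mu F mF fin).
apply: (@negligibleS _ _ _ mu (lim_sup_set F)); last first.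
  apply/negligibleP => //.
  by apply: bigcap_measurable => // k _; apply: bigcup_measurable => j _; exact: mF.
move=> t [Jt ht] k _; have [[|q] [a [kq _ h]]] := ht k.+1 => //.
exists q => //=; rewrite /F -bigcup_mkord /=.
have qR : 1 <= q.+1%:R :> R by rewrite ler1n.
have qp := lt_le_trans ltr01 qR.
have aq : `|a%:~R| <= (q.+1 * b)%:R :> R.
  have h1 := hB Jt; have h2 := P1 q; rewrite natrM.
  have : `|q.+1%:R * f t| <= q.+1%:R * B by rewrite normrM (gtr0_norm qp) ler_pM2l.
  have : q.+1%:R * (B + 1) <= q.+1%:R * b%:R by rewrite ler_pM2l.
  rewrite -/(P q) in h; rewrite mulrDr mulr1.
  move: h; rewrite ltr_norml !ler_norml => /andP[? ?] ? /andP[? ?].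
  by apply/andP; split; lra.
rewrite -intr_norm -[(q.+1 * b)%:R]/((q.+1 * b)%:Z%:~R) ler_int in aq.
have [i ai] : exists i : nat, a + (q.+1 * b)%:Z = i%:Z.
  exists (absz (a + (q.+1 * b)%:Z)); rewrite gez0_abs //.
  by move: aq; rewrite ler_norml => /andP[aq _]; rewrite -lerBlDr sub0r.
exists i => /=.
  rewrite /n addn1 ltnS mul2n -addnn -lez_nat -ai PoszD lerD2r.
  by move: aq; rewrite ler_norml => /andP[_].
apply: (hc (q, i)) => /=; split => //.
by rewrite -ai addrK.
Qed.

End Negligible.

(** The difference of the inverse squares is [(x + y) / (x y)^2] times [y - x], and that factor is
    at least [N^-5] on the given range. *)
Lemma inverse_square_expands (kappa N x y : R) : 0 < kappa -> 0 < N ->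
  N^-1 <= x <= N -> N^-1 <= y <= N ->
  `|x - y| <= (N ^+ 5 / kappa) * `|kappa * x ^- 2 - kappa * y ^- 2|.
Proof.
move=> k0 N0 /andP[x1 x2] /andP[y1 y2].
have iN : 0 < N^-1 by rewrite invr_gt0.
have x0 : 0 < x by exact: lt_le_trans x1.
have y0 : 0 < y by exact: lt_le_trans y1.
have -> : kappa * x ^- 2 - kappa * y ^- 2 = (kappa * ((x + y) / (x * y) ^+ 2)) * (y - x).
  by field; rewrite !gt_eqF.
have xy0 : 0 < (x * y) ^+ 2 by rewrite exprn_gt0 // mulr_gt0.
have z0 : 0 <= kappa * ((x + y) / (x * y) ^+ 2).
  by rewrite mulr_ge0 ?(ltW k0) // divr_ge0 ?(ltW xy0) // addr_ge0 // ltW.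
rewrite normrM (ger0_norm z0) distrC [leRHS]mulrA ler_peMl //.
rewrite mulrA divfK ?gt_eqF // mulrA ler_pdivlMr // mul1r.
have h1 : (x * y) ^+ 2 <= (N * N) ^+ 2.
  by rewrite ler_pXn2r ?nnegrE ?mulr_ge0 ?(ltW x0) ?(ltW y0) ?(ltW N0) // ler_pM ?(ltW x0) ?(ltW y0).
have h2 : 1 <= N * (x + y).
  by rewrite -[leLHS](mulfV (lt0r_neq0 N0)) ler_pM2l // (le_trans x1) // lerDl ltW.
apply: (le_trans h1); have -> : N ^+ 5 * (x + y) = (N * N) ^+ 2 * (N * (x + y)) by ring.
by rewrite ler_peMr // sqr_ge0.
Qed.

Lemma khinchin_levy_ae :
  {ae mu, forall t : R, khinchin_levy (4 / 27 * (t / (2 * pi)) ^- 2)}.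
Proof.
pose kappa : R := 4 / 27 * (2 * pi) ^+ 2.
have p0 : 0 < 2 * pi :> R by rewrite mulr_gt0 // pi_gt0.
have k0 : 0 < kappa by rewrite mulr_gt0 ?exprn_gt0 // divr_gt0.
pose f t := kappa * t ^- 2.
have fE t : 4 / 27 * (t / (2 * pi)) ^- 2 = f t.
  by rewrite /f /kappa expr_div_n invf_div mulrA.
(* Nonzero times are exhausted by countably many ranges, with [s] the sign and [|t|] between
   [1 / (m + 1)] and [m + 1], on which [f] is bounded and expanding; the exponents are exhausted by
   [1 + 1 / (k + 1)]. *)
pose J (s : bool) (m : nat) : set R := [set t | m.+1%:R^-1 <= (-1) ^+ s * t <= m.+1%:R].
pose bad s m k := [set t | J s m t /\ forall q0, exists q (a : int),
   [/\ (q0 <= q)%N, (0 < q)%N & `|q%:R * f t - a%:~R| < q%:R `^ (- (1 + k.+1%:R^-1))]].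
have nbad s m k : mu.-negligible (bad s m k).
  have N0 : 0 < m.+1%:R :> R by [].
  have fs t : f t = f ((-1) ^+ s * t) by rewrite /f exprMn sqrr_sign mul1r.
  apply: (@well_approximable_negligible f (J s m) (m.+1%:R ^+ 5 / kappa) (kappa * m.+1%:R ^+ 2)).
  - by rewrite divr_gt0 // exprn_gt0.
  - by rewrite invr_gt0.
  - move=> t1 t2 J1 J2; rewrite (fs t1) (fs t2).
    have -> : `|t1 - t2| = `|(-1) ^+ s * t1 - (-1) ^+ s * t2| by rewrite -mulrBr normrMsign.
    exact: inverse_square_expands.
  - move=> t /andP[t1 t2]; rewrite fs; have i0 : 0 < m.+1%:R^-1 :> R by rewrite invr_gt0.
    have t0 := lt_le_trans i0 t1.
    rewrite ger0_norm; last by apply: mulr_ge0; [exact: ltW|rewrite invr_ge0 sqr_ge0].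
    rewrite ler_pM2l // -[leRHS]invrK lef_pV2 ?posrE ?invr_gt0 ?exprn_gt0 //.
    by rewrite -exprVn ler_pXn2r ?nnegrE ?(ltW i0) ?(ltW t0).
change (mu.-negligible (~` [set t | khinchin_levy (4 / 27 * (t / (2 * pi)) ^- 2)])).
apply: (@negligibleS _ _ _ mu ([set (0 : R)] `|`
   \bigcup_m \bigcup_k (bad false m k `|` bad true m k))); last first.
  apply: negligibleU.
    by apply/negligibleP; [exact: measurable_set1|exact: lebesgue_measure_set1].
  apply: negligible_bigcup => m; apply: negligible_bigcup => k.
  exact: negligibleU.
move=> t /= nkl; have [->|t0] := eqVneq t 0; [by left|right].
apply: contrapT => nb; apply: nkl; rewrite fE; apply: khinchin_levy_of_diophantine => eps e0.
pose m := nceil (`|t| + `|t|^-1).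
pose k := nceil eps^-1.
have at0 : 0 < `|t| by rewrite normr_gt0.
have ai0 : 0 < `|t|^-1 by rewrite invr_gt0.
have Jt : J (t < 0) m t.
  rewrite /J /= -normrEsign.
  have [h _] := nceilP (ltW (addr_gt0 at0 ai0)); rewrite -/m in h.
  have hm : m%:R <= m.+1%:R :> R by rewrite ler_nat.
  rewrite invf_ple ?posrE ?ltr0n //; apply/andP; split; lra.
have ke : k.+1%:R^-1 <= eps.
  rewrite invf_ple ?posrE ?ltr0n //.
  have ie0 : 0 <= eps^-1 by rewrite invr_ge0 ltW.
  have [h _] := nceilP ie0.
  by rewrite (le_trans h) // ler_nat.
have : ~ bad (t < 0) m k t.
  by move=> hbad; apply: nb; exists m => //; exists k => //; case: (t < 0) hbad; [right|left].
move=> nbt; apply: contrapT => no; apply: nbt; split => // q0.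
apply: contrapT => no2; apply: no; exists q0 => q a q0q qp.
rewrite leNgt; apply/negP => lt; apply: no2; exists q, a; split => //.
apply: lt_le_trans lt _; rewrite ler_powR ?ler1n // lerN2 lerD2l //.
Qed.

End AlmostEveryTime.

(** * Dimension bounds from an exponential sum bound, and the theorem *)

Section DimensionOfEvolution.
Context {R : realType}.

Lemma dimension_bounds (t alpha : R) (g : R -> R[i]) :
  step_function g -> nonconstant g -> 0 < alpha -> alpha < 1 -> sum_bound t alpha ->
  exists2 u, continuous_representative (@omega_gc R) t g u &
    ((1 + alpha)%:E <= D_ t (@omega_gc R) g)%E /\ (D_ t (@omega_gc R) g <= (2 - alpha)%:E)%E.
Proof.
move=> gs gn a0 a1 sb.
have [L [hL [y0 hE] hg]] := fourier_coef_step gs gn.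
have [u [K [K0 hu hH]]] := exists_profile a0 a1 sb hg.
have cr := profile_representative a0 K0 hu hH.
exists u => //; rewrite /D_ (evolution_eq cr); split.
  have [c c0 hI] := increment_lower_bound a0 a1 K0 sb hL hE hg hu.
  exact: (fractal_dim_lower a0 a1 K0 hH (profile_cts a0 K0 hH) c0 hI).
rewrite ge_max; apply/andP; split.
  apply: (fractal_dim_hoelder K0 (ltW a0) (ltW a1)) => x y xy.
  by rewrite -ReB (le_trans (Re_le_normc _)) // hH.
apply: (fractal_dim_hoelder K0 (ltW a0) (ltW a1)) => x y xy.
by rewrite -ImB (le_trans (Im_le_normc _)) // hH.
Qed.

End DimensionOfEvolution.

Local Close Scope complex_scope.
Unset Implicit Arguments.

Theorem mainTheorem16 (R : realType) (g : R -> R[i])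
    (g_step : step_function g) (g_nonconstant : nonconstant g) :
  [/\ forall t : R, t != 0 ->
        [/\ exists u : R -> R[i],
              continuous_representative (@omega_gc R) t g u,
            ((5 / 4)%:E <= D_ t (@omega_gc R) g)%E &
            (D_ t (@omega_gc R) g <= (7 / 4)%:E)%E],
      forall t : R, t != 0 ->
        khinchin_levy (4 / 27 * (t / (2 * pi)) ^- 2) ->
        ((11 / 8)%:E <= D_ t (@omega_gc R) g)%E /\
        (D_ t (@omega_gc R) g <= (13 / 8)%:E)%E &
      {ae lebesgue_measure, forall t : R,
        khinchin_levy (4 / 27 * (t / (2 * pi)) ^- 2)}].
Proof.
split.
- move=> t t0.
  have q0 : 0 < 1 / 4 :> R by lra.
  have q1 : 1 / 4 < 1 :> R by lra.
  have [u hu [h1 h2]] := dimension_bounds g_step g_nonconstant q0 q1 (sum_bound_quarter t0).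
  split; first by exists u.
    by apply: le_trans h1; rewrite lee_fin; lra.
  by apply: (le_trans h2); rewrite lee_fin; lra.
- move=> t t0 kl.
  (* Only exponents below 3/8 are available, so both inequalities are proved up to an arbitrary
     [e > 0]. *)
  have key (e : R) : 0 < e -> ((11 / 8)%:E <= D_ t (@omega_gc R) g + e%:E)%E /\
      (D_ t (@omega_gc R) g <= (13 / 8 + e)%:E)%E.
    move=> e0; pose eta := Num.min (1 / 4) e.
    have n0 : 0 < eta by rewrite lt_min e0 andbT; lra.
    have n1 : eta <= 1 / 4 by rewrite ge_min lexx.
    have n2 : eta <= e by rewrite ge_min lexx orbT.
    have sb := sum_bound_khinchin_levy t0 n0 n1 kl.
    have q0 : 0 < 3 / 8 - eta / 2 by lra.
    have q1 : 3 / 8 - eta / 2 < 1 by lra.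
    have [_ _ [h1 h2]] := dimension_bounds g_step g_nonconstant q0 q1 sb.
    split; last by apply: (le_trans h2); rewrite lee_fin; lra.
    rewrite -leeBlDr // -EFinB; apply: le_trans h1; rewrite lee_fin; lra.
  split; apply/lee_addgt0Pr => e e0; have [h1 h2] := key e e0 => //.
- exact: khinchin_levy_ae.
Qed.
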